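(* Let $\Phi:\mathcal N\to\mathcal N_t$ be the $\mathcal L$-linear isomorphism with $\Phi(\underline N_w)=\underline w$ for $w\in W^{\mathfrak p}$. Then for every $0\le i\le n-1$ and every $h\in\mathcal N$ we have $\Phi(hC_{s_i})=e_i\cdot\Phi(h)$. Moreover, the action of $\mathbb{DT}_n$ on $\mathcal N_t$ factors through the algebra $\widehat{\operatorname{TL}}(W)$, and the resulting action of $\widehat{\operatorname{TL}}(W)$ on $\mathcal N_t$ is faithful.
   Context: Let $n\ge4$, $\mathcal L=\mathbb Z[q,q^{-1}]$. $W$ is the Weyl group of type $D_n$ with simple reflections $S=\{s_0,\dots,s_{n-1}\}$ ($s_0,s_1$ both joined to $s_2$, $s_i$ joined to $s_{i+1}$ for $i\ge2$), length $l$, $S_{\mathfrak p}=\{s_1,\dots,s_{n-1}\}$, $W_{\mathfrak p}=\langle S_{\mathfrak p}\rangle$, $W^{\mathfrak p}=\{w\mid l(sw)>l(w)\ \forall s\in S_{\mathfrak p}\}$. Hecke module: $\mathcal H$ is the Hecke algebra of $W$ over $\mathcal L$ with basis $H_w$, $H_xH_y=H_{xy}$ if $l(xy)=l(x)+l(y)$, $H_s^2=(q^{-1}-q)H_s+H_e$, and $C_s=H_s+q$. $\mathcal N=\mathcal L\otimes_{\mathcal H_{\mathfrak p}}\mathcal H$, where $\mathcal H_{\mathfrak p}$ is spanned by $H_w$ ($w\in W_{\mathfrak p}$) and $C_s$ ($s\in S_{\mathfrak p}$) acts by $0$ on $\mathcal L$; it has basis $N_w=1\otimes H_w$, $w\in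 W^{\mathfrak p}$. The Kazhdan–Lusztig basis $\underline N_w$ is the unique basis of elements fixed by the involution induced by $H_w\mapsto H_{w^{-1}}^{-1}$, $q\mapsto q^{-1}$, with $\underline N_w\in N_w+\sum_{w'\ne w}q\mathbb Z[q]N_{w'}$. Diagrams: for $w\in W^{\mathfrak p}$ let $(\alpha_1,\dots,\alpha_n)=(+,\dots,+)\cdot w$ for the right action on $\{+,-\}^n$ where $s_i$ ($i\ge1$) swaps entries $i,i+1$ and $s_0$ sends $(a_1,a_2,\dots)$ to $(-a_2,-a_1,\dots)$. A decorated tangle is a collection of non-intersecting arcs and closed loops in a rectangle joining in pairs marked points on the top and bottom faces, up to isotopy, with dots on components each reachable from the left face without meeting the tangle. The decorated cup diagram $\underline w$ has $n$ top points labeled $\alpha_1,\dots,\alpha_n$: repeatedly join a not yet joined $+$ to the nearest not yet joined $-$ to its right (ignoring joined symbols) by an undotted cup; then join the remaining $-$'s pairwise from the left by cups carrying one dot; every remaining point gets a vertical edge to the bottom face, carrying one dot iff its label is $-$. $\mathcal N_t$ is the free $\mathcal L$-module with basis $\{\underline w\}$. $e_i$ ($1\le i\le n-1$) is the $(n,n)$-tangle with a cup joining top points $i,i+1$, a cap joining bottom points $i,i+1$, vertical lines elsewhere; $e_0$ is $e_1$ with one dot on its cup and one on its cap. $\mathbb T_n$ is the free $\mathcal L$-algebra on decorated $(n,n)$-tangles with multiplication by vertical concatenation; $\mathbb{DT}_n$ is the subalgebra generated by $e_0,\dots,e_{n-1}$. $\mathbb{DT}_n$ acts on $\mathcal N_t$: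 $e_i\cdot\underline w$ is obtained by placing $e_i$ on top of $\underline w$ and simplifying by: (i) an undotted closed loop is removed, multiplying by $q+q^{-1}$; (ii) two dots on one component are removed; (iii) a closed loop with exactly one dot gives $0$; (iv) an undotted component joining two bottom points gives $0$; (v) a component joining two bottom points with exactly one dot is removed. $\widehat{\operatorname{TL}}(W)$ is the quotient of $\mathbb{DT}_n$ by the local relations (i)–(iii) if $n$ is odd, and, if $n$ is even, additionally by the subspace spanned by all diagrams having no edges joining a top point to a bottom point and an odd number of undotted cups. *)

(* Defs.v *)
From HB Require Import structures.
From mathcomp Require Import all_boot all_order all_algebra all_fingroup.
From mathcomp Require Import fraction.
From Stdlib Require Import ClassicalEpsilon.
Set Implicit Arguments. Unset Strict Implicit. Unset Printing Implicit Defensive.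
Import Order.TTheory GRing.Theory Num.Theory.
Local Open Scope ring_scope.

Notation "x %:F" := (@FracField.tofrac _ x).
Definition Kq : fieldType := {fraction {poly int}}.
Definition Xq : Kq := ('X)%:F.
Definition is_laurent (x : Kq) : Prop :=
  exists (k : nat) (p : {poly int}), x * Xq ^+ k = p%:F.
Definition laurentb (x : Kq) : bool :=
  if excluded_middle_informative (is_laurent x) then true else false.
Lemma laurentbP x : reflect (is_laurent x) (laurentb x).
Proof. by rewrite /laurentb; case: excluded_middle_informative => h; constructor. Qed.
Definition laurent : {pred Kq} := fun x => laurentb x.
Lemma laurent_subring : subring_closed laurent.
Proof.
split.
- by apply/laurentbP; exists 0%N, 1; rewrite expr0 mulr1 rmorph1.
- move=> x y /laurentbP[a [p hp]] /laurentbP[b [r hr]]; apply/laurentbP.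
  exists (a + b)%N, (p * 'X^b - r * 'X^a).
  rewrite rmorphB !rmorphM /= -hp -hr !rmorphXn /= -/Xq exprD.
  by rewrite mulrBl -!mulrA [Xq ^+ b * _]mulrC.
- move=> x y /laurentbP[a [p hp]] /laurentbP[b [r hr]]; apply/laurentbP.
  exists (a + b)%N, (p * r).
  rewrite rmorphM /= -hp -hr exprD.
  by rewrite -!mulrA; congr (_ * _); rewrite mulrCA.
Qed.
HB.instance Definition _ := GRing.isSubringClosed.Build Kq laurent laurent_subring.
Record L := MkL { valL :> Kq; _ : valL \in laurent }.
HB.instance Definition _ := [isSub for valL].
HB.instance Definition _ := [Choice of L by <:].
HB.instance Definition _ := [SubChoice_isSubComNzRing of L by <:].

Definition lrep (x : Kq) : nat * {poly int} :=
  epsilon (inhabits (0%N, 0)) (fun kp => x * Xq ^+ kp.1 = kp.2%:F).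
(* x = p q^{-k}  |->  p(q^{-1}) q^k *)
Definition barK (x : Kq) : Kq :=
  (\sum_(i < size (lrep x).2) (((lrep x).2)`_i)%:~R * Xq^-1 ^+ i) * Xq ^+ (lrep x).1.
Definition barL (a : L) : L := insubd a (barK (val a)).
Definition qL : L := insubd 0 Xq.
Definition qiL : L := insubd 0 (Xq^-1).
Definition in_qZq (a : L) : Prop := exists p : {poly int}, val a = ('X * p)%:F.

(* The Weyl group W of type D_n, realised as even signed permutations  *)
Definition Pt (n : nat) := (bool * 'I_n)%type.
Definition ordpred n (i : 'I_n) : 'I_n :=
  Ordinal (leq_ltn_trans (leq_pred i) (ltn_ord i)).
(* 0-based positions acted on by s_i:  s_0,s_1 : (0,1);  s_i : (i-1,i) *)
Definition lo n (i : 'I_n) : 'I_n := if i == 0 :> nat then i else ordpred i.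
Definition hi n (i : 'I_n) : 'I_n := if i == 0 :> nat then insubd i 1%N else i.
Definition sref n (i : 'I_n) : {perm Pt n} :=
  if i == 0 :> nat then
    (tperm (false, lo i) (true, hi i) * tperm (true, lo i) (false, hi i))%g
  else (tperm (false, lo i) (false, hi i) * tperm (true, lo i) (true, hi i))%g.
Definition Wgrp n : {set {perm Pt n}} := <<[set sref i | i : 'I_n]>>%g.
Definition wprod n (t : seq 'I_n) : {perm Pt n} := (\prod_(i <- t) sref i)%g.
Definition lenW n (w : {perm Pt n}) : nat :=
  find (fun k => [exists t : k.-tuple 'I_n, w == wprod t])
       (iota 0 (#|{: {perm Pt n}}|).+1).
Definition Wp n : {set {perm Pt n}} :=
  [set w in Wgrp n | [forall i : 'I_n, (i != 0 :> nat) ==> (lenW w < lenW (sref i * w)%g)%N]].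
Definition redword n (w : {perm Pt n}) : seq 'I_n :=
  if [pick t : (lenW w).-tuple 'I_n | w == wprod t] is Some t then val t else [::].

(* Hecke algebra H (elements = L-linear combinations of H_w)            *)
Definition hk n := {ffun {perm Pt n} -> L}.
Definition scl (T : finType) (a : L) (f : {ffun T -> L}) : {ffun T -> L} :=
  [ffun x => a * f x].
Definition Hw n (w : {perm Pt n}) : hk n := [ffun x => (x == w)%:R].
Definition inH n (h : hk n) : Prop := forall x, x \notin Wgrp n -> h x = 0.
Definition HwHs n (w : {perm Pt n}) (i : 'I_n) : hk n :=
  if (lenW w < lenW (w * sref i)%g)%N then Hw (w * sref i)%g
  else Hw (w * sref i)%g + scl (qiL - qL) (Hw w).
Definition HsHw n (i : 'I_n) (w : {perm Pt n}) : hk n :=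
  if (lenW w < lenW (sref i * w)%g)%N then Hw (sref i * w)%g
  else Hw (sref i * w)%g + scl (qiL - qL) (Hw w).
Definition rmulHs n (h : hk n) (i : 'I_n) : hk n := \sum_w scl (h w) (HwHs w i).
Definition lmulHs n (i : 'I_n) (h : hk n) : hk n := \sum_w scl (h w) (HsHw i w).
Definition rmulCs n (h : hk n) (i : 'I_n) : hk n := rmulHs h i + scl qL h.
Definition lmulCs n (i : 'I_n) (h : hk n) : hk n := lmulHs i h + scl qL h.
Definition rmulHsinv n (h : hk n) (i : 'I_n) : hk n := rmulHs h i + scl (qL - qiL) h.
(* bar(H_w) = H_{w^{-1}}^{-1} = H_{s_1}^{-1} ... H_{s_k}^{-1} for a reduced word *)
Definition barHw n (w : {perm Pt n}) : hk n :=
  foldl (fun h i => rmulHsinv h i) (Hw 1%g) (redword w).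
Definition barH n (h : hk n) : hk n := \sum_(w in Wgrp n) scl (barL (h w)) (barHw w).

(* The parabolic module N = L (x)_{H_p} H is H modulo the kernel
   sum_{s in S_p} C_s H ; we work with representatives in H.           *)
Definition inKer n (x : hk n) : Prop :=
  exists hs : 'I_n -> hk n, (forall i, inH (hs i)) /\
    x = \sum_(i < n | i != 0 :> nat) lmulCs i (hs i).
Definition isKL n (u : hk n) (w : {perm Pt n}) : Prop :=
  [/\ inH u, inKer (barH u - u) &
      exists c : {perm Pt n} -> L, (forall x, in_qZq (c x)) /\
        inKer (u - (Hw w + \sum_(x in Wp n | x != w) scl (c x) (Hw x)))].

(* Diagrams: a matching on the top (false) / bottom (true) points      *)
(* (fixed points = unused points) and the dot parity of the component  *)
(* through each point.                                                 *)
Definition Dg n := ({ffun Pt n -> Pt n} * {ffun Pt n -> bool})%type.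
Definition Nt n := {ffun Dg n -> L}.
Definition delta n (d : Dg n) : Nt n := [ffun x => (x == d)%:R].

Definition eD n (i : 'I_n) : Dg n :=
  ([ffun x : Pt n => if x.2 == lo i then (x.1, hi i) else
                     if x.2 == hi i then (x.1, lo i) else (~~ x.1, x.2)],
   [ffun x : Pt n => (i == 0 :> nat) && ((x.2 == lo i) || (x.2 == hi i))]).
Definition idD n : Dg n := ([ffun x : Pt n => (~~ x.1, x.2)], [ffun _ => false]).

(* sign sequence (+,...,+).w ; true encodes '-' *)
Definition alpha n (w : {perm Pt n}) (j : 'I_n) : bool := ((w^-1)%g (false, j)).1.

Fixpoint pm (s : seq bool) (i : nat) (st : seq nat) : seq (nat * nat) * seq nat :=
  match s with
  | [::] => ([::], [::])
  | false :: s' => pm s' i.+1 (i :: st)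
  | true :: s' =>
      match st with
      | [::] => let r := pm s' i.+1 [::] in (r.1, i :: r.2)
      | j :: st' => let r := pm s' i.+1 st' in ((j, i) :: r.1, r.2)
      end
  end.
Fixpoint pairup (l : seq nat) : seq (nat * nat) :=
  match l with
  | a :: b :: l' => (a, b) :: pairup l'
  | _ => [::]
  end.
Definition partner_in (ps : seq (nat * nat)) (j : nat) : option nat :=
  if has (fun p => p.1 == j) ps then Some (nth (0, 0) ps (find (fun p => p.1 == j) ps)).2
  else if has (fun p => p.2 == j) ps then Some (nth (0, 0) ps (find (fun p => p.2 == j) ps)).1
  else None.
Definition signs n (w : {perm Pt n}) : seq bool := [seq alpha w j | j <- enum 'I_n].
Definition undotted_cups n (w : {perm Pt n}) := (pm (signs w) 0 [::]).1.
Definition dotted_cups n (w : {perm Pt n}) := pairup (pm (signs w) 0 [::]).2.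
Definition cup_partner n (w : {perm Pt n}) (j : 'I_n) : option 'I_n :=
  match partner_in (undotted_cups w) j with
  | Some k => Some (insubd j k)
  | None => if partner_in (dotted_cups w) j is Some k then Some (insubd j k) else None
  end.
Definition cup_dot n (w : {perm Pt n}) (j : 'I_n) : bool :=
  match partner_in (undotted_cups w) j with
  | Some _ => false
  | None => if partner_in (dotted_cups w) j is Some _ then true else alpha w j
  end.
(* the decorated cup diagram underline{w}; rays go from top j to bottom j *)
Definition cupD n (w : {perm Pt n}) : Dg n :=
  ([ffun x : Pt n => if x.1 then (if cup_partner w x.2 is None then (false, x.2) else x)
                     else (if cup_partner w x.2 is Some k then (false, k) else (true, x.2))],
   [ffun x : Pt n => if x.1 then (cup_partner w x.2 == None) && cup_dot w x.2
                     else cup_dot w x.2]).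

(* stacking A on top of B: points of levels 0 (top of A), 1 (middle),
   2 (bottom of B) *)
Definition Q n := ('I_3 * 'I_n)%type.
Definition lev0 : 'I_3 := ord0.
Definition lev1 : 'I_3 := inord 1.
Definition lev2 : 'I_3 := inord 2.
Definition embA n (p : Pt n) : Q n := (if p.1 then lev1 else lev0, p.2).
Definition embB n (p : Pt n) : Q n := (if p.1 then lev2 else lev1, p.2).
Definition edge n (D : Dg n) (emb : Pt n -> Q n) (x y : Q n) : bool :=
  [exists p : Pt n, [&& D.1 p != p, emb p == x & emb (D.1 p) == y]].
Definition adj n (A B : Dg n) : rel (Q n) :=
  fun x y => edge A (@embA n) x y || edge B (@embB n) x y.
Definition conn n (A B : Dg n) (x y : Q n) : bool := connect (adj A B) x y.
Definition dotw n (D : Dg n) (emb : Pt n -> Q n) (x : Q n) : bool :=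
  [exists p : Pt n, [&& D.1 p != p, emb p == x & D.2 p]].
(* dot parity of the component through x (each arc counted at both ends) *)
Definition cpar n (A B : Dg n) (x : Q n) : bool :=
  odd ((\sum_(y | conn A B x y) (dotw A (@embA n) y + dotw B (@embB n) y)) %/ 2).
Definition outer n (x : Q n) : bool := (x.1 == lev0) || (x.1 == lev2).
Definition ofQ n (x : Q n) : Pt n := (x.1 == lev2, x.2).
Definition toQ n (p : Pt n) : Q n := (if p.1 then lev2 else lev0, p.2).
Definition partnerQ n (A B : Dg n) (x : Q n) : option (Q n) :=
  [pick y | [&& outer y, y != x & conn A B x y]].
Definition compD n (A B : Dg n) : Dg n :=
  ([ffun p : Pt n => if partnerQ A B (toQ p) is Some y then ofQ y else p],
   [ffun p : Pt n => (partnerQ A B (toQ p) != None) && cpar A B (toQ p)]).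
(* closed loops (components inside the middle level), one representative each *)
Definition loops n (A B : Dg n) : {set 'I_n} :=
  [set j : 'I_n | ~~ [exists y, outer y && conn A B (lev1, j) y] &&
                  [forall k : 'I_n, conn A B (lev1, j) (lev1, k) ==> (j <= k)%N]].
(* relations (i)-(iii): undotted loop -> q+q^{-1}, dots mod 2, dotted loop -> 0 *)
Definition loopScal n (A B : Dg n) : L :=
  \prod_(j in loops A B) (if cpar A B (lev1, j) then 0 else qL + qiL).
(* relations (iv),(v) for components joining two bottom points *)
Definition bbScal n (C : Dg n) : L :=
  if [exists j : 'I_n, [&& C.1 (true, j) != (true, j), (C.1 (true, j)).1 &
                          ~~ C.2 (true, j)]] then 0 else 1.
(* normal form of a cup diagram: rays from top j to bottom j, no bottom-bottom arcs *)
Definition cupnorm n (C : Dg n) : Dg n :=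
  ([ffun x : Pt n => if x.1 then (if (C.1 (false, x.2)).1 then (false, x.2) else x)
                     else (if (C.1 (false, x.2)).1 then (true, x.2) else C.1 x)],
   [ffun x : Pt n => if x.1 then (C.1 (false, x.2)).1 && C.2 (false, x.2) else C.2 x]).
Definition actE n (i : 'I_n) (c : Dg n) : L * Dg n :=
  let C := compD (eD i) c in (loopScal (eD i) c * bbScal C, cupnorm C).
Definition actV n (i : 'I_n) (v : Nt n) : Nt n :=
  [ffun d => \sum_(c : Dg n) if (actE i c).2 == d then v c * (actE i c).1 else 0].

(* elements of DT_n written as L-combinations of words in the e_i;
   the word [:: i1; ...; ik] stands for e_{i1} e_{i2} ... e_{ik}        *)
Definition word n := seq 'I_n.
Definition actW n (t : word n) (v : Nt n) : Nt n := foldr (fun i v => actV i v) v t.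
Definition actF n (f : seq (L * word n)) (v : Nt n) : Nt n :=
  \sum_(x <- f) scl x.1 (actW x.2 v).
(* reduction of the tangle of a word modulo the local relations (i)-(iii) *)
Definition redW n (t : word n) : L * Dg n :=
  foldr (fun i acc => (loopScal (eD i) acc.2 * acc.1, compD (eD i) acc.2)) (1, idD n) t.
Definition rhoF n (f : seq (L * word n)) : {ffun Dg n -> L} :=
  [ffun D => \sum_(x <- f) if (redW x.2).2 == D then x.1 * (redW x.2).1 else 0].
(* reduced diagrams with no through strands and an odd number of undotted cups *)
Definition badD n (D : Dg n) : bool :=
  [forall j : 'I_n, ~~ (D.1 (false, j)).1] &&
  odd #|[set j : 'I_n | (j < (D.1 (false, j)).2)%N && ~~ D.2 (false, j)]|.
(* membership in the kernel of DT_n -> TLhat(W) *)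
Definition inKerTL n (f : seq (L * word n)) : Prop :=
  if odd n then rhoF f = 0 else forall D, rhoF f D != 0 -> badD D.

(* Main.v *)
(* Functions on even sign sequences form a module on which C_(s_i) acts by an
   operator Cop i, and it is a model of N with N_w the delta function at
   (+,...,+).w.  A planar diagram D defines a kernel Kd D on labels of its end
   points: labels incompatible with the arcs (equal along an undotted arc,
   distinct along a dotted one) get weight 0, and each arc contributes q if its
   right end is "+", where the bottom face is bent around the right face.
   Applying Cop i to Kd D gives Kd of the composite e_i D, a check on at most
   two arcs.  Hence the kernels Kc of the cup diagrams are permuted by Cop i as
   the cup diagrams are by e_i; they are unitriangular with off-diagonal
   entries in q Z[q], and fixed by the bar involution (since the C_(s_i) commute
   with it and the constant sequence is fixed), so they are the
   Kazhdan-Lusztig basis.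
   For faithfulness, a tangle acts by its kernel restricted to even labels.
   Give every arc of D that returns to its face its cheap orientation, and label
   all through strands "+" at the top, except possibly the leftmost one, which
   is used to make the label even.  Up to a common power of q, the entry of D
   there is 1, and another diagram has a unit entry there only if it has fewer
   returning arcs; so the coefficients of a vanishing combination vanish
   q-adically, by induction on the exponent and the number of returning arcs.
   The parity cannot be adjusted exactly when D has no through strand and an
   odd number of undotted cups, and such a D vanishes on all even labels. *)
Require Import Defs.
From HB Require Import structures.
From mathcomp Require Import all_boot all_order all_algebra all_fingroup.
From mathcomp Require Import fraction zify ring.
Import Order.TTheory GRing.Theory Num.Theory.
Set Implicit Arguments. Unset Strict Implicit. Unset Printing Implicit Defensive.
Local Open Scope ring_scope.

(** * Laurent polynomials *)

(** Composition of tangles is given by connectivity in a three-level graph, which is awkward to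
    compute with. It is evaluated once, for a generator on top of an arbitrary matching, as the
    local surgery [jn]; afterwards diagrams are handled through [jn] and two conditions on a line of
    points: no crossing, and no dotted arc under another. The second condition is essential for the
    weights: when the two arcs meeting the cap of e_i are nested, the local identity holds only if
    the inner one carries no dot. The operators [Cop] act on functions of all sign sequences, odd
    ones included, and preserve parity. This replaces topological parity arguments: that e_i maps
    cup diagrams of W^p to multiples of such diagrams, and that a word never mixes parities, is read
    off from the operators. The bar involution is treated as a relation between functions with
    conjugate coordinates and is compared with the inverses of the H_s one letter of a reduced word
    at a time. Lengths are inversion counts of signed permutations; on W^p they become sums of the
    positions of the minus signs. *)

Lemma Xq_neq0 : Xq != 0.
Proof. by rewrite tofrac_eq0 polyX_eq0. Qed.

Lemma laurent_tofrac (p : {poly int}) : p%:F \in laurent.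
Proof. by apply/laurentbP; exists 0%N, p; rewrite expr0 mulr1. Qed.

Definition polyL (p : {poly int}) : L := MkL (laurent_tofrac p).

Lemma laurent_Xqinv : Xq^-1 \in laurent.
Proof. by apply/laurentbP; exists 1%N, 1; rewrite expr1 mulVf ?Xq_neq0 ?rmorph1. Qed.

Lemma val_qL : val qL = Xq.
Proof. by rewrite /qL val_insubd laurent_tofrac. Qed.

Lemma val_qiL : val qiL = Xq^-1.
Proof. by rewrite /qiL val_insubd laurent_Xqinv. Qed.

Lemma valLD (x y : L) : val (x + y) = val x + val y. Proof. exact: rmorphD. Qed.
Lemma valLM (x y : L) : val (x * y) = val x * val y. Proof. exact: rmorphM. Qed.
Lemma valLX (x : L) k : val (x ^+ k) = val x ^+ k. Proof. exact: rmorphXn. Qed.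
Lemma valL1 : val (1 : L) = 1. Proof. exact: rmorph1. Qed.

Lemma qqi : qL * qiL = 1.
Proof. by apply: val_inj; rewrite valLM val_qL val_qiL valL1 mulfV ?Xq_neq0. Qed.

Lemma qiq : qiL * qL = 1.
Proof. by rewrite mulrC qqi. Qed.

Lemma qXqi k : qL ^+ k * qiL ^+ k = 1.
Proof. by rewrite -exprMn qqi expr1n. Qed.

Lemma L_mulI (k : nat) (x y : L) : qL ^+ k * x = qL ^+ k * y -> x = y.
Proof.
by move=> /(congr1 (fun z => qiL ^+ k * z)); rewrite !mulrA [qiL ^+ k * _]mulrC qXqi !mul1r.
Qed.

Lemma mul_qX_neq0 (x : L) k : x != 0 -> x * qL ^+ k != 0.
Proof.
by apply: contra => /eqP h; apply/eqP/(@L_mulI k); rewrite mulr0 mulrC.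
Qed.

Lemma polyL_repr (a : L) : exists k p, a * qL ^+ k = polyL p.
Proof.
case: (laurentbP _ (valP a)) => k [p hp]; exists k, p.
by apply: val_inj; rewrite valLM valLX val_qL.
Qed.

Lemma polyLB p r : polyL (p - r) = polyL p - polyL r.
Proof. by apply: val_inj; rewrite [RHS]rmorphB /= rmorphB. Qed.
Lemma polyLD p r : polyL (p + r) = polyL p + polyL r.
Proof. by apply: val_inj; rewrite [RHS]rmorphD /= rmorphD. Qed.
Lemma polyLM p r : polyL (p * r) = polyL p * polyL r.
Proof. by apply: val_inj; rewrite [RHS]rmorphM /= rmorphM. Qed.
Lemma polyL0 : polyL 0 = 0.
Proof. by apply: val_inj; rewrite /= rmorph0. Qed.
Lemma polyL1 : polyL 1 = 1.
Proof. by apply: val_inj; rewrite /= rmorph1. Qed.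
Lemma polyLXn k : polyL 'X^k = qL ^+ k.
Proof. by apply: val_inj; rewrite valLX val_qL /= rmorphXn. Qed.
Lemma polyL_inj : injective polyL.
Proof. by move=> p r [] /eqP; rewrite tofrac_eq => /eqP. Qed.

Lemma polyL_sum (I : finType) (F : I -> {poly int}) :
  polyL (\sum_i F i) = \sum_i polyL (F i).
Proof. exact: (big_morph polyL polyLD polyL0). Qed.

(** Clears the negative powers of q in a finite family of coefficients, so that q-adic arguments
    become arguments on the coefficients of integer polynomials. *)
Lemma common_denominator (I : finType) (r : I -> L) :
  exists k, exists p : I -> {poly int}, forall i, r i * qL ^+ k = polyL (p i).
Proof.
pose kp i := lrep (val (r i)).
have hr i : r i * qL ^+ (kp i).1 = polyL (kp i).2.
  apply: val_inj; rewrite valLM valLX val_qL /kp /lrep.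
  apply: (ClassicalEpsilon.epsilon_spec _
    (fun kp : nat * {poly int} => val (r i) * Xq ^+ kp.1 = kp.2%:F)).
  have [k [p hp]] := polyL_repr (r i); exists (k, p).
  by move/(congr1 val): hp; rewrite valLM valLX val_qL.
exists (\sum_i (kp i).1)%N, (fun i => (kp i).2 * 'X^(\sum_(j | j != i) (kp j).1)%N).
by move=> i; rewrite (bigD1 i) //= exprD mulrA hr polyLM polyLXn.
Qed.

Lemma in_qZqE a : in_qZq a <-> exists p, a = qL * polyL p.
Proof.
split=> -[p hp]; exists p; last by rewrite hp valLM val_qL /= rmorphM.
by apply: val_inj; rewrite hp valLM val_qL /= rmorphM.
Qed.

Lemma in_qZq0 : in_qZq 0.
Proof. by apply/in_qZqE; exists 0; rewrite polyL0 mulr0. Qed.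

Lemma in_qZqB a b : in_qZq a -> in_qZq b -> in_qZq (a - b).
Proof.
move=> /in_qZqE [p ->] /in_qZqE [r ->]; apply/in_qZqE; exists (p - r).
by rewrite polyLB mulrBr.
Qed.

Lemma in_qZqM a p : in_qZq a -> in_qZq (a * polyL p).
Proof.
by move=> /in_qZqE [r ->]; apply/in_qZqE; exists (r * p); rewrite polyLM mulrA.
Qed.

Lemma in_qZq_sum (I : finType) (P : pred I) (F : I -> L) :
  (forall i, P i -> in_qZq (F i)) -> in_qZq (\sum_(i | P i) F i).
Proof.
move=> hF; elim/big_rec: _ => [|i x Pi hx]; first exact: in_qZq0.
by rewrite -[x]opprK -[- x]sub0r; apply: in_qZqB (hF i Pi) (in_qZqB in_qZq0 hx).
Qed.

(** * The bar involution of Laurent polynomials *)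

Definition evX (p : {poly int}) : Kq := (map_poly intr p).[Xq^-1].

Lemma evXD p r : evX (p + r) = evX p + evX r.
Proof. by rewrite /evX rmorphD hornerD. Qed.
Lemma evXM p r : evX (p * r) = evX p * evX r.
Proof. by rewrite /evX rmorphM hornerM. Qed.
Lemma evXXn k : evX 'X^k = Xq^-1 ^+ k.
Proof. by rewrite /evX rmorphXn /= map_polyX hornerXn. Qed.

Lemma evXE p : evX p = \sum_(i < size p) (p`_i)%:~R * Xq^-1 ^+ i.
Proof.
rewrite /evX (horner_coef_wide _ (size_poly _ _)).
by apply: eq_bigr => i _; rewrite coef_map.
Qed.

(** [barK] uses a representation picked by [epsilon]. Two representations of [x] agree after
    cross-multiplication by powers of ['X], and evaluating that identity at 1/q shows that the
    choice is immaterial. *)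
Lemma barK_eq (x : Kq) k p : x * Xq ^+ k = p%:F -> barK x = evX p * Xq ^+ k.
Proof.
move=> hp; rewrite /barK -evXE; set r := lrep x.
have hr : x * Xq ^+ r.1 = r.2%:F.
  apply: (ClassicalEpsilon.epsilon_spec _
    (fun kp : nat * {poly int} => x * Xq ^+ kp.1 = kp.2%:F)).
  by exists (k, p).
have : r.2 * 'X^k = p * 'X^(r.1).
  by apply/eqP; rewrite -tofrac_eq !rmorphM !rmorphXn /= -/Xq -hr -hp mulrAC.
move/(congr1 evX); rewrite !evXM !evXXn !exprVn => h.
have hX m : Xq ^+ m != 0 by rewrite expf_neq0 ?Xq_neq0.
apply: (mulIf (invr_neq0 (hX k))); rewrite mulrAC h -mulrA mulVf // -!mulrA.
by rewrite mulfV // mulr1.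
Qed.

Lemma laurent_Xqinv_exp k : Xq^-1 ^+ k \in laurent.
Proof. by rewrite rpredX // laurent_Xqinv. Qed.

Lemma laurent_evX p : evX p \in laurent.
Proof.
rewrite evXE rpred_sum // => i _; rewrite rpredM ?laurent_Xqinv_exp //.
by rewrite rpred_int.
Qed.

Lemma val_barL a k p : a * qL ^+ k = polyL p -> val (barL a) = evX p * Xq ^+ k.
Proof.
move=> /(congr1 val); rewrite valLM valLX val_qL => h.
rewrite /barL val_insubd (barK_eq h) rpredM ?laurent_evX //.
by rewrite rpredX ?laurent_tofrac.
Qed.

Lemma barLD a b : barL (a + b) = barL a + barL b.
Proof.
have [k [p hp]] := polyL_repr a; have [m [r hr]] := polyL_repr b.
have h : (a + b) * qL ^+ (k + m) = polyL (p * 'X^m + r * 'X^k).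
  by rewrite polyLD !polyLM !polyLXn -hp -hr exprD; ring.
apply: val_inj; rewrite valLD (val_barL hp) (val_barL hr) (val_barL h).
rewrite evXD !evXM !evXXn exprD mulrDl !exprVn.
have hX i : Xq ^+ i != 0 by rewrite expf_neq0 ?Xq_neq0.
congr (_ + _); last by rewrite -!mulrA (mulKf (hX k)).
by rewrite [Xq ^+ k * _]mulrC -!mulrA (mulKf (hX m)).
Qed.

Lemma barLM a b : barL (a * b) = barL a * barL b.
Proof.
have [k [p hp]] := polyL_repr a; have [m [r hr]] := polyL_repr b.
have h : (a * b) * qL ^+ (k + m) = polyL (p * r).
  by rewrite polyLM -hp -hr exprD; ring.
apply: val_inj; rewrite valLM (val_barL hp) (val_barL hr) (val_barL h).
by rewrite evXM exprD; ring.
Qed.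

Lemma barL0 : barL 0 = 0.
Proof. by apply: (@addrI _ (barL 0)); rewrite -barLD !addr0. Qed.

Lemma barL1 : barL 1 = 1.
Proof.
have h : 1 * qL ^+ 0 = polyL 1 by rewrite polyL1 mulr1.
by apply: val_inj; rewrite (val_barL h) /evX rmorph1 hornerC mulr1.
Qed.

Lemma barLN a : barL (- a) = - barL a.
Proof. by apply: (@addrI _ (barL a)); rewrite -barLD !addrN barL0. Qed.

Lemma barL_q : barL qL = qiL.
Proof.
have h : qL * qL ^+ 0 = polyL 'X by rewrite mulr1 -[qL]expr1 -polyLXn.
by apply: val_inj; rewrite (val_barL h) /evX map_polyX hornerX val_qiL mulr1.
Qed.

Lemma barL_qi : barL qiL = qL.
Proof.
by rewrite -[LHS]mul1r -qqi -mulrA -{1}barL_q -barLM qqi barL1 mulr1.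
Qed.

(* A polynomial in q divisible by q cannot equal a polynomial in 1/q. *)
Lemma in_qZq_bar_fixed a : in_qZq a -> barL a = a -> a = 0.
Proof.
move=> /in_qZqE [p hp] hbar; rewrite hp.
have h : a * qL ^+ 0 = polyL ('X * p).
  by rewrite mulr1 hp polyLM -['X]expr1 polyLXn.
have hX i : Xq ^+ i != 0 by rewrite expf_neq0 ?Xq_neq0.
pose m := size ('X * p).
(* [rv] is q^m times the value of ['X * p] at 1/q, of degree at most m. Bar-invariance identifies it
   with ['X * p] times ['X^m], whose coefficients beyond m are those of [p]. *)
pose rv := \poly_(j < m.+1) (if (0 < j)%N then ('X * p)`_(m - j) else 0).
have hrv : evX ('X * p) * Xq ^+ m = rv%:F.
  rewrite evXE big_distrl /= -/m /rv poly_def rmorph_sum /= -(big_mkord predT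
     (fun i => (('X * p)`_i)%:~R * Xq^-1 ^+ i * Xq ^+ m)) big_nat_rev /=.
  rewrite -(big_mkord predT (fun i => ((if (0 < i)%N then ('X * p)`_(m - i) else 0) *: 'X^i)%:F)).
  rewrite big_nat_recl //= scale0r rmorph0 add0r.
  apply: eq_big_nat => i /andP [_ hi].
  rewrite add0n -mul_polyC rmorphM rmorphXn /= -/Xq.
  have -> (z : int) : z%:P%:F = z%:~R :> Kq.
    by rewrite -[in LHS](intz z) rmorph_int rmorph_int.
  rewrite -mulrA; congr (_ * _); rewrite -[in Xq ^+ m](subnK hi) exprD mulrA exprVn.
  by rewrite mulVf ?mul1r.
have := val_barL h; rewrite hbar mulr1 => /(congr1 (fun z => z * Xq ^+ m)).
rewrite hrv -[Xq ^+ m]rmorphXn -[a]mulr1 -[1](expr0 qL) h /= -rmorphM => /eqP.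
rewrite tofrac_eq => /eqP E.
suff -> : p = 0 by rewrite polyL0 mulr0.
apply/polyP => i; rewrite coef0.
have := congr1 (fun r : {poly int} => r`_(i.+1 + m)) E.
rewrite /= coefMXn ltnNge leq_addl /= addnK mulrC coefMX /= => ->.
by rewrite coef_poly ltnNge addSn ltnS leq_addl.
Qed.

(** * Stacking e_i on a diagram *)

Section Stacking.
Variables (n : nat) (hn : (1 < n)%N).
Implicit Types (i j : 'I_n) (p r : Pt n) (D : Dg n).

Lemma lo_eq0 i : i == 0 :> nat -> lo i = 0 :> nat.
Proof. by move=> h; rewrite /lo h (eqP h). Qed.

Lemma hi_lo i : hi i = (lo i).+1 :> nat.
Proof.
rewrite /lo /hi; case: ifP => [/eqP h|h].
  by rewrite val_insubd hn h.
by rewrite /= prednK // lt0n h.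
Qed.

Lemma lo_neq_hi i : (lo i == hi i) = false.
Proof. by apply/eqP => /(congr1 val) /=; rewrite hi_lo; lia. Qed.

Lemma lo_val_pos i : i != 0 :> nat -> lo i = i.-1 :> nat /\ hi i = i.
Proof. by move=> h; rewrite /lo /hi (negbTE h). Qed.

Definition tlo i : Pt n := (false, lo i).
Definition thi i : Pt n := (false, hi i).

Lemma tlo_neq_thi i : (tlo i == thi i) = false.
Proof. by rewrite xpair_eqE lo_neq_hi andbF. Qed.

Lemma thi_neq_tlo i : (thi i == tlo i) = false.
Proof. by rewrite eq_sym tlo_neq_thi. Qed.

Definition istop i p := (p == tlo i) || (p == thi i).

Definition zb i : bool := i == 0 :> nat.

(** The stacking of e_i on [D] as a surgery: a new cup appears, and the two strands that ended under
    the cap of e_i are fused, so that their other ends become partners and their dots add up,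
    together with the dot of the cap when i is 0. *)
Definition jn i D : Dg n :=
  ([ffun p => if p == tlo i then thi i else if p == thi i then tlo i else
              if D.1 p == tlo i then D.1 (thi i) else
              if D.1 p == thi i then D.1 (tlo i) else D.1 p],
   [ffun p => if istop i p then zb i else
              if istop i (D.1 p) then D.2 (tlo i) (+) D.2 (thi i) (+) zb i
              else D.2 p]).

Definition jnScal i D : L :=
  if D.1 (tlo i) == thi i then (if D.2 (tlo i) (+) zb i then 0 else qL + qiL) else 1.

Lemma eD1E i b j : (eD i).1 (b, j) = if j == lo i then (b, hi i) else
                     if j == hi i then (b, lo i) else (~~ b, j).
Proof. by rewrite ffunE. Qed.

Lemma eD2E i p : (eD i).2 p = zb i && ((p.2 == lo i) || (p.2 == hi i)).
Proof. by rewrite ffunE. Qed.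

Lemma eD1_neq i p : (eD i).1 p != p.
Proof.
case: p => b j; rewrite eD1E; case: ifP => [/eqP ->|_].
  by rewrite xpair_eqE [hi i == _]eq_sym lo_neq_hi andbF.
case: ifP => [/eqP ->|_]; first by rewrite xpair_eqE lo_neq_hi andbF.
by rewrite xpair_eqE; case: b.
Qed.

Lemma eD1K i : involutive (eD i).1.
Proof.
case=> b j; rewrite eD1E; case: ifP => [/eqP ->|h1].
  by rewrite eD1E [hi i == _]eq_sym lo_neq_hi eqxx.
case: ifP => [/eqP ->|h2]; first by rewrite eD1E eqxx.
by rewrite eD1E h1 h2 negbK.
Qed.

Lemma lev01 : (lev0 == lev1) = false. Proof. by rewrite -val_eqE /= inordK. Qed.
Lemma lev02 : (lev0 == lev2) = false. Proof. by rewrite -val_eqE /= inordK. Qed.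
Lemma lev12 : (lev1 == lev2) = false. Proof. by rewrite -val_eqE /= !inordK. Qed.
Lemma lev10 : (lev1 == lev0) = false. Proof. by rewrite eq_sym lev01. Qed.
Lemma lev20 : (lev2 == lev0) = false. Proof. by rewrite eq_sym lev02. Qed.
Lemma lev21 : (lev2 == lev1) = false. Proof. by rewrite eq_sym lev12. Qed.
Definition levE := (lev01, lev02, lev12, lev10, lev20, lev21, eqxx).

Lemma levP (l : 'I_3) : [\/ l = lev0, l = lev1 | l = lev2].
Proof.
case: l => [[|[|[|//]]] h]; [apply: Or31|apply: Or32|apply: Or33];
  by apply: val_inj; rewrite /= ?inordK.
Qed.

Lemma embA_inj : injective (@embA n).
Proof.
by move=> [[] j] [[] k]; rewrite /embA /= => /eqP; rewrite xpair_eqE ?levE //= => /eqP ->.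
Qed.

Lemma embB_inj : injective (@embB n).
Proof.
by move=> [[] j] [[] k]; rewrite /embB /= => /eqP; rewrite xpair_eqE ?levE //= => /eqP ->.
Qed.

Lemma toQ_inj : injective (@toQ n).
Proof.
by move=> [[] j] [[] k]; rewrite /toQ /= => /eqP; rewrite xpair_eqE ?levE //= => /eqP ->.
Qed.

Lemma toQK : cancel (@toQ n) (@ofQ n).
Proof. by move=> [[] j]; rewrite /toQ /ofQ /= levE. Qed.

Lemma outer_toQ p : outer (toQ p).
Proof. by case: p => [[] j]; rewrite /outer /toQ /= ?levE. Qed.

Lemma edgeP D (emb : Pt n -> Q n) x y :
  reflect (exists p, [/\ D.1 p != p, x = emb p & y = emb (D.1 p)]) (edge D emb x y).
Proof.
apply: (iffP existsP) => -[p].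
  by case/and3P => h /eqP <- /eqP <-; exists p.
by case=> h -> ->; exists p; rewrite h !eqxx.
Qed.

Record matching D : Prop := Matching {
  matchK : involutive D.1;
  match_dot : forall p, D.2 (D.1 p) = D.2 p;
  match_free : forall p, D.1 p = p -> D.2 p = false;
  match_top : forall j, D.1 (false, j) != (false, j) }.

Lemma match_inj D : matching D -> injective D.1.
Proof. by move=> mD; apply: inv_inj (matchK mD). Qed.

Lemma cardset_count (T : finType) (a : pred T) (s : seq T) : uniq s ->
  #|[set r | a r && (r \in s)]| = count a s.
Proof.
move=> us; rewrite -size_filter -(card_uniqP (filter_uniq a us)).
by apply: eq_card => r; rewrite inE mem_filter.
Qed.

Lemma dotw_sum D (emb : Pt n -> Q n) (P : pred (Q n)) : injective emb ->
  (\sum_(y | P y) dotw D emb y)%N = #|[set r | [&& D.1 r != r, D.2 r & P (emb r)]]|.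
Proof.
move=> inj; rewrite -(card_imset _ inj) -sum1_card [RHS]big_mkcond [LHS]big_mkcond /=.
apply: eq_bigr => y _.
have -> : (y \in emb @: [set r | [&& D.1 r != r, D.2 r & P (emb r)]]) = P y && dotw D emb y.
  apply/imsetP/andP => [[r]|[Py /existsP[r /and3P[h1 /eqP h2 h3]]]].
    rewrite inE => /and3P[h1 h2 h3] ->; split=> //.
    by apply/existsP; exists r; rewrite h1 h2 eqxx.
  by exists r; rewrite // inE h1 h3 h2.
by case: (P y) => //=; case: (dotw _ _ _).
Qed.

Section Components.
Variables (i : 'I_n) (D : Dg n) (mD : matching D).
Let A := eD i.

(* [kap] retracts the three-level graph onto the points of [D]; only the new cup of [e_i] is sent to [None]. *)
Definition kap (x : Q n) : option (Pt n) :=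
  if x.1 == lev0 then (if (x.2 == lo i) || (x.2 == hi i) then None else Some (false, x.2))
  else Some (x.1 == lev2, x.2).

Lemma kap_embB p : kap (embB p) = Some p.
Proof. by case: p => [[] j]; rewrite /kap /embB /= ?levE. Qed.

Lemma kap_toQ p : kap (toQ p) = if istop i p then None else Some p.
Proof.
case: p => [[] j]; rewrite /kap /toQ /istop /= ?levE ?xpair_eqE //=.
Qed.

Lemma outerE (x : Q n) : outer x -> x = toQ (ofQ x).
Proof.
case: x => l j; rewrite /outer /toQ /ofQ /=.
by case: (levP l) => ->; rewrite ?levE.
Qed.

Lemma adj_kap (P : option (Pt n) -> bool) :
  (forall p, P (Some (D.1 p)) = P (Some p)) -> P (Some (tlo i)) = P (Some (thi i)) ->
  forall x y, adj A D x y -> P (kap x) = P (kap y).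
Proof.
move=> PD Pt x y /orP[] /edgeP [p [_ -> ->]]; last by rewrite !kap_embB PD.
case: p => b j; rewrite eD1E; case: ifP => [/eqP ->|h1].
  by rewrite /kap /embA /=; case: b; rewrite /= ?levE ?orbT.
case: ifP => [/eqP ->|h2]; first by rewrite /kap /embA /=; case: b; rewrite /= ?levE ?orbT.
by rewrite /kap /embA /=; case: b; rewrite /= ?levE h1 h2.
Qed.

(** Bounds components from above: a property of points of [D] respected by the arcs of [D] and by
    the cap of e_i cannot change along a component. Applied to membership in an explicit list, it
    shows that the list exhausts the component. *)
Lemma conn_kap (P : option (Pt n) -> bool) :
  (forall p, P (Some (D.1 p)) = P (Some p)) -> P (Some (tlo i)) = P (Some (thi i)) ->
  forall x y, conn A D x y -> P (kap x) = P (kap y).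
Proof.
move=> PD Pt x y.
by apply: (@closed_connect _ _ (fun x => P (kap x))) => {}x {}y; apply: adj_kap.
Qed.

Lemma adj_sym x y : adj A D x y = adj A D y x.
Proof.
have E (B : Dg n) emb x' y' : involutive B.1 -> edge B emb x' y' -> edge B emb y' x'.
  move=> BK /edgeP [p [h -> ->]]; apply/edgeP; exists (B.1 p); rewrite BK.
  by split=> //; rewrite eq_sym.
by apply/idP/idP => /orP[] h; apply/orP; [left|right|left|right];
  apply: E h; [exact: eD1K|exact: matchK|exact: eD1K|exact: matchK].
Qed.

Lemma conn_sym x y : conn A D x y = conn A D y x.
Proof. by apply: sym_connect_sym => {}x {}y; apply: adj_sym. Qed.

Lemma conn_refl x : conn A D x x.
Proof. exact: connect0. Qed.

Lemma conn_trans x y z : conn A D x y -> conn A D y z -> conn A D x z.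
Proof. exact: connect_trans. Qed.

Lemma conn_A p : conn A D (embA p) (embA (A.1 p)).
Proof.
apply/connect1/orP; left; apply/edgeP; exists p; split=> //; exact: eD1_neq.
Qed.

Lemma conn_D p : conn A D (embB p) (embB (D.1 p)).
Proof.
case: (D.1 p =P p) => [->|h]; first exact: connect0.
by apply/connect1/orP; right; apply/edgeP; exists p; split=> //; apply/eqP.
Qed.

Lemma conn_up p : ~~ istop i p -> conn A D (toQ p) (embB p).
Proof.
case: p => [[] j]; first by move=> _; exact: connect0.
rewrite /istop !xpair_eqE /= negb_or => /andP[/negbTE h1 /negbTE h2].
by have := conn_A (false, j); rewrite eD1E h1 h2.
Qed.

Lemma conn_cap : conn A D (embB (tlo i)) (embB (thi i)).
Proof. by have := conn_A (true, lo i); rewrite eD1E eqxx. Qed.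

Lemma conn_cup : conn A D (toQ (tlo i)) (toQ (thi i)).
Proof. by have := conn_A (false, lo i); rewrite eD1E eqxx. Qed.

Lemma conn_toQ_cup p x : istop i p -> conn A D (toQ p) x -> kap x = None.
Proof.
move=> hp /(conn_kap (P := fun o => o == None)) -/(_ (fun _ => erefl) erefl).
by rewrite kap_toQ hp eqxx => /esym /eqP.
Qed.

(** The component of a point [p] off the new cup, as a list of points of [D]: either the arc of [p]
    alone, or two arcs glued by the cap. *)
Definition cls p : seq (Pt n) :=
  if istop i (D.1 p) then
    [:: tlo i; thi i; D.1 (tlo i); D.1 (thi i)] else [:: p; D.1 p].

Lemma cls_D p r : ~~ istop i p -> (D.1 r \in cls p) = (r \in cls p).
Proof.
have K x y : (D.1 x == D.1 y) = (x == y) by rewrite (inj_eq (inv_inj (matchK mD))).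
have K' x y : (D.1 x == y) = (x == D.1 y) by rewrite -{1}(matchK mD y) K.
move=> hp; rewrite /cls; case: ifP => _; rewrite !inE !K !K'.
  by do ![case: (_ == _)].
by rewrite orbC.
Qed.

Lemma cls_top p : ~~ istop i p -> (tlo i \in cls p) = (thi i \in cls p).
Proof.
rewrite /cls /istop negb_or => /andP[/negbTE h1 /negbTE h2].
case: ifP; first by rewrite !inE !eqxx ?orbT.
by case/norP=> /negbTE h3 /negbTE h4; rewrite !inE ![_ == p]eq_sym ![_ == D.1 p]eq_sym h1 h2 h3 h4.
Qed.

Lemma conn_cls p x : ~~ istop i p -> conn A D (toQ p) x ->
  exists2 r, kap x = Some r & r \in cls p.
Proof.
move=> hp hc.
have := conn_kap (P := fun o => if o is Some r then r \in cls p else false)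
  (fun r => cls_D r hp) (cls_top hp) hc.
rewrite kap_toQ (negbTE hp).
have -> : p \in cls p.
  rewrite /cls; case: ifP; rewrite !inE ?eqxx // => /orP[] /eqP E.
    have -> : p == D.1 (tlo i) by rewrite -E matchK.
    by rewrite ?orbT.
  have -> : p == D.1 (thi i) by rewrite -E matchK.
  by rewrite ?orbT.
by case: (kap x) => // r /esym; exists r.
Qed.

Lemma cls_conn p r : ~~ istop i p -> r \in cls p -> conn A D (toQ p) (embB r).
Proof.
move=> hp; have h := conn_up hp; have hD := conn_trans h (conn_D p).
rewrite /cls; case: ifP => [hDp|_]; rewrite !inE; last by case/orP=> /eqP ->.
have hl : conn A D (toQ p) (embB (tlo i)) /\ conn A D (toQ p) (embB (thi i)).
  case/orP: hDp => /eqP E; rewrite E in hD.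
    by split=> //; apply: conn_trans hD conn_cap.
  by split=> //; apply: conn_trans hD _; rewrite conn_sym conn_cap.
case: hl => hl hh.
by case/or4P=> /eqP -> //; [apply: conn_trans hl (conn_D _)|apply: conn_trans hh (conn_D _)].
Qed.

Lemma conn_embB_cls p r : ~~ istop i p -> conn A D (toQ p) (embB r) = (r \in cls p).
Proof.
move=> hp; apply/idP/idP; last exact: cls_conn.
by case/(conn_cls hp) => r'; rewrite kap_embB => -[<-].
Qed.

Lemma partnerQ_some x y : outer y -> y != x -> conn A D x y ->
  (forall z, outer z -> z != x -> conn A D x z -> z = y) -> partnerQ A D x = Some y.
Proof.
move=> h1 h2 h3 h4; rewrite /partnerQ; case: pickP => [z /and3P[h5 h6 h7]|/(_ y)].
  by rewrite (h4 z).
by rewrite h1 h2 h3.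
Qed.

Lemma partnerQ_none x : 
  (forall z, outer z -> z != x -> conn A D x z -> False) -> partnerQ A D x = None.
Proof.
move=> h; rewrite /partnerQ; case: pickP => // z /and3P[h5 h6 h7].
by case: (h z).
Qed.

Lemma istop_tlo : istop i (tlo i). Proof. by rewrite /istop eqxx. Qed.
Lemma istop_thi : istop i (thi i). Proof. by rewrite /istop eqxx orbT. Qed.

Lemma jn_nontop p : ~~ istop i p -> ~~ istop i ((jn i D).1 p).
Proof.
rewrite /istop negb_or ffunE => /andP[/negbTE h1 /negbTE h2]; rewrite h1 h2.
case: ifP => [/eqP E|E1].
  rewrite negb_or match_top // andbT -E (inj_eq (inv_inj (matchK mD))) eq_sym.
  by rewrite h2.
case: ifP => [/eqP E|E2]; last by rewrite E1 E2.
by rewrite negb_or match_top //= -E (inj_eq (inv_inj (matchK mD))) eq_sym h1.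
Qed.

End Components.
End Stacking.

(** * Partners, dots and loops of the composite *)

Section Composition.
Variables (n : nat) (hn : (1 < n)%N) (i : 'I_n) (D : Dg n) (mD : matching D).
Implicit Types (p r : Pt n).
Let A := eD i.

Lemma partnerQ_jn p : partnerQ A D (toQ p) =
  if (jn i D).1 p == p then None else Some (toQ ((jn i D).1 p)).
Proof.
have topcase r r' : istop i r -> istop i r' -> r' != r -> (jn i D).1 r = r' ->
    conn A D (toQ r) (toQ r') -> partnerQ A D (toQ r) = 
    if (jn i D).1 r == r then None else Some (toQ ((jn i D).1 r)).
  move=> hr hr' hne -> hc; rewrite (negbTE hne).
  apply: partnerQ_some; rewrite ?outer_toQ ?(inj_eq (@toQ_inj n)) //.
  move=> z /outerE ->; rewrite (inj_eq (@toQ_inj n)) => hz /(conn_toQ_cup hr).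
  rewrite kap_toQ; case: ifP => // hs _; congr (toQ _); move: hz hs hr hr' hne.
  by rewrite /istop => /negbTE hz /orP[] /eqP E1 /orP[] /eqP E2 /orP[] /eqP E3; 
    move: hz; rewrite ?E1 ?E2 ?E3 ?eqxx.
case hp: (istop i p).
  case/orP: (hp) => /eqP E; subst p.
    apply: (topcase _ (thi i)); rewrite ?istop_tlo ?istop_thi //; last exact: conn_cup.
      by rewrite thi_neq_tlo.
    by rewrite ffunE eqxx.
  apply: (topcase _ (tlo i)); rewrite ?istop_tlo ?istop_thi ?tlo_neq_thi //.
    by rewrite ffunE thi_neq_tlo // eqxx.
  by rewrite conn_sym // conn_cup.
move/negbT: hp => hp.
have hj : (jn i D).1 p = if D.1 p == tlo i then D.1 (thi i) else
    if D.1 p == thi i then D.1 (tlo i) else D.1 p.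
  by rewrite ffunE; move: hp; rewrite /istop negb_or => /andP[/negbTE -> /negbTE ->].
have hjn := jn_nontop mD hp.
have hcls : (jn i D).1 p \in cls i D p.
  rewrite hj /cls /istop; case: ifP => [h|h1]; first by rewrite /= !inE eqxx !orbT.
  by case: ifP => [h|h2]; rewrite /= !inE eqxx !orbT.
have huniq r : r \in cls i D p -> ~~ istop i r -> r = p \/ r = (jn i D).1 p.
  rewrite hj /cls /istop negb_or => + /andP[/negbTE h1 /negbTE h2].
  case: ifP => [|h].
    rewrite !inE h1 h2 /= => /orP[] /eqP E /orP[] /eqP ->; rewrite -?E ?matchK ?eqxx; auto.
    by right; rewrite E thi_neq_tlo.
  case/norP: h => /negbTE -> /negbTE ->; rewrite !inE => /orP[] /eqP ->; auto.
have conn_cases z : outer z -> z != toQ p -> conn A D (toQ p) z ->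
    z = toQ ((jn i D).1 p).
  move=> /outerE -> hz /(conn_cls mD hp) [r]; rewrite kap_toQ; case: ifP => // /negbT hs.
  case=> <- /huniq -/(_ hs) [E|-> //].
  by rewrite E eqxx in hz.
case: eqP => [E|/eqP hne].
  apply: partnerQ_none => z ho hz hc; move: (conn_cases z ho hz hc); rewrite E => Ez.
  by rewrite Ez eqxx in hz.
apply: partnerQ_some; rewrite ?outer_toQ ?(inj_eq (@toQ_inj n)) //.
apply: conn_trans (cls_conn hn mD hp hcls) _.
by rewrite conn_sym // conn_up.
Qed.

Lemma cparE x : cpar A D x =
  odd ((#|[set r | [&& A.1 r != r, A.2 r & conn A D x (embA r)]]| +
        #|[set r | [&& D.1 r != r, D.2 r & conn A D x (embB r)]]|) %/ 2).
Proof.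
by rewrite /cpar big_split /= (dotw_sum _ _ (@embA_inj n)) (dotw_sum _ _ (@embB_inj n)).
Qed.

Lemma card_dots (B : Dg n) (P : pred (Pt n)) s : uniq s ->
  (forall r, B.1 r = r -> B.2 r = false) ->
  (forall r, B.2 r -> P r = (r \in s)) ->
  #|[set r | [&& B.1 r != r, B.2 r & P r]]| = count B.2 s.
Proof.
move=> us hB hP; rewrite -cardset_count //; apply: eq_card => r; rewrite !inE.
case: eqP => [/hB -> //|_] /=.
by case E : (B.2 r) => //=; rewrite hP.
Qed.

Lemma eD_free r : A.1 r = r -> A.2 r = false.
Proof. by move/eqP; rewrite (negbTE (eD1_neq hn i r)). Qed.

Definition blo : Pt n := (true, lo i).
Definition bhi : Pt n := (true, hi i).

Lemma cpar_top p : istop i p -> cpar A D (toQ p) = zb i.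
Proof.
move=> hp; rewrite cparE.
rewrite (@card_dots A _ [:: tlo i; thi i]) //; first last.
- move=> [b j]; rewrite eD2E /= => /andP[_ hj].
  case: b; rewrite !inE !xpair_eqE /=; last first.
    rewrite hj; have -> : embA (false, j) = toQ (false, j) by [].
    have hq : istop i (false, j) by rewrite /istop !xpair_eqE.
    move: hp hq; rewrite /istop => /orP[] /eqP -> /orP[] /eqP ->; rewrite ?conn_refl ?conn_cup //.
    by rewrite conn_sym // conn_cup.
  apply/negP => /(conn_toQ_cup hp).
  by rewrite (_ : embA (true, j) = embB (false, j)) // kap_embB.
- exact: eD_free.
- by rewrite /= inE tlo_neq_thi.
rewrite (@card_dots D _ [::]) //; first last.
- move=> r _; apply/negP => /(conn_toQ_cup hp).
  by rewrite kap_embB.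
- exact: match_free.
by rewrite /= !eD2E /= !eqxx orbT; case: (zb i).
Qed.

Lemma cpar_nontop p : ~~ istop i p -> D.1 p != p -> cpar A D (toQ p) =
  if istop i (D.1 p) then D.2 (tlo i) (+) D.2 (thi i) (+) zb i else D.2 p.
Proof.
move=> hp hDp; rewrite cparE.
have hA r : A.2 r -> conn A D (toQ p) (embA r) =
    (r \in if istop i (D.1 p) then [:: blo; bhi] else [::]).
  case: r => [b j]; rewrite eD2E => /andP[_ /= hj].
  have hq : istop i (false, j) by rewrite /istop !xpair_eqE.
  case: b; last first.
    rewrite (_ : embA (false, j) = toQ (false, j)) // conn_sym //.
    have -> : conn A D (toQ (false, j)) (toQ p) = false.
      apply/negP => /(conn_toQ_cup hq).
      by rewrite kap_toQ (negbTE hp).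
    by case: ifP => _; rewrite ?in_nil // !inE !xpair_eqE.
  rewrite (_ : embA (true, j) = embB (false, j)) // conn_embB_cls //.
  rewrite /cls; case: ifP => [_|/negP h].
    rewrite !inE !xpair_eqE /= hj /=.
    by move: hj => /orP[] ->; rewrite ?orbT.
  rewrite !inE; apply/negP => /orP[] /eqP E; first by rewrite -E hq in hp.
  by apply: h; rewrite -E.
rewrite (card_dots _ eD_free hA); last first.
  by case: ifP => _ //=; rewrite inE xpair_eqE lo_neq_hi.
rewrite (card_dots (s := cls i D p)); first last.
- by move=> r _; rewrite conn_embB_cls.
- exact: match_free.
- rewrite /cls; case: ifP => h; last by rewrite /= inE eq_sym hDp.
  have nD x y : (D.1 x == D.1 y) = (x == y) by rewrite (inj_eq (inv_inj (matchK mD))).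
  have nt x : D.1 (false, x) == (false, x) = false by apply/negbTE/(match_top mD).
  rewrite /= !inE ?negb_or tlo_neq_thi // nD tlo_neq_thi // ![tlo i == D.1 _]eq_sym.
  rewrite ![thi i == D.1 _]eq_sym !nt.
  (* Were the two points under the cap joined by [D], the point [p], being the partner of one of
     them, would be the other one, contrary to [hp]. *)
  have Dne : D.1 (thi i) == tlo i = false.
    apply/negP => /eqP E; move: hp; rewrite -(matchK mD p).
    case/orP: h => /eqP ->; rewrite ?E ?istop_tlo //.
    by rewrite -E matchK // istop_thi.
  by rewrite Dne -(inj_eq (inv_inj (matchK mD))) matchK // eq_sym Dne.
rewrite /cls; case: ifP => h /=; rewrite ?eD2E /= ?eqxx ?match_dot //.
  by rewrite orbT; case: (zb i); case: (D.2 (tlo i)); case: (D.2 (thi i)).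
by case: (D.2 p).
Qed.

Lemma compD_jn : compD A D = jn i D.
Proof.
apply/pair_eqP; rewrite /compD /=; apply/andP; split; apply/eqP/ffunP => p.
  rewrite [LHS]ffunE partnerQ_jn.
  by case: eqP => [->|_] //; rewrite toQK.
rewrite [LHS]ffunE [RHS]ffunE partnerQ_jn.
case hp: (istop i p).
  rewrite cpar_top //.
  have -> : (jn i D).1 p == p = false; last by [].
  rewrite ffunE; case/orP: hp => /eqP ->; first by rewrite eqxx thi_neq_tlo.
  by rewrite thi_neq_tlo // eqxx tlo_neq_thi.
move/negbT: (hp) => hp'.
have E : ((jn i D).1 p == p) = (D.1 p == p).
  rewrite ffunE; move: hp; rewrite /istop => /norP[/negbTE h1 /negbTE h2]; rewrite h1 h2.
  case: ifP => [/eqP e1|_].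
    rewrite e1 eq_sym [_ == p]eq_sym h1; apply/eqP => e2.
    have := tlo_neq_thi hn i; rewrite -e1 e2 matchK // => /eqP. 
    by apply.
  case: ifP => [/eqP e1|_] //.
  rewrite e1 eq_sym [_ == p]eq_sym h2; apply/eqP => e2.
  have := tlo_neq_thi hn i; rewrite -e1 e2 matchK // eqxx //.
rewrite E; case: (D.1 p =P p) => [e|/eqP ne].
  by rewrite e hp match_free.
by rewrite cpar_nontop //; case: ifP.
Qed.

(** A closed loop cannot use a vertical line of e_i, so it consists of the cap and one arc of [D]
    below it. The representative chosen by [loops] is the smaller of its two points, [lo i]. *)
Lemma loopScal_jn : loopScal A D = jnScal i D.
Proof.
rewrite /jnScal; case: ifP => [/eqP hl|/eqP hl].
  have hh : D.1 (thi i) = tlo i by rewrite -hl matchK.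
  pose P o := if o is Some r then istop i r else false.
  have hP x y : conn A D x y -> P (kap i x) = P (kap i y).
    apply: (@conn_kap n i D P) => [r|]; last by rewrite /P istop_tlo istop_thi.
    have nD x' y' : (D.1 x' == y') = (x' == D.1 y').
      by rewrite -{1}(matchK mD y') (inj_eq (inv_inj (matchK mD))).
    by rewrite /P /istop !nD hl hh orbC.
  have hconn r : conn A D (embB (tlo i)) (embB r) = istop i r.
    apply/idP/idP => [/hP|]; first by rewrite !kap_embB /P istop_tlo.
    by case/orP=> /eqP ->; [exact: connect0|exact: conn_cap].
  have hc : cpar A D (embB (tlo i)) = D.2 (tlo i) (+) zb i.
    rewrite cparE (@card_dots A _ [:: blo; bhi]) //; first last.
    - move=> [b j]; rewrite eD2E => /andP[_ /= hj].
      case: b; rewrite !inE !xpair_eqE /=.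
        by rewrite (_ : embA (true, j) = embB (false, j)) // hconn /istop !xpair_eqE.
      apply/negP => /hP; rewrite kap_embB /P istop_tlo.
      by rewrite (_ : embA (false, j) = toQ (false, j)) // kap_toQ /istop !xpair_eqE hj.
    - exact: eD_free.
    - by rewrite /= inE xpair_eqE lo_neq_hi.
    rewrite (@card_dots D _ [:: tlo i; thi i]); first last.
    - by move=> r _; rewrite hconn !inE.
    - exact: match_free.
    - by rewrite /= inE tlo_neq_thi.
    rewrite /= !eD2E /= !eqxx orbT -hl match_dot //.
    by case: (zb i); case: (D.2 (tlo i)).
  rewrite /loopScal; have -> : loops A D = [set lo i].
    apply/setP => j; rewrite !inE.
    have ej k : (lev1, k) = embB (false, k) by [].
    have istopE k : istop i (false, k) = (k == lo i) || (k == hi i) by rewrite /istop !xpair_eqE.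
    apply/andP/idP => [[h1 /forallP h2]|/eqP ->].
      have hj : istop i (false, j).
        apply/negPn/negP => h; case/existsP: h1; exists (toQ (false, j)).
        by rewrite outer_toQ ej conn_sym // conn_up.
      move: hj (h2 (lo i)); rewrite istopE => /orP[] // /eqP ->.
      rewrite !ej (_ : conn A D _ _) ?hi_lo ?ltnn //.
      by rewrite conn_sym // conn_cap.
    rewrite ej; split; last first.
      apply/forallP => k; apply/implyP; rewrite ej hconn istopE => /orP[] /eqP -> //.
      by rewrite hi_lo.
    apply/negP => /existsP [y /andP[/outerE -> /hP]].
    by rewrite kap_embB /P istop_tlo kap_toQ; case: ifP => //= ->.
  by rewrite big_set1 (_ : (lev1, lo i) = embB (tlo i)) // hc.
rewrite /loopScal big_pred0 // => j; rewrite inE; apply/negP => /andP[/existsP h1 _]; apply: h1.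
case hj: (istop i (false, j)); last first.
  exists (toQ (false, j)); rewrite outer_toQ /=.
  by rewrite (_ : (lev1, j) = embB (false, j)) // conn_sym // conn_up // hj.
have hne x : istop i x -> ~~ istop i (D.1 x).
  have nt y : D.1 (false, y) == (false, y) = false by apply/negbTE/(match_top mD).
  have hh : D.1 (thi i) != tlo i.
    by apply/eqP => E; apply: hl; rewrite -E matchK.
  by rewrite /istop => /orP[] /eqP ->; rewrite negb_or nt ?hh ?andbT //; apply/eqP.
(* From a point under the cap, its arc in [D] ends away from the cap, and from there an outer face
   is reached directly. *)
exists (toQ (D.1 (false, j))); rewrite outer_toQ /=.
apply: (conn_trans (conn_D i D (false, j))).
by rewrite conn_sym // conn_up // hne.
Qed.

End Composition.

(** * Planar diagrams as arcs on a line *)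

Section Position.
Variable n : nat.
Implicit Types (i j : 'I_n) (p r : Pt n) (D : Dg n).

(* The bottom face is bent around the right face, so that an (n,n)-diagram becomes a system of arcs on a line of 2n points and "reachable from the left face" becomes "not enclosed by another arc". *)
Definition pos p : nat := if p.1 then (n + (n - p.2.+1))%N else p.2.

Lemma pos_inj : injective pos.
Proof.
move=> [b j] [c k]; rewrite /pos /=; have := ltn_ord j; have := ltn_ord k.
by case: b; case: c => hk hj h; congr pair; try apply: val_inj => /=; lia.
Qed.

Lemma pos_eq p r : (pos p == pos r) = (p == r).
Proof. exact: (inj_eq pos_inj). Qed.

Record planar D : Prop := Planar {
  planar_matching :> matching D;
  planar_nc : forall p r, (pos p < pos r)%N -> (pos r < pos (D.1 p))%N ->
     (pos (D.1 p) < pos (D.1 r))%N -> False;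
  planar_exp : forall p r, D.2 p -> (pos p < pos (D.1 p))%N -> (pos r < pos p)%N ->
     (pos (D.1 p) < pos (D.1 r))%N -> False }.

Lemma planar_inside D p r : planar D -> (pos r < pos p)%N -> (pos p < pos (D.1 r))%N ->
  (pos r <= pos (D.1 p) <= pos (D.1 r))%N.
Proof.
move=> pD h1 h2; apply/andP; split; rewrite leqNgt; apply/negP => h.
  by apply: (planar_nc (p := D.1 p) (r := r) pD); rewrite ?(matchK pD).
by apply: (planar_nc (p := r) (r := p) pD).
Qed.

Lemma planar_exposed D p r : planar D -> D.2 p -> (pos r < pos p)%N ->
  (pos p < pos (D.1 r))%N -> D.1 p = r \/ D.1 p = p.
Proof.
move=> pD dp h1 h2; have /andP[h3 h4] := planar_inside pD h1 h2.
case: (D.1 p =P r) => [|/eqP ne]; [by left|right]; apply/eqP; rewrite -[_ == _]negbK.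
rewrite -pos_eq in ne; rewrite -pos_eq; apply/negP => ne2.
have ne3 : (pos (D.1 p) == pos (D.1 r)) = false.
  by rewrite pos_eq (inj_eq (inv_inj (matchK pD))) -pos_eq; lia.
case: (ltnP (pos p) (pos (D.1 p))) => h5.
  by apply: (planar_exp (p := p) (r := r) pD) => //; lia.
apply: (planar_exp (p := D.1 p) (r := r) pD); rewrite ?(matchK pD) ?(match_dot pD) //; lia.
Qed.

End Position.

Section Planar.
Variables (n : nat) (hn : (1 < n)%N).
Implicit Types (i j : 'I_n) (p r : Pt n) (D : Dg n).

Section Jn.
Variables (i : 'I_n) (D : Dg n) (mD : matching D).

Lemma jn1_lo : (jn i D).1 (tlo i) = thi i.
Proof. by rewrite ffunE eqxx. Qed.
Lemma jn1_hi : (jn i D).1 (thi i) = tlo i.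
Proof. by rewrite ffunE thi_neq_tlo // eqxx. Qed.

Lemma jn1_x : D.1 (tlo i) != thi i -> (jn i D).1 (D.1 (tlo i)) = D.1 (thi i).
Proof.
by move=> h; rewrite ffunE (negbTE h) (negbTE (match_top mD _)) matchK // eqxx.
Qed.
Lemma loop_sym : (D.1 (thi i) == tlo i) = (D.1 (tlo i) == thi i).
Proof. by rewrite -(inj_eq (match_inj mD)) matchK // eq_sym. Qed.

Lemma jn1_y : D.1 (tlo i) != thi i -> (jn i D).1 (D.1 (thi i)) = D.1 (tlo i).
Proof.
move=> h; rewrite ffunE loop_sym (negbTE h) (negbTE (match_top mD _)) matchK //.
by rewrite thi_neq_tlo // eqxx.
Qed.
Lemma jn1_o p : ~~ istop i p -> ~~ istop i (D.1 p) -> (jn i D).1 p = D.1 p.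
Proof.
by rewrite /istop ffunE => /norP[/negbTE-> /negbTE->] /norP[/negbTE-> /negbTE->].
Qed.
Lemma jn2_top p : istop i p -> (jn i D).2 p = zb i.
Proof. by rewrite ffunE => ->. Qed.
Lemma istop_x : D.1 (tlo i) != thi i -> ~~ istop i (D.1 (tlo i)).
Proof. by move=> h; rewrite /istop (negbTE h) (negbTE (match_top mD _)). Qed.
Lemma istop_y : D.1 (tlo i) != thi i -> ~~ istop i (D.1 (thi i)).
Proof. by move=> h; rewrite /istop loop_sym (negbTE h) (negbTE (match_top mD _)). Qed.
Lemma jn2_xy p : ~~ istop i p -> istop i (D.1 p) ->
  (jn i D).2 p = D.2 (tlo i) (+) D.2 (thi i) (+) zb i.
Proof. by rewrite ffunE => /negbTE -> ->. Qed.
Lemma jn2_o p : ~~ istop i p -> ~~ istop i (D.1 p) -> (jn i D).2 p = D.2 p.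
Proof. by rewrite ffunE => /negbTE -> /negbTE ->. Qed.

(** The partition along which facts on [jn] are checked: the ends of the new cup, the two ends that
    get fused (present only if no loop closes), and the points whose arc is untouched. *)
Variant pt_spec p : Prop :=
  | PtLo of p = tlo i
  | PtHi of p = thi i
  | PtX of D.1 (tlo i) != thi i & p = D.1 (tlo i)
  | PtY of D.1 (tlo i) != thi i & p = D.1 (thi i)
  | PtO of ~~ istop i p & ~~ istop i (D.1 p).

Lemma ptP p : pt_spec p.
Proof.
case hp: (istop i p); first by case/orP: hp => /eqP; [exact: PtLo|exact: PtHi].
case hq: (istop i (D.1 p)); last by apply: PtO; rewrite ?hp ?hq.
case/orP: hq => /eqP E; have Ep := congr1 D.1 E; rewrite matchK // in Ep.
  apply: PtX => //; apply/eqP => E2; move: hp; rewrite Ep E2.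
  by rewrite istop_thi.
apply: PtY => //; rewrite -loop_sym; apply/eqP => E2; move: hp; rewrite Ep E2.
by rewrite istop_tlo.
Qed.

Lemma jn_matching : matching (jn i D).
Proof.
split.
- move=> p; case: (ptP p) => [->|->|h ->|h ->|h1 h2].
  + by rewrite jn1_lo jn1_hi.
  + by rewrite jn1_hi jn1_lo.
  + by rewrite jn1_x // jn1_y.
  + by rewrite jn1_y // jn1_x.
  + by rewrite !jn1_o ?matchK.
- move=> p; case: (ptP p) => [->|->|h ->|h ->|h1 h2].
  + by rewrite jn1_lo !jn2_top ?istop_tlo ?istop_thi.
  + by rewrite jn1_hi !jn2_top ?istop_tlo ?istop_thi.
  + by rewrite jn1_x // !jn2_xy ?matchK ?istop_x ?istop_y ?istop_tlo ?istop_thi.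
  + by rewrite jn1_y // !jn2_xy ?matchK ?istop_x ?istop_y ?istop_tlo ?istop_thi.
  + by rewrite jn1_o // !jn2_o ?matchK // match_dot.
- move=> p; case: (ptP p) => [->|->|h ->|h ->|h1 h2].
  + by rewrite jn1_lo => /eqP; rewrite thi_neq_tlo.
  + by rewrite jn1_hi => /eqP; rewrite tlo_neq_thi.
  + by rewrite jn1_x // => /(match_inj mD) /eqP; rewrite thi_neq_tlo.
  + by rewrite jn1_y // => /(match_inj mD) /eqP; rewrite tlo_neq_thi.
  + by rewrite jn1_o // jn2_o //; apply: match_free.
- move=> j; case: (ptP (false, j)) => [->|->|h ->|h ->|h1 h2].
  + by rewrite jn1_lo thi_neq_tlo.
  + by rewrite jn1_hi tlo_neq_thi.
  + by rewrite jn1_x // (inj_eq (match_inj mD)) thi_neq_tlo.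
  + by rewrite jn1_y // (inj_eq (match_inj mD)) tlo_neq_thi.
  + by rewrite jn1_o // match_top.
Qed.

Lemma pos_lo : pos (tlo i) = lo i. Proof. by []. Qed.
Lemma pos_hi : pos (thi i) = (lo i).+1. Proof. by rewrite /pos /= hi_lo. Qed.

Lemma pos_nontop p : ~~ istop i p -> pos p != lo i /\ pos p != (lo i).+1.
Proof. by rewrite /istop -pos_lo -pos_hi !pos_eq negb_or => /andP[]. Qed.

End Jn.

Section PlanarJn.
Variables (i : 'I_n) (D : Dg n) (pD : planar D).
Let mD : matching D := pD.

(** The points [lo i] and [hi i] are adjacent, so an arc ending elsewhere encloses both or neither
    of them; non-crossing carries this over to their partners. *)
Lemma inside_top r x : ~~ istop i r -> ~~ istop i (D.1 r) ->
  D.1 x = tlo i \/ D.1 x = thi i ->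
  (pos r < pos x)%N -> (pos x < pos (D.1 r))%N ->
  [/\ (pos r < lo i)%N, ((lo i).+1 < pos (D.1 r))%N,
     (pos r < pos (D.1 (tlo i)) < pos (D.1 r))%N & (pos r < pos (D.1 (thi i)) < pos (D.1 r))%N].
Proof.
move=> h1 h2 hx h3 h4.
have [g1 g2] := pos_nontop h1; have [g3 g4] := pos_nontop h2.
have h5 := planar_inside pD h3 h4.
have h6 : ((pos r < lo i) && ((lo i).+1 < pos (D.1 r)))%N.
  by case: hx => E; rewrite E ?pos_lo ?pos_hi in h5; lia.
have N x' : istop i x' -> (pos (D.1 x') != pos r) /\ pos (D.1 x') != pos (D.1 r).
  move=> hx'; rewrite !pos_eq (inj_eq (match_inj mD)); split; apply/eqP => E.
    by move: h2; rewrite -E matchK // hx'.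
  by move: h1; rewrite -E hx'.
have [n1 n2] := N _ (istop_tlo i); have [n3 n4] := N _ (istop_thi i).
have /= := @planar_inside _ D (tlo i) r pD; rewrite pos_lo => k1.
have /= := @planar_inside _ D (thi i) r pD; rewrite pos_hi => k2.
split; lia.
Qed.

Lemma jn_planar : planar (jn i D).
Proof.
have N x y : x != y -> pos (D.1 x) != pos (D.1 y).
  by rewrite pos_eq (inj_eq (match_inj mD)).
have posT := (pos_lo i, pos_hi i).
split; first exact: jn_matching.
- move=> p r; case: (ptP i mD p) => [->|->|h ->|h ->|h1 h2];
    case: (ptP i mD r) => [->|->|g ->|g ->|g1 g2];
    rewrite ?jn1_lo ?jn1_hi ?jn1_x ?jn1_y // ?jn1_o // ?jn1_o // ?posT; try lia.
  + move=> k1 k2 k3.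
    have := @inside_top r (D.1 (thi i)) g1 g2.
    by rewrite matchK // => /(_ (or_intror erefl) k2 k3) [*]; lia.
  + move=> k1 k2 k3.
    have := @inside_top r (D.1 (tlo i)) g1 g2.
    by rewrite matchK // => /(_ (or_introl erefl) k2 k3) [*]; lia.
  + move=> k1 k2 k3.
    have := @inside_top p (D.1 (tlo i)) h1 h2.
    by rewrite matchK // => /(_ (or_introl erefl) k1 k2) [*]; lia.
  + move=> k1 k2 k3.
    have := @inside_top p (D.1 (thi i)) h1 h2.
    by rewrite matchK // => /(_ (or_intror erefl) k1 k2) [*]; lia.
  + exact: planar_nc.
- have zlo : zb i -> lo i = 0 :> nat by exact: lo_eq0.
  (* A dotted fused arc under an untouched one: for i = 0 nothing can enclose position 0, and
     otherwise one of the two fused arcs was already dotted and enclosed. *)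
  have encl r x : D.1 (tlo i) != thi i -> istop i (D.1 x) -> (pos r < pos x)%N ->
      ~~ istop i r -> ~~ istop i (D.1 r) ->
      (pos x < pos (D.1 r))%N -> D.2 (tlo i) (+) D.2 (thi i) (+) zb i -> False.
    move=> hl hx k1 g1 g2 k2 hd.
    have hx' : D.1 x = tlo i \/ D.1 x = thi i by case/orP: hx => /eqP; auto.
    have [e1 e2 e3 e4] := inside_top g1 g2 hx' k1 k2.
    case: (zb i) zlo hd => [/(_ isT)|_]; first lia.
    have E u : istop i u -> (pos r < pos u < pos (D.1 r))%N -> D.2 u -> False.
      move=> hu /andP[u1 u2] du; have [Eu|Eu] := planar_exposed pD du u1 u2.
        by move: g2; rewrite -Eu matchK // hu.
      by move: (match_free mD Eu); rewrite du.
    have F1 := E _ (istop_tlo i); have F2 := E _ (istop_thi i).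
    rewrite posT in F1; rewrite posT in F2.
    case: (D.2 (tlo i)) F1 => [F1 _|_]; first by apply: F1 => //; lia.
    by case: (D.2 (thi i)) F2 => // F2 _; apply: F2 => //; lia.
  (* A dotted untouched arc under the fused one: left of [lo i] or right of [hi i] it already lay
     under one of the two old arcs, and if it spans them it would cross the old arc of [r]. *)
  have encl2 p r r' : istop i r -> istop i r' -> r != r' -> D.1 (tlo i) != thi i ->
     ~~ istop i p -> ~~ istop i (D.1 p) -> 
     (pos p < pos (D.1 p))%N -> (pos (D.1 r) < pos p)%N -> 
     (pos (D.1 p) < pos (D.1 r'))%N -> D.2 p -> False.
    clear encl zlo N; move=> hr hr' hrr' hl h1 h2 k1 k2 k3 dp.
    have [g1 g2] := pos_nontop h1; have [g3 g4] := pos_nontop h2.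
    have B t : istop i t -> (pos t < lo i)%N = false /\ (pos t <= (lo i).+1)%N.
      by case/orP=> /eqP ->; rewrite posT; lia.
    have [b1 b2] := B _ hr; have [b3 b4] := B _ hr'.
    case: (ltnP (pos (D.1 p)) (lo i)) => c1.
      have c2 : (pos p < pos (D.1 (D.1 r)))%N by rewrite matchK //; lia.
      have [E|E] := planar_exposed pD dp k2 c2; first by rewrite E in k1; lia.
      by rewrite E in k1; lia.
    case: (ltnP (lo i).+1 (pos p)) => c2.
      have c3 : (pos r' < pos p)%N by lia.
      have c4 : (pos p < pos (D.1 r'))%N by lia.
      have [E|E] := planar_exposed pD dp c3 c4; last by rewrite E in k1; lia.
      by rewrite E in k1; lia.
    have c3 : (pos p < pos r)%N by lia.
    have c4 : (pos r < pos (D.1 p))%N by lia.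
    by have := planar_inside pD c3 c4; lia.
  move=> p r; case: (ptP i mD p) => [->|->|h ->|h ->|h1 h2].
  + by rewrite jn1_lo jn2_top ?istop_tlo // posT => /zlo ->.
  + by rewrite jn1_hi !posT; lia.
  + rewrite jn1_x // jn2_xy ?istop_x ?matchK ?istop_tlo // => k0 k1.
    case: (ptP i mD r) => [->|->|g ->|g ->|g1 g2];
    rewrite ?jn1_lo ?jn1_hi ?jn1_x ?jn1_y // ?jn1_o // ?posT; try lia.
    move=> k2 k3; apply: (encl r (D.1 (tlo i))); rewrite ?matchK ?istop_tlo //.
    exact: ltn_trans k3.
  + rewrite jn1_y // jn2_xy ?istop_y ?matchK ?istop_thi // => k0 k1.
    case: (ptP i mD r) => [->|->|g ->|g ->|g1 g2];
    rewrite ?jn1_lo ?jn1_hi ?jn1_x ?jn1_y // ?jn1_o // ?posT; try lia.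
    move=> k2 k3; apply: (encl r (D.1 (thi i))); rewrite ?matchK ?istop_thi //.
    exact: ltn_trans k3.
  + rewrite jn1_o // jn2_o // => k0 k1.
    case: (ptP i mD r) => [->|->|g ->|g ->|g1 g2];
    rewrite ?jn1_lo ?jn1_hi ?jn1_x ?jn1_y // ?(jn1_o g1 g2) ?posT; try lia.
    * by move=> k2 k3; apply: (encl2 p (tlo i) (thi i));
        rewrite ?istop_tlo ?istop_thi ?tlo_neq_thi.
    * by move=> k2 k3; apply: (encl2 p (thi i) (tlo i));
        rewrite ?istop_tlo ?istop_thi ?thi_neq_tlo.
    * exact: planar_exp.
Qed.

End PlanarJn.
End Planar.

(** * Weights of labelled diagrams *)

Section Weights.
Variables (n : nat) (hn : (1 < n)%N).
Implicit Types (i j : 'I_n) (p r : Pt n) (D : Dg n).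

Definition lab := {ffun Pt n -> bool}.
Implicit Types (a b : lab).

(* Labels: [true] is "-"; an orientation of an arc is charged q when its right end is "+". *)
Definition wt D a p : L :=
  if (pos (D.1 p) < pos p)%N then (a p (+) a (D.1 p) (+) D.2 p)%:R * qL ^+ (~~ a p) else 1.
Definition Kd D a : L := \prod_p wt D a p.

Definition updL i a (t : bool) : lab :=
  [ffun p => if p == thi i then t else if p == tlo i then ~~ t (+) zb i else a p].
(** The tangle e_i as an operator on labels: the prefactor is the weight of its cup, and the sum
    runs over the two orientations of its cap, charged q^-1 when the right end is [true]. With this
    charge an undotted loop sums to q + q^-1, and a cap that straightens a strand costs nothing. *)
Definition CopL i (v : lab -> L) a : L :=
  (a (tlo i) (+) a (thi i) (+) zb i)%:R * qL ^+ (~~ a (thi i)) *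
  \sum_(t : bool) qiL ^+ t * v (updL i a t).

Lemma updL_hi i a t : updL i a t (thi i) = t.
Proof. by rewrite ffunE eqxx. Qed.
Lemma updL_lo i a t : updL i a t (tlo i) = ~~ t (+) zb i.
Proof. by rewrite ffunE tlo_neq_thi // eqxx. Qed.
Lemma updL_o i a t p : ~~ istop i p -> updL i a t p = a p.
Proof. by rewrite ffunE /istop => /norP[/negbTE -> /negbTE ->]. Qed.

Lemma wt_pair D a p : matching D -> D.1 p != p ->
  wt D a p * wt D a (D.1 p) =
  (a p (+) a (D.1 p) (+) D.2 p)%:R *
     qL ^+ (if (pos (D.1 p) < pos p)%N then ~~ a p else ~~ a (D.1 p)).
Proof.
move=> mD ne; rewrite /wt matchK // match_dot // [a (D.1 p) (+) a p]addbC.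
case: (ltnP (pos (D.1 p)) (pos p)) => h; first by rewrite ltnNge (ltnW h) /= mulr1.
have -> : (pos p < pos (D.1 p))%N by move: ne; rewrite -pos_eq; lia.
by rewrite mul1r.
Qed.

Lemma Kd_split2 D a p r : p != r ->
  Kd D a = wt D a p * wt D a r * \prod_(s | (s != p) && (s != r)) wt D a s.
Proof.
by move=> h; rewrite /Kd (bigD1 p) //= (bigD1 r) ?[r == p]eq_sym //= mulrA.
Qed.

Lemma Kd_split4 D a p r p' r' : uniq [:: p; r; p'; r'] ->
  Kd D a = wt D a p * wt D a p' * (wt D a r * wt D a r') *
    \prod_(s | s \notin [:: p; r; p'; r']) wt D a s.
Proof.
rewrite /= !inE !negb_or => /and4P[/and3P[h1 h2 h3] /andP[h4 h5] h6 _].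
rewrite /Kd (bigD1 p) //= (bigD1 r) 1?eq_sym //=.
rewrite (bigD1 p') /=; last by rewrite eq_sym h2 eq_sym h4.
rewrite (bigD1 r') /=; last by rewrite eq_sym h3 eq_sym h5 eq_sym h6.
rewrite [X in _ * (_ * (_ * (_ * X)))](eq_bigl (fun s => s \notin [:: p; r; p'; r'])).
  by ring.
by move=> s; rewrite !inE !negb_or -!andbA.
Qed.

Lemma wt_eq D D' a b p : D.1 p = D'.1 p -> D.2 p = D'.2 p -> a p = b p ->
  a (D.1 p) = b (D.1 p) -> wt D a p = wt D' b p.
Proof. by rewrite /wt => -> -> -> ->. Qed.

(** Non-crossing excludes that [x] lies right and [y] left of the cap. If both lie on one side, the
    two arcs are nested and the inner one cannot be dotted; the identity of [Cop_Kd] would fail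
    otherwise. Repeated clauses give the three cases the same shape. *)
Lemma pos_xy i D : planar D -> D.1 (tlo i) != thi i ->
  let x := D.1 (tlo i) in let y := D.1 (thi i) in
  [\/ [/\ (pos x < lo i)%N, (pos y < (lo i).+1)%N = false, (pos y < pos x)%N = false,
         zb i = false & zb i = false],
      [/\ (pos x < lo i)%N, (pos y < (lo i).+1)%N, (pos y < pos x)%N, zb i = false &
         D.2 (tlo i) = false] |
      [/\ (pos x < lo i)%N = false, (pos y < (lo i).+1)%N = false, (pos y < pos x)%N,
         D.2 (thi i) = false & D.2 (thi i) = false]].
Proof.
move=> pD hl x y; have mD : matching D := pD.
have [[px1 px2] [py1 py2]] := (pos_nontop hn (istop_x mD hl), pos_nontop hn (istop_y mD hl)).
have pxy : pos y != pos x by apply/eqP => /pos_inj /(match_inj mD) /eqP; rewrite thi_neq_tlo.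
have z0 : (pos x < lo i)%N -> zb i = false.
  by move=> k; apply/negP => /lo_eq0 E; rewrite E in k.
have I1 := @planar_inside n D (tlo i) y pD; have I2 := @planar_inside n D (thi i) (tlo i) pD.
have E1 := @planar_exposed n D (tlo i) y pD; have E2 := @planar_exposed n D (thi i) (tlo i) pD.
rewrite !matchK // !pos_lo !pos_hi // in I1 I2 E1 E2; rewrite -!/x -!/y in I1 I2 E1 E2 px1 px2 py1 py2.
have ney : x <> y by move=> E; move: pxy; rewrite E eqxx.
have nex : y <> thi i by move=> E; move: (match_top mD (hi i)); rewrite -/(thi i) -/y E eqxx.
have nel : x <> tlo i by move=> E; move: (match_top mD (lo i)); rewrite -/(tlo i) -/x E eqxx.
have neh : y <> tlo i by move=> /eqP; rewrite /y loop_sym // (negbTE hl).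
have dl : (pos y < lo i)%N -> D.2 (tlo i) = false.
  by move=> k1; apply/negP => dt; case: (E1 dt k1 (ltnSn _)).
have dh : ((lo i).+1 < pos x)%N -> D.2 (thi i) = false.
  by move=> k2; apply/negP => dt; case: (E2 dt (ltnSn _) k2).
clear E1 E2 ney nex nel neh hl.
case: (ltnP (pos x) (lo i)) => k1.
  rewrite (z0 k1); case: (ltnP (lo i).+1 (pos y)) => k2.
    by apply: Or31; split=> //; clear -k1 k2; apply/negbTE; rewrite -leqNgt; lia.
  have k3 : (pos y < lo i)%N by clear -k2 py1 py2; lia.
  apply: Or32; split; rewrite ?dl //; first exact: leq_trans k3 (leqnSn _).
  by move: (I1 k3 (ltnSn _)) => /andP[+ _]; rewrite leq_eqVlt (negbTE pxy).
have k2 : ((lo i).+1 < pos x)%N by clear -k1 px1 px2; lia.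
have /andP[k3 k4] := I2 (ltnSn _) k2.
apply: Or33; split; rewrite ?dh //; last by move: k4; rewrite leq_eqVlt (negbTE pxy).
by apply/negbTE; rewrite -leqNgt; clear -py1 py2 k3; lia.
Qed.

Lemma Cop_Kd i D a : planar D ->
  CopL i (Kd D) a = jnScal i D * Kd (jn i D) a.
Proof.
move=> pD; have mD : matching D := pD.
have posT := (pos_lo i, pos_hi hn i).
have hlh : tlo i != thi i by rewrite tlo_neq_thi.
rewrite /CopL /jnScal; case: ifP => [/eqP hl|/negbT hl].
  have hl' : D.1 (thi i) = tlo i by rewrite -hl matchK.
  rewrite big_bool /= !(Kd_split2 _ _ hlh).
  have hR t : \prod_(s | (s != tlo i) && (s != thi i)) wt D (updL i a t) s =
      \prod_(s | (s != tlo i) && (s != thi i)) wt (jn i D) a s.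
    apply: eq_bigr => s; rewrite -negb_or -/(istop i s) => hs.
    have hs' : ~~ istop i (D.1 s).
      by apply: contra hs => /orP[] /eqP E; move/(congr1 D.1): E;
        rewrite matchK // ?hl ?hl' => ->; rewrite ?istop_tlo ?istop_thi.
    by apply: wt_eq; rewrite ?jn1_o ?jn2_o ?updL_o.
  rewrite !hR; set R := \prod_(s | _) _.
  have W (b : lab) : wt D b (tlo i) * wt D b (thi i) =
      (b (tlo i) (+) b (thi i) (+) D.2 (tlo i))%:R * qL ^+ (~~ b (thi i)).
    have := wt_pair b mD (p := tlo i); rewrite hl => ->; last by rewrite thi_neq_tlo.
    by rewrite !posT ltnNge leqnSn.
  have mJ := jn_matching hn i mD.
  have := wt_pair a mJ (p := tlo i); rewrite jn1_lo => ->; last by rewrite thi_neq_tlo.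
  rewrite !W jn2_top ?istop_tlo // !updL_hi !updL_lo !posT ltnNge leqnSn /=.
  case: (a (tlo i)); case: (a (thi i)); case: (zb i); case: (D.2 (tlo i)) => /=;
    rewrite ?(mul0r, mulr0, mul1r, mulr1, expr0, expr1, addr0, add0r) //;
    rewrite ?[qiL * _]mulrCA ?mulrA ?mulrDl ?mulrDr ?mulrA ?qiq ?qqi ?mul1r //; try ring.
set x := D.1 (tlo i); set y := D.1 (thi i).
have xlo : x != tlo i by exact: match_top.
have yhi : y != thi i by exact: match_top.
have yx : y != x by rewrite (inj_eq (match_inj mD)) thi_neq_tlo.
have ylo : y != tlo i by rewrite loop_sym.
have xhi : x != thi i by [].
have S (u v : Pt n) : u != v -> ((u == v) = false) * ((v == u) = false).
  by move=> h; rewrite (eq_sym v) (negbTE h).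
have F := (S _ _ hlh, S _ _ xlo, S _ _ xhi, S _ _ ylo, S _ _ yhi, S _ _ yx).
have u4 : uniq [:: tlo i; thi i; x; y] by rewrite /= !inE !F.
have u4' : uniq [:: tlo i; x; thi i; y] by rewrite /= !inE !F.
have nx : ~~ istop i x by exact: istop_x.
have ny : ~~ istop i y by exact: istop_y.
rewrite (Kd_split4 (jn i D) _ u4') big_bool /= !(Kd_split4 D _ u4).
have hR t : \prod_(s | s \notin [:: tlo i; thi i; x; y]) wt D (updL i a t) s =
    \prod_(s | s \notin [:: tlo i; x; thi i; y]) wt (jn i D) a s.
  apply: eq_big => [s|s]; first by rewrite !inE; do ![case: (_ == _)].
  rewrite !inE !negb_or => /and4P[h1 h2 h3 h4].
  have hs : ~~ istop i s by rewrite /istop negb_or h1.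
  have hs' : ~~ istop i (D.1 s).
    by apply/norP; split; [apply: contra h3|apply: contra h4];
      move=> /eqP E; rewrite /x /y -E matchK.
  by apply: wt_eq; rewrite ?jn1_o ?jn2_o ?updL_o.
rewrite !hR; set R := \prod_(s | _) _.
rewrite !wt_pair //.
have mJ := jn_matching hn i mD.
have := wt_pair a mJ (p := tlo i); rewrite jn1_lo => ->; last by rewrite thi_neq_tlo.
have := wt_pair a mJ (p := x); rewrite jn1_x // => -> //.
rewrite jn2_top ?istop_tlo // jn2_xy ?matchK ?istop_tlo // !updL_hi !updL_lo !(updL_o _ _ nx) !(updL_o _ _ ny) !posT.
have -> : ((lo i).+1 < lo i)%N = false by rewrite ltnNge leqnSn.
rewrite -/x -/y.
have fin := pos_xy pD hl.
rewrite /= -/x -/y in fin; rewrite mul1r -!mulrA; congr (_ * (_ * _)); rewrite !mulrA.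
move: R => R.
(* What remains is a finite check on the labels of [x] and [y] and on the dots; [h1] and [h2]
   discard the forbidden dots. *)
case: fin => [] [-> k1 -> h1 h2]; rewrite ?h1 ?h2 ?k1 /=; clear -h1 h2;
case: (a x); case: (a y); case: (zb i) h1 h2 => h1 h2; case: (D.2 (tlo i)) h1 h2 => h1 h2;
  case: (D.2 (thi i)) h1 h2 => h1 h2 //=;
  by rewrite !(expr0, expr1, mul0r, mulr0, mul1r, mulr1, addr0, add0r, qiq, qqi).
Qed.

End Weights.

(** * Comparing arc systems on a half-plane *)

Section Halves.
Variable n : nat.
Implicit Types (i j k p : 'I_n) (D c : Dg n).

Definition Sg := {ffun 'I_n -> bool}.
Implicit Types (al be : Sg).

Lemma big_pairs (R : Type) (idx : R) (op : Monoid.com_law idx) (f : 'I_n -> 'I_n) (F : 'I_n -> R) :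
  involutive f ->
  \big[op/idx]_j F j =
    op (\big[op/idx]_(j | f j == j) F j) (\big[op/idx]_(j | (f j < j)%N) op (F j) (F (f j))).
Proof.
move=> fK; rewrite (bigID (fun j => f j == j)) /=; congr (op _ _).
rewrite (bigID (fun j => (f j < j)%N)) /= big_split /=; congr (op _ _).
  by apply: eq_bigl => j; rewrite -val_eqE /=; case: ltngtP.
rewrite [RHS](reindex_inj (inv_inj fK)) /=; apply: eq_big => [j|j _]; last by rewrite fK.
by rewrite fK -val_eqE /=; case: ltngtP.
Qed.

(** A single face of a diagram: fixed points of [f] are rays to infinity. Rays cannot pass under
    arcs, and a dotted arc must see the left boundary, hence has neither an enclosing arc nor a ray
    on its left. *)
Record half (f : 'I_n -> 'I_n) (d : 'I_n -> bool) : Prop := Half {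
  halfK : involutive f;
  half_dot : forall j, d (f j) = d j;
  half_nc : forall j k, (j < k)%N -> (k < f j)%N -> (f j < f k)%N -> False;
  half_ray : forall j k, f k = k -> (j < k)%N -> (k < f j)%N -> False;
  half_exp : forall j k, d j -> (j < f j)%N -> (k < j)%N -> (f j < f k)%N -> False;
  half_exp_ray : forall j k, d j -> (j < f j)%N -> (k < j)%N -> f k = k -> False }.

(** The orientation of arcs that costs no q: right ends are minus, and a left end is minus exactly
    when its arc is dotted. *)
Definition standard (f : 'I_n -> 'I_n) (d : 'I_n -> bool) al :=
  forall j, (j < f j)%N -> al j = d j /\ al (f j).

Definition only_first_ray_minus (f : 'I_n -> 'I_n) al :=
  forall j k, f j = j -> f k = k -> (k < j)%N -> al j = false.

(* Induction on the right end of the arc: everything to its left that matters is already known to agree. *)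
Lemma half_compare f d f' d' al : half f d -> half f' d' ->
  standard f d al -> only_first_ray_minus f al -> standard f' d' al ->
  forall j, f' j != j -> f j = f' j /\ d j = d' j.
Proof.
move=> H H' S O S'.
have main m : forall j, (j < f' j)%N -> (f' j < m)%N -> f j = f' j.
  elim: m => // m IH j hj hm.
  have inner p : (p < f' j)%N -> (f' p < f' j)%N -> f' p != p -> f p = f' p.
    move=> h1 h2 h3; case: (ltnP p (f' p)) => h4; first by apply: IH => //; lia.
    have h5 : (f' p < p)%N by rewrite ltn_neqAle h4 andbT.
    by have := IH (f' p); rewrite (halfK H') => /(_ h5) E; rewrite -[in LHS]E ?(halfK H) //; lia.
  set k := f' j in hj hm *; have kj : f' k = j by rewrite /k (halfK H').
  have [aj ak] := S' j hj; rewrite -/k in ak.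
  have in_pt p : (j < p)%N -> (p < k)%N -> [/\ f p = f' p, (j < f' p)%N & (f' p < k)%N].
    move=> h1 h2.
    have h3 : f' p != p by apply/eqP => E; apply: (half_ray H' E h1 h2).
    have h4 : (f' p < k)%N.
      rewrite ltnNge; apply/negP; rewrite leq_eqVlt => /orP[/eqP E|h4].
        by have := halfK H' p; rewrite -(val_inj E : k = f' p) kj => E2; move: h1; rewrite E2 ltnn.
      exact: (half_nc H' h1 h2 h4).
    have h5 : (j < f' p)%N.
      rewrite ltnNge; apply/negP; rewrite leq_eqVlt => /orP[/eqP E|h5].
        by have := halfK H' p; rewrite (val_inj E : f' p = j) -/k => E2; move: h2; rewrite E2 ltnn.
      by apply: (half_nc H' (j := f' p) (k := j)); rewrite ?(halfK H').
    by split=> //; apply: inner.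
  (* The arc of [f] from [j] cannot stop before [k], where [f] and [f'] already agree. It cannot
     overshoot [k] either: [k] is labelled minus, so it would be the left end of a dotted arc
     enclosed by it. *)
  have fin : (j < f j)%N -> f j = k.
    move=> h1; apply/eqP/negPn/negP => ne.
    case: (ltnP (f j) k) => h2.
      have [E h3 h4] := in_pt _ h1 h2; move: E; rewrite (halfK H) => E.
      by move: h3; rewrite -E ltnn.
    have h3 : (k < f j)%N.
      by rewrite ltn_neqAle h2 andbT; apply: contra ne => /eqP E; apply/eqP/val_inj.
    have nk : f k != k by apply/eqP => E; apply: (half_ray H E hj h3).
    have h4 : (j < f k)%N.
      rewrite ltnNge; apply/negP; rewrite leq_eqVlt => /orP[/eqP E|h4].
        by have := halfK H k; rewrite (val_inj E : f k = j) => E2; move: h3; rewrite E2 ltnn.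
      by apply: (half_nc H (j := f k) (k := j)); rewrite ?(halfK H).
    case: (ltnP (f k) k) => h5.
      have [E h6 h7] := in_pt _ h4 h5; rewrite (halfK H) in E.
      by move: h4; rewrite -[f k](halfK H') -E kj ltnn.
    have h6 : (k < f k)%N by rewrite ltn_neqAle h5 andbT eq_sym.
    have h7 : (f k < f j)%N.
      rewrite ltnNge; apply/negP; rewrite leq_eqVlt => /orP[/eqP E|h7].
        by have E2 := inv_inj (halfK H) (val_inj E); move: hj; rewrite E2 ltnn.
      exact: (half_nc H hj h3 h7).
    have [dk _] := S k h6; rewrite ak in dk.
    by apply: (half_exp H (j := k) (k := j)); rewrite -?dk.
  case: (ltngtP j (f j)) => [h|h|/val_inj h]; first exact: fin.
    (* If [j] were a right end for [f], its label would be minus, so its [f']-arc is dotted.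
       Exposure then forces the point [f j] to have its [f']-partner left of [k], where both systems
       agree, which is absurd. *)
    have [_ aj'] : al (f j) = d (f j) /\ al j by have := S (f j); rewrite (halfK H); apply.
    have dj : d' j by rewrite -aj.
    have h1 : f' (f j) != f j by apply/eqP => E; apply: (half_exp_ray H' dj hj h E).
    have h2 : (f' (f j) < k)%N.
      rewrite ltnNge; apply/negP; rewrite leq_eqVlt => /orP[/eqP E|h2]; last exact: (half_exp H' dj hj h h2).
      by have := inv_inj (halfK H') (val_inj E); move=> E2; rewrite -E2 ltnn in h.
    have := inner (f j) (ltn_trans h hj) h2 h1; rewrite (halfK H) => E2.
    by move: hj; rewrite [in X in (_ < nat_of_ord X)%N]/k [in f' j]E2 (halfK H') ltnNge ltnW.
  have hk : f k != k -> (k < f k)%N.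
    move=> nk; rewrite ltnNge; apply/negP => h1.
    have h2 : (f k < k)%N by rewrite ltn_neqAle nk h1.
    case: (ltngtP (f k) j) => [h3|h3|/val_inj h3].
    - by apply: (half_ray H (j := f k) (k := j)); rewrite ?(halfK H).
    - have [E h6 h7] := in_pt _ h3 h2; rewrite (halfK H) in E.
      by move: h3; rewrite -[f k](halfK H') -E kj ltnn.
    - by move: hj (halfK H k); rewrite h3 -h => + E; rewrite E ltnn.
  (* Now [j] is a ray of [f] and [k] is labelled minus: as a ray it is not the first one, and as the
     left end of a dotted arc it has the ray [j] on its left. *)
  case: (f k =P k) => [E|/eqP /hk h1].
    by move: (O k j E (esym h) hj); rewrite ak.
  have [dk _] := S k h1; rewrite ak in dk.
  by case: (half_exp_ray H (j := k) (k := j)); rewrite -?dk.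
move=> j nj.
have E : f j = f' j.
  case: (ltnP j (f' j)) => h; first exact: (main _ j h (ltnSn _)).
  have h2 : (f' j < j)%N by rewrite ltn_neqAle nj h.
  have := main j.+1 (f' j); rewrite (halfK H') => /(_ h2 (ltnSn _)) E.
  by rewrite -[in LHS]E (halfK H).
split=> //; case: (ltnP j (f' j)) => h.
  have h' : (j < f j)%N by rewrite E.
  by rewrite -(proj1 (S j h')) -(proj1 (S' j h)).
have h2 : (f' j < f' (f' j))%N by rewrite (halfK H') ltn_neqAle nj h.
have h' : (f j < f (f j))%N by rewrite (halfK H) E -[X in (_ < nat_of_ord X)%N](halfK H').
by rewrite -(half_dot H) -(half_dot H') -(proj1 (S _ h')) -(proj1 (S' _ h2)) E.
Qed.

(** * The two faces of a planar diagram *)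

Definition hf (b : bool) D j : 'I_n := if (D.1 (b, j)).1 == b then (D.1 (b, j)).2 else j.
Definition hd (b : bool) D j : bool := ((D.1 (b, j)).1 == b) && D.2 (b, j).

Lemma hfE b D j : (D.1 (b, j)).1 == b -> D.1 (b, j) = (b, hf b D j).
Proof. by rewrite /hf => h; rewrite h {1}(surjective_pairing (D.1 _)) (eqP h). Qed.

Lemma hf_ray b D j : (D.1 (b, j)).1 != b -> hf b D j = j.
Proof. by rewrite /hf => /negbTE ->. Qed.

Lemma hfK b D : matching D -> involutive (hf b D).
Proof.
move=> mD j; case: (boolP ((D.1 (b, j)).1 == b)) => h; last by rewrite !hf_ray.
have E := hfE h; have := congr1 D.1 E; rewrite matchK // => E2.
by rewrite {1}/hf -E2 eqxx.
Qed.

Lemma hfD b D j : hf b D j != j -> D.1 (b, j) = (b, hf b D j).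
Proof. by move=> h; apply: hfE; apply: contraR h => /hf_ray ->. Qed.

Lemma pos_top j : pos (false, j) = j. Proof. by []. Qed.
Lemma pos_bot j : pos (true, j) = (n + (n - j.+1))%N. Proof. by []. Qed.
Lemma pos_bot_ge (p : Pt n) : p.1 -> (n <= pos p)%N.
Proof. by case: p => [[] j] // _; rewrite pos_bot leq_addr. Qed.
Lemma pos_top_lt (p : Pt n) : ~~ p.1 -> (pos p < n)%N.
Proof. by case: p => [[] j] // _; rewrite pos_top. Qed.

Lemma hd_dot b D j : matching D -> hd b D (hf b D j) = hd b D j.
Proof.
move=> mD; case: (boolP ((D.1 (b, j)).1 == b)) => h; last by rewrite hf_ray.
by rewrite /hd -(hfE h) matchK // match_dot // h eqxx.
Qed.

(* Both faces of a diagram are half-planes of the same shape: reversing the order of the bottom face does not affect nesting, and through strands are rays. *)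
Lemma half_top D : planar D -> half (hf false D) (hd false D).
Proof.
move=> pD; have mD : matching D := pD; have K := hfK false mD.
have ray k : hf false D k = k -> (n <= pos (D.1 (false, k)))%N.
  move=> E; apply: pos_bot_ge; case h : (_.1) => //; move/negbT: h; rewrite -eqbF_neg => /hfE.
  by rewrite E => /eqP; rewrite (negbTE (match_top mD k)).
have arc j : hf false D j != j -> pos (D.1 (false, j)) = hf false D j.
  by move/hfD ->.
have ne j : (j < hf false D j)%N -> hf false D j != j by rewrite -val_eqE /=; lia.
split=> //.
- by move=> j; exact: hd_dot.
- move=> j k h1 h2 h3; have h4 : hf false D k != k by rewrite -val_eqE /=; lia.
  by apply: (@planar_nc _ D pD (false, j) (false, k)); rewrite ?pos_top ?arc //; apply: ne; lia.
- move=> j k E h1 h2; have a1 := arc _ (ne _ (ltn_trans h1 h2)).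
  apply: (@planar_nc _ D pD (false, j) (false, k)); rewrite ?pos_top ?a1 //.
  exact: leq_trans (ltn_ord _) (ray _ E).
- move=> j k /andP[_ dj] h1 h2 h3; have h4 : hf false D k != k by rewrite -val_eqE /=; lia.
  by apply: (@planar_exp _ D pD (false, j) (false, k)); rewrite ?pos_top ?arc //; apply: ne; lia.
- move=> j k /andP[_ dj] h1 h2 E; have a1 := arc _ (ne _ h1).
  apply: (@planar_exp _ D pD (false, j) (false, k)); rewrite ?pos_top ?a1 //.
  exact: leq_trans (ltn_ord _) (ray _ E).
Qed.

Lemma half_bot D : planar D -> (forall j, D.1 (true, j) != (true, j)) ->
  half (hf true D) (hd true D).
Proof.
move=> pD full; have mD : matching D := pD; have K := hfK true mD.
have ray k : hf true D k = k -> (pos (D.1 (true, k)) < n)%N.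
  move=> E; apply: pos_top_lt; apply/negP => h; move: (full k).
  by rewrite (@hfE true D k) ?h // E eqxx.
have arc j : hf true D j != j -> pos (D.1 (true, j)) = (n + (n - (hf true D j).+1))%N.
  by move/hfD ->.
have ne j : (j < hf true D j)%N -> hf true D j != j by rewrite -val_eqE /=; lia.
have sub j k : (j < k)%N -> (n - k.+1 < n - j.+1)%N by have := ltn_ord k; lia.
split=> //.
- by move=> j; exact: hd_dot.
- move=> j k h1 h2 h3; have h4 : hf true D k != k by rewrite -val_eqE /=; lia.
  have a1 := arc _ (ne _ (ltn_trans h1 h2)); have a2 := arc _ h4.
  apply: (@planar_nc _ D pD (D.1 (true, k)) (D.1 (true, j)));
    rewrite ?matchK // ?pos_bot ?a1 ?a2 ltn_add2l; exact: sub.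
- move=> j k E h1 h2; have a1 := arc _ (ne _ (ltn_trans h1 h2)).
  apply: (@planar_nc _ D pD (D.1 (true, k)) (D.1 (true, j))); rewrite ?matchK // ?pos_bot ?a1 ?ltn_add2l ?sub //.
  exact: leq_trans (ray _ E) (leq_addr _ _).
- move=> j k /andP[_ dj] h1 h2 h3; have h4 : hf true D k != k by rewrite -val_eqE /=; lia.
  have a1 := arc _ (ne _ h1); have a2 := arc _ h4.
  apply: (@planar_exp _ D pD (D.1 (true, j)) (D.1 (true, k)));
    rewrite ?matchK ?match_dot // ?pos_bot ?a1 ?a2 ltn_add2l; exact: sub.
- move=> j k /andP[_ dj] h1 h2 E; have a1 := arc _ (ne _ h1).
  apply: (@planar_exp _ D pD (D.1 (true, j)) (D.1 (true, k)));
    rewrite ?matchK ?match_dot // ?pos_bot ?a1 ?ltn_add2l ?sub //.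
  exact: leq_trans (ray _ E) (leq_addr _ _).
Qed.

End Halves.

(** * Cup diagrams *)

Section Cups.
Variable n : nat.
Implicit Types (i j k : 'I_n) (p r : Pt n) (D c C : Dg n) (al be : Sg n).

Definition compat D (a : lab n) : bool :=
  [forall p, (pos (D.1 p) < pos p)%N ==> (a p (+) a (D.1 p) (+) D.2 p)].
Definition flips D (a : lab n) : nat := (\sum_(p | pos (D.1 p) < pos p) ~~ a p)%N.

Lemma KdE D a : Kd D a = (compat D a)%:R * qL ^+ flips D a.
Proof.
rewrite /Kd /compat; case: forallP => [h|/forallP].
  rewrite mul1r /flips -prodrXr [RHS]big_mkcond /=; apply: eq_bigr => p _.
  rewrite /wt; case: ifP => // hp; have := h p; rewrite hp /= => ->.
  by rewrite mul1r.
rewrite negb_forall mul0r => /existsP[p]; rewrite negb_imply => /andP[h1 h2].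
by rewrite (bigD1 p) //= /wt h1 (negbTE h2) !mul0r.
Qed.

Lemma compatP D a p : matching D -> compat D a -> D.1 p != p -> a p (+) a (D.1 p) (+) D.2 p.
Proof.
move=> mD /forallP h ne; have := h p; have := h (D.1 p); rewrite matchK // match_dot //.
have : pos (D.1 p) != pos p by rewrite pos_eq.
by rewrite [a (D.1 p) (+) _]addbC; case: ltngtP.
Qed.

Definition glue al be : lab n := [ffun p => if p.1 then be p.2 else al p.2].
(** Closing the bottom with minus signs implements relations (iv) and (v): an undotted bottom arc
    gets weight 0 and a dotted one weight 1. A ray forces its top label to equal its dot, at no
    cost. *)
Definition ones : Sg n := [ffun => true].
Lemma onesE j : ones j = true. Proof. by rewrite ffunE. Qed.
Definition Kc c al : L := Kd c (glue al ones).

Lemma glue_top al be j : glue al be (false, j) = al j. Proof. by rewrite ffunE. Qed.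
Lemma glue_bot al be j : glue al be (true, j) = be j. Proof. by rewrite ffunE. Qed.

Definition upd i al (t : bool) : Sg n :=
  [ffun j => if j == hi i then t else if j == lo i then ~~ t (+) zb i else al j].
Definition Cop i (v : Sg n -> L) al : L :=
  (al (lo i) (+) al (hi i) (+) zb i)%:R * qL ^+ (~~ al (hi i)) *
  \sum_(t : bool) qiL ^+ t * v (upd i al t).

Lemma updL_glue i al be t : updL i (glue al be) t = glue (upd i al t) be.
Proof. by apply/ffunP => -[[] j]; rewrite !ffunE !xpair_eqE /= ?ffunE. Qed.

Lemma CopE i (v : lab n -> L) al be : Cop i (fun al => v (glue al be)) al = CopL i v (glue al be).
Proof.
rewrite /Cop /CopL !glue_top; congr (_ * _); apply: eq_bigr => t _.
by rewrite updL_glue.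
Qed.

Lemma Cop_glue i D al be : (1 < n)%N -> planar D ->
  Cop i (fun al => Kd D (glue al be)) al = jnScal i D * Kd (jn i D) (glue al be).
Proof. by move=> hn pD; rewrite CopE Cop_Kd. Qed.

Definition wl D (a : lab n) p : L :=
  if (pos p < pos (D.1 p))%N then (a p (+) a (D.1 p) (+) D.2 p)%:R * qL ^+ (~~ a (D.1 p)) else 1.

Lemma Kd_left D a : matching D -> Kd D a = \prod_p wl D a p.
Proof.
move=> mD; rewrite /Kd (reindex_inj (match_inj mD)) /=; apply: eq_bigr => p _.
by rewrite /wl /wt matchK // match_dot // [a (D.1 p) (+) a p]addbC.
Qed.

Record cup_type c : Prop := CupType {
  cup_planar :> planar c;
  cup_bot : forall j, c.1 (true, j) = (true, j) \/ c.1 (true, j) = (false, j) }.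

Lemma cup_top c j : cup_type c ->
  c.1 (false, j) = if hf false c j == j then (true, j) else (false, hf false c j).
Proof.
move=> hc; have mc : matching c := hc.
case: eqP => [E|/eqP h]; last exact: hfD.
case h : (c.1 (false, j)) => [[] k]; last first.
  have := @hfE _ false c j; rewrite h => /(_ isT) E2.
  by have := match_top mc j; rewrite h E2 E eqxx.
have E2 : c.1 (true, k) = (false, j) by rewrite -h matchK.
by case: (cup_bot hc k); rewrite E2 // => -[->].
Qed.

Lemma cup_bottom c j : cup_type c ->
  c.1 (true, j) = if hf false c j == j then (false, j) else (true, j).
Proof.
move=> hc; have mc : matching c := hc; have := cup_top j hc.
case: eqP => [E h|E h]; first by rewrite -h matchK.
case: (cup_bot hc j) => // /(congr1 c.1); rewrite matchK // h => -[] E2.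
by case: E; rewrite -E2.
Qed.

Lemma cup_ext c c' : cup_type c -> cup_type c' -> hf false c =1 hf false c' ->
  (forall j, c.2 (false, j) = c'.2 (false, j)) -> c = c'.
Proof.
move=> hc hc' E1 E2; have mc : matching c := hc; have mc' : matching c' := hc'.
have E p : c.1 p = c'.1 p.
  by case: p => [[] j]; rewrite ?cup_bottom ?cup_top // E1.
apply/pair_eqP/andP; split; apply/eqP/ffunP => // -[[] j] //.
have := E (true, j); case: (c'.1 (true, j) =P (true, j)) => [h1 h2|h1 h2].
  by rewrite !match_free // h2.
case: (cup_bot hc' j) => // h3.
by rewrite -(match_dot mc) -(match_dot mc') h2 h3.
Qed.

(** The cheapest label of a cup diagram; for [cupD w] it is the sign sequence of [w]
    ([stdlab_cupD]). *)
Definition stdlab c : Sg n := [ffun j => (pos (c.1 (false, j)) < j)%N || c.2 (false, j)].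

Lemma stdlab_right c j : (hf false c j < j)%N -> stdlab c j.
Proof.
move=> h; rewrite ffunE hfD; first by rewrite pos_top h.
by rewrite -val_eqE /=; lia.
Qed.

Lemma stdlab_left c j : (j <= hf false c j)%N -> stdlab c j = c.2 (false, j).
Proof.
rewrite ffunE; case: (boolP ((c.1 (false, j)).1 == false)) => h.
  by rewrite hfE // pos_top ltnNge => ->.
move=> _; rewrite ltnNge (leq_trans _ (pos_bot_ge _)) //; first exact: ltnW.
by move: h; case: (c.1 (false, j)).1.
Qed.

Lemma stdlab_standard c : planar c -> standard (hf false c) (hd false c) (stdlab c).
Proof.
move=> pc j h; rewrite stdlab_left 1?ltnW // stdlab_right ?(hfK _ pc) //.
split=> //; rewrite /hd; case: eqP => //; case E : (c.1 (false, j)).1 => // _.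
by move: h; rewrite hf_ray ?E // ltnn.
Qed.

Lemma stdlab_rays c : cup_type c -> only_first_ray_minus (hf false c) (stdlab c).
Proof.
move=> hc j k Ej Ek kj; rewrite stdlab_left ?Ej //; apply/negP => dj.
apply: (@planar_exp _ c hc (false, j) (false, k)) => //;
  rewrite !cup_top // Ej eqxx ?Ek ?eqxx !(pos_top, pos_bot) //;
  have := ltn_ord j; lia.
Qed.

(** [half_compare] in both directions makes the arcs coincide. This is how the outcome of e_i is
    recognised as some [cupD v] without retracing the construction of cups from signs. *)
Lemma stdlab_inj c c' : cup_type c -> cup_type c' -> stdlab c = stdlab c' -> c = c'.
Proof.
move=> hc hc' E.
have pc : planar c := hc; have pc' : planar c' := hc'.
have C1 := half_compare (half_top pc) (half_top pc') (stdlab_standard pc) (stdlab_rays hc).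
rewrite E in C1; have {}C1 := C1 (stdlab_standard pc').
have C2 := half_compare (half_top pc') (half_top pc) (stdlab_standard pc') (stdlab_rays hc').
rewrite -E in C2; have {}C2 := C2 (stdlab_standard pc).
have Ef j : hf false c j = hf false c' j.
  case: (hf false c' j =P j) => [h|/eqP /C1 [] //].
  by case: (hf false c j =P j) => [->|/eqP /C2 [] //].
apply: cup_ext => // j.
case: (hf false c' j =P j) => [h|/eqP h].
  by rewrite -!stdlab_left ?Ef ?h // E.
have [_] := C1 j h; rewrite /hd !hfD ?Ef //=.
Qed.

Lemma compat_top c al be j : planar c -> compat c (glue al be) -> hf false c j != j ->
  al j (+) al (hf false c j) (+) c.2 (false, j).
Proof.
move=> pc hc h; have := compatP (p := (false, j)) pc hc (match_top pc j).
by rewrite hfD // !glue_top.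
Qed.

Lemma compat_ray c al j : cup_type c -> compat c (glue al ones) -> hf false c j = j ->
  al j = c.2 (false, j).
Proof.
move=> pc hc h; have := compatP (p := (false, j)) pc hc (match_top pc j).
by rewrite cup_top // h eqxx glue_top glue_bot onesE; case: (al j); case: (c.2 _).
Qed.

Lemma Kc_stdlab c : cup_type c -> Kc c (stdlab c) = 1.
Proof.
move=> hc; have pc : planar c := hc; have mc : matching c := hc; have K := hfK false mc.
rewrite /Kc Kd_left // big1 // => p _; rewrite /wl; case: ifP => // hp.
case: p hp => [[] j] hp.
  by move: hp; rewrite cup_bottom //; case: ifP => _; rewrite ?ltnn // pos_top pos_bot => hp;
    have := ltn_ord j; lia.
rewrite glue_top; case: (hf false c j =P j) => [h|/eqP h].
  by rewrite cup_top // h eqxx glue_bot onesE stdlab_left ?h //; case: (c.2 _); rewrite mul1r.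
rewrite hfD // pos_top in hp; rewrite hfD // glue_top stdlab_left 1?ltnW //.
by rewrite stdlab_right ?K //; case: (c.2 _); rewrite mul1r.
Qed.

(** The length of the element of W^p with sign sequence [al] ([lenW_Wp]). Positions count from 0, so
    that s_0, which turns two leading plus signs into minus signs, adds exactly 1. *)
Definition stat al : nat := (\sum_j al j * j)%N.

(** An arc has two compatible orientations. Leaving the standard one turns the minus at its right
    end into a plus, which costs q and lowers [stat], even when a minus reappears at the left
    end. *)
Lemma Kc_triangular c al : cup_type c -> Kc c al != 0 ->
  al = stdlab c \/ (stat al < stat (stdlab c))%N /\ (0 < flips c (glue al ones))%N.
Proof.
move=> hc; rewrite /Kc KdE; case hcomp: (compat _ _); last by rewrite mul0r eqxx.
move=> _; have pc : planar c := hc; have mc : matching c := hc; have K := hfK false mc.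
have Hray j : hf false c j = j -> al j = stdlab c j.
  by move=> h; rewrite (compat_ray hc hcomp) // stdlab_left ?h.
have Hpair j : (hf false c j < j)%N -> al j -> al (hf false c j) = stdlab c (hf false c j).
  move=> h h2; rewrite stdlab_left ?K 1?ltnW //.
  have := compat_top (j := hf false c j) pc hcomp; rewrite K h2 => /(_ _).
  have -> : j != hf false c j by rewrite -val_eqE /=; lia.
  by move/(_ isT); case: (al _); case: (c.2 _).
have Hle j : (hf false c j < j)%N -> (al j * j + al (hf false c j) * hf false c j <=
    stdlab c j * j + stdlab c (hf false c j) * hf false c j ?= iff al j)%N.
  move=> h; rewrite (stdlab_right h); case aj: (al j).
    by rewrite Hpair //; apply/leqif_refl.
  split; first by case: (al _); case: (stdlab _ _); lia.
  by apply/eqP; case: (al _); case: (stdlab _ _); lia.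
case: (boolP [forall j, (hf false c j < j)%N ==> al j]) => [/forallP h|].
  have h' j : (hf false c j < j)%N -> al j by move=> g; have := h j; rewrite g.
  left; apply/ffunP => j; case: (ltngtP (hf false c j) j) => g.
  - by rewrite stdlab_right // h'.
  - by rewrite -{1 2}[j]K Hpair ?K // h' ?K.
  - by rewrite Hray //; apply: val_inj.
rewrite negb_forall => /existsP[j]; rewrite negb_imply => /andP[h1 h2]; right; split; last first.
  have nj : hf false c j != j by rewrite -val_eqE /=; lia.
  rewrite /flips (bigD1 (false, j)) /=; first by rewrite glue_top h2.
  by rewrite hfD // !pos_top.
rewrite /stat !(big_pairs _ _ K) /= -addnS; apply: leq_add.
  by apply: leq_sum => k /eqP /Hray ->.
rewrite (bigD1 j) // [X in (_ < X)%N](bigD1 j) //= -addSn; apply: leq_add.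
  by rewrite ltn_neqAle (Hle j h1).1 (Hle j h1).2 h2.
by apply: leq_sum => k /andP[/Hle [-> _] _].
Qed.

(** * Normal forms of composites with cup diagrams *)

Lemma cupnorm_top C j : (cupnorm C).1 (false, j) =
  if (C.1 (false, j)).1 then (true, j) else C.1 (false, j).
Proof. by rewrite ffunE. Qed.
Lemma cupnorm_bot C j : (cupnorm C).1 (true, j) =
  if (C.1 (false, j)).1 then (false, j) else (true, j).
Proof. by rewrite ffunE. Qed.
Lemma cupnorm_dot C j : (cupnorm C).2 (false, j) = C.2 (false, j).
Proof. by rewrite ffunE. Qed.

Lemma cupnorm_cup C : planar C -> cup_type (cupnorm C).
Proof.
move=> pC; have mC : matching C := pC; split; last first.
  by move=> j; rewrite cupnorm_bot; case: ifP; [right|left].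
have tt j : ~~ (C.1 (false, j)).1 ->
    exists k, [/\ C.1 (false, j) = (false, k), C.1 (false, k) = (false, j) &
    (cupnorm C).1 (false, k) = (false, j)].
  case E : (C.1 (false, j)) => [[] k] // _; exists k.
  by have E2 := congr1 C.1 E; rewrite matchK // in E2; rewrite cupnorm_top -E2.
have left_top p : (pos p < pos ((cupnorm C).1 p))%N -> exists j, p = (false, j).
  case: p => [[] j]; last by exists j.
  rewrite cupnorm_bot; case: ifP; rewrite ?ltnn // pos_bot pos_top => _ h.
  by have := ltn_ord j; lia.
split; first split.
- move=> [[] j].
    by rewrite cupnorm_bot; case: ifP => h; rewrite ?cupnorm_top ?cupnorm_bot h.
  rewrite cupnorm_top; case: ifP => h; first by rewrite cupnorm_bot h.
  by have [k [-> _ ->]] := tt j (negbT h).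
- move=> [[] j].
    by rewrite cupnorm_bot; case: ifP => h //; rewrite !ffunE /= h.
  rewrite cupnorm_top; case: ifP => h; first by rewrite !ffunE /= h.
  have [k [E1 E2 E3]] := tt j (negbT h).
  by rewrite E1 !cupnorm_dot -E1 match_dot.
- by move=> [[] j]; rewrite !ffunE /=; case: ifP => //= h E; rewrite match_free.
- move=> j; rewrite cupnorm_top; case: ifP => _; first by rewrite xpair_eqE.
  exact: match_top.
- move=> p r h1 h2 h3; have [j Ej] := left_top p (ltn_trans h1 h2).
  have [k Ek] := left_top r (ltn_trans h2 h3); subst p r.
  move: h1 h2 h3; rewrite !cupnorm_top pos_top; case: ifP => hj; case: ifP => hk.
  + by rewrite !(pos_bot, pos_top); have := ltn_ord j; have := ltn_ord k; lia.
  + move=> _ _; have := pos_top_lt (negbT hk); rewrite pos_bot; lia.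
  + move=> h1 h2 _; apply: (@planar_nc _ C pC (false, j) (false, k)) => //.
    exact: leq_trans (pos_top_lt (negbT hj)) (pos_bot_ge hk).
  + exact: (@planar_nc _ C pC (false, j) (false, k)).
- move=> p r dp h1 h2 h3; have [j Ej] := left_top p h1.
  have [k Ek] := left_top r (ltn_trans h2 (ltn_trans h1 h3)); subst p r.
  move: dp h1 h2 h3; rewrite cupnorm_dot !cupnorm_top; case: ifP => hj; case: ifP => hk dj h1 h2 h3.
  + have g1 : (j < pos (C.1 (false, j)))%N := leq_trans (ltn_ord _) (pos_bot_ge hj).
    apply: (@planar_exp _ C pC (false, j) (false, k)) => //.
    rewrite ltnNge leq_eqVlt; apply/negP => /orP[|g2].
      by rewrite pos_eq (inj_eq (match_inj mC)) => /eqP[E]; rewrite E ltnn in h2.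
    apply: (@planar_nc _ C pC (false, k) (false, j)) => //.
    exact: leq_trans (ltn_ord _) (pos_bot_ge hk).
  + have := pos_top_lt (negbT hk); move: h3; rewrite pos_bot; lia.
  + apply: (@planar_exp _ C pC (false, j) (false, k)) => //.
    exact: leq_trans (pos_top_lt (negbT hj)) (pos_bot_ge hk).
  + exact: (@planar_exp _ C pC (false, j) (false, k)).
Qed.

(** All bottom labels are equal, so the weight does not see at which bottom point a ray ends, and
    the rays may be straightened. *)
Lemma Kc_cupnorm C al : planar C -> Kc C al = bbScal C * Kc (cupnorm C) al.
Proof.
move=> pC; have mC : matching C := pC; rewrite /bbScal; case: ifP => [/existsP[j /and3P[h1 h2 h3]]|/existsP h].
  rewrite mul0r /Kc KdE (_ : compat _ _ = false) ?mul0r //; apply/negP => hc.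
  have := compatP mC hc h1; case E : (C.1 (true, j)) h1 h2 => [[] k] // _ _.
  by rewrite !glue_bot !onesE (negbTE h3).
have mN : matching (cupnorm C) := cupnorm_cup pC.
rewrite mul1r /Kc !Kd_left //; apply: eq_bigr => -[[] j] _; last first.
  rewrite /wl cupnorm_top cupnorm_dot; case hj: (C.1 (false, j)).1 => //.
  rewrite (leq_trans (ltn_ord j) (pos_bot_ge hj)) (leq_trans (ltn_ord j) (pos_bot_ge (_ : (true, j).1))) //.
  by case: (C.1 (false, j)) hj => [[] k] //= _; rewrite !glue_bot !onesE.
rewrite /wl cupnorm_bot; have -> : (pos (true, j) < pos (if (C.1 (false, j)).1 then (false, j) else (true, j)))%N = false.
  by case: ifP => _; rewrite ?ltnn // pos_top pos_bot; have := ltn_ord j; lia.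
case: ifP => // hp.
have h1 : C.1 (true, j) != (true, j) by apply/eqP => E; rewrite E ltnn in hp.
have h2 : (C.1 (true, j)).1.
  by apply/negPn/negP => /pos_top_lt; rewrite ltnNge (leq_trans _ (ltnW hp)) // pos_bot leq_addr.
case hd : (C.2 (true, j)); last by case: h; exists j; rewrite h1 h2 hd.
by case: (C.1 (true, j)) h2 => [[] k] //= _; rewrite !glue_bot !onesE mul1r.
Qed.

Lemma actE_jn i c : (1 < n)%N -> matching c ->
  actE i c = (jnScal i c * bbScal (jn i c), cupnorm (jn i c)).
Proof. by move=> hn mc; rewrite /actE compD_jn // loopScal_jn. Qed.

Lemma actE_cup i c : (1 < n)%N -> cup_type c -> cup_type (actE i c).2.
Proof. move=> hn hc; have mc : matching c := hc; rewrite actE_jn //.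
by apply: cupnorm_cup; apply: jn_planar => //; apply: cup_planar. Qed.

Lemma Cop_Kc i c al : (1 < n)%N -> cup_type c ->
  Cop i (Kc c) al = (actE i c).1 * Kc (actE i c).2 al.
Proof.
move=> hn hc; have mc : matching c := hc; rewrite actE_jn //= -mulrA -Kc_cupnorm; last by apply: jn_planar => //; apply: cup_planar.
by apply: Cop_glue => //; apply: cup_planar.
Qed.

(** * Parity of the number of minus signs *)

Definition par al : bool := \big[addb/false]_j al j.

Lemma par_upd i al t : (1 < n)%N -> al (lo i) (+) al (hi i) (+) zb i ->
  par (upd i al t) = par al.
Proof.
move=> hn h; have ne : hi i != lo i by rewrite eq_sym lo_neq_hi.
rewrite /par (bigD1 (lo i)) // (bigD1 (hi i)) //= [RHS](bigD1 (lo i)) // (bigD1 (hi i)) //=.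
rewrite !ffunE eqxx lo_neq_hi // eqxx !addbA; congr addb.
  by move: h; case: (al _); case: (al _); case: (zb i); case: t.
by apply: eq_bigr => j /andP[/negbTE h1 /negbTE h2]; rewrite ffunE h1 h2.
Qed.

Lemma Cop_par i (v : Sg n -> L) b : (1 < n)%N -> (forall al, par al != b -> v al = 0) ->
  forall al, par al != b -> Cop i v al = 0.
Proof.
move=> hn hv al hal; rewrite /Cop; case h: (_ (+) _ (+) _); last by rewrite !mul0r.
rewrite big1 ?mulr0 // => t _; rewrite hv ?mulr0 // par_upd //.
Qed.

Lemma par_compat c al : cup_type c -> compat c (glue al ones) ->
  par al = (\big[addb/false]_(j | hf false c j == j) c.2 (false, j)) (+)
           (\big[addb/false]_(j | (hf false c j < j)%N) ~~ c.2 (false, j)).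
Proof.
move=> hc hcomp; have pc : planar c := hc; have K := hfK false (planar_matching pc).
rewrite /par (big_pairs _ _ K) /=; congr (_ (+) _); apply: eq_bigr => j.
  by move/eqP => h; rewrite (compat_ray hc hcomp).
move=> h; have := compat_top (j := j) pc hcomp; rewrite -val_eqE /= ltn_eqF // => /(_ isT).
by case: (al j); case: (al _); case: (c.2 _).
Qed.

Lemma Kc_compat c al : Kc c al != 0 -> compat c (glue al ones).
Proof. by rewrite /Kc KdE; case: (compat _ _) => //; rewrite mul0r eqxx. Qed.

Lemma Kc_par c al : cup_type c -> Kc c al != 0 -> par al = par (stdlab c).
Proof.
move=> hc /Kc_compat h1; have h2 : compat c (glue (stdlab c) ones).
  by apply: Kc_compat; rewrite Kc_stdlab // oner_neq0.
by rewrite (par_compat hc h1) (par_compat hc h2).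
Qed.

End Cups.

(** * Parsing sign sequences *)

Section Parsing.

(* [s] is the part of the label sequence from position [i] on, [st] the stack of positions of open "+"s. *)
Definition plus (s : seq bool) i (st : seq nat) p := (p \in st) || ((i <= p)%N && ~~ nth true s (p - i)).
(** The default values of [nth] are opposite in [plus] and [minus], so that a position beyond the
    end of [s] is neither. *)
Definition minus (s : seq bool) i k := (i <= k)%N && nth false s (k - i).

Lemma plus_push s i st p : plus (false :: s) i st p = plus s i.+1 (i :: st) p.
Proof.
rewrite /plus inE; case: (ltngtP i p) => [h|h|->] /=; rewrite ?subnn ?orbT ?orbF //.
by rewrite -[(p - i)%N]prednK ?subn_gt0 //= subnS.
Qed.

Lemma plus_skip s i st p : plus (true :: s) i st p = plus s i.+1 st p.
Proof.
rewrite /plus; case: (ltngtP i p) => [h|h|->] /=; rewrite ?subnn ?orbT ?orbF //.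
by rewrite -[(p - i)%N]prednK ?subn_gt0 //= subnS.
Qed.

Lemma plus_pop s i j st p : plus s i (j :: st) p = (p == j) || plus s i st p.
Proof. by rewrite /plus inE orbA. Qed.

Lemma minus_cons x s i k : minus (x :: s) i k = (k == i) && x || minus s i.+1 k.
Proof.
rewrite /minus; case: (ltngtP i k) => [h|h|->] /=; rewrite ?subnn ?orbF //.
by rewrite -[(k - i)%N]prednK ?subn_gt0 //= subnS.
Qed.

(** Stated for an arbitrary stack, as the induction along the sequence requires. The geometric
    content is in [parsed_out], [parsed_nest] and [parsed_exposed]: no left-over minus lies under a
    cup, and every plus under a cup or before a left-over minus is matched in time. *)
Record parsed s i st (U : seq (nat * nat)) (ms : seq nat) : Prop := Parsed {
  parsed_pair : forall j k, (j, k) \in U -> [/\ (j < k)%N, minus s i k & plus s i st j];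
  parsed_left : forall m, m \in ms -> minus s i m;
  parsed_minus : forall k, minus s i k -> k \in ms \/ exists j, (j, k) \in U;
  parsed_fst : forall j j' k, (j, k) \in U -> (j', k) \in U -> j = j';
  parsed_snd : forall j k k', (j, k) \in U -> (j, k') \in U -> k = k';
  parsed_disj : forall j k, (j, k) \in U -> k \notin ms;
  parsed_out : forall j k m, (j, k) \in U -> m \in ms -> (j < m)%N -> (m < k)%N -> False;
  parsed_nest : forall j k p, (j, k) \in U -> plus s i st p -> (j < p)%N -> (p < k)%N ->
     exists2 k', (p, k') \in U & (k' < k)%N;
  parsed_exposed : forall m p, m \in ms -> plus s i st p -> (p < m)%N ->
     exists2 k', (p, k') \in U & (k' < m)%N;
  parsed_sorted : sorted ltn ms }.

Lemma minus_ge s i k : minus s i k -> (i <= k)%N.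
Proof. by case/andP. Qed.

Lemma pm_parsed s : forall i st, sorted gtn st -> (forall p, p \in st -> p < i)%N ->
  parsed s i st (pm s i st).1 (pm s i st).2.
Proof.
elim: s => [|x s IH] i st so lt /=.
  by split=> // k; rewrite /minus nth_nil andbF.
have ltS p : p \in st -> (p < i.+1)%N by move/lt; lia.
case: x; last first.
  have so' : sorted gtn (i :: st).
    by rewrite /= path_min_sorted //; apply/allP => p /lt.
  have lt' p : p \in i :: st -> (p < i.+1)%N by rewrite inE => /orP[/eqP ->|/ltS].
  have [H1 H2 H3 H4 H5 H6 H7 H8 H9 H10] := IH i.+1 (i :: st) so' lt'.
  have E k : minus (false :: s) i k = minus s i.+1 k by rewrite minus_cons andbF.
  split=> //.
  - by move=> j k /H1; rewrite E plus_push.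
  - by move=> m /H2; rewrite E.
  - by move=> k; rewrite E; apply: H3.
  - by move=> j k p; rewrite plus_push; apply: H8.
  - by move=> m p; rewrite plus_push; apply: H9.
have E k : minus (true :: s) i k = (k == i) || minus s i.+1 k by rewrite minus_cons andbT.
case: st so lt ltS => [|j0 st] so lt ltS.
  have [H1 H2 H3 H4 H5 H6 H7 H8 H9 H10] := IH i.+1 [::] isT (fun p (h : p \in [::]) => ltS p h).
  have pge p : plus s i.+1 [::] p -> (i < p)%N by case/andP.
  split=> /=.
  - by move=> j k /H1[h1 h2 h3]; rewrite E h2 orbT plus_skip.
  - by move=> m; rewrite inE E => /orP[->|/H2 ->]; rewrite ?orbT.
  - move=> k; rewrite E inE => /orP[->|/H3 [->|]]; [by left|by left; rewrite orbT|by right].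
  - exact: H4.
  - exact: H5.
  - move=> j k h; rewrite inE negb_or (H6 _ _ h) andbT.
    by have [_ /minus_ge + _] := H1 _ _ h; case: eqP => // ->; rewrite ltnn.
  - move=> j k m h; rewrite inE => /orP[/eqP ->|]; last exact: H7.
    by have [_ _ /pge] := H1 _ _ h; lia.
  - by move=> j k p; rewrite plus_skip; apply: H8.
  - move=> m p; rewrite inE plus_skip => /orP[/eqP ->|]; last exact: H9.
    by move/pge; lia.
  - by rewrite /= path_min_sorted //; apply/allP => m /H2 /minus_ge.
have so' : sorted gtn st by move: so => /= /path_sorted.
have ltj p : p \in st -> (p < j0)%N.
  by move=> hp; have /= := so; rewrite (path_sortedE (rev_trans ltn_trans)) => /andP[/allP /(_ p hp)].
have lt' p : p \in st -> (p < i.+1)%N by move=> hp; apply: ltS; rewrite inE hp orbT.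
have j0i : (j0 < i)%N by apply: lt; rewrite inE eqxx.
have [H1 H2 H3 H4 H5 H6 H7 H8 H9 H10] := IH i.+1 st so' lt'.
have pcase p : plus s i.+1 st p -> (p < j0)%N \/ (i < p)%N.
  by case/orP=> [/ltj|/andP[]]; auto.
have kge j k : (j, k) \in (pm s i.+1 st).1 -> (i < k)%N by case/H1 => _ /minus_ge.
have j0n k : (j0, k) \notin (pm s i.+1 st).1.
  by apply/negP => /H1 [_ _ /pcase]; lia.
split=> /=.
- move=> j k; rewrite inE E plus_skip plus_pop => /orP[/eqP[-> ->]|/H1 [h1 h2 h3]].
    by rewrite !eqxx.
  by rewrite h1 h2 h3 !orbT.
- by move=> m; rewrite E => /H2 ->; rewrite orbT.
- move=> k; rewrite E => /orP[/eqP ->|/H3 [->|[j h]]]; [|by left|].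
    by right; exists j0; rewrite inE eqxx.
  by right; exists j; rewrite inE h orbT.
- move=> j j' k; rewrite !inE => /orP[/eqP[-> ->]|h] /orP[/eqP[-> //]|h'].
  + by move/kge: h'; rewrite ltnn.
  + by move=> e; move/kge: h; rewrite e ltnn.
  + exact: H4 h h'.
- move=> j k k'; rewrite !inE => /orP[/eqP[-> ->]|h] /orP[/eqP E2|h'].
  + by case: E2.
  + by move: h'; rewrite (negbTE (j0n _)).
  + by case: E2 h => -> _; rewrite (negbTE (j0n _)).
  + exact: H5 h h'.
- move=> j k; rewrite inE => /orP[/eqP[_ ->]|/H6 //].
  by apply/negP => /H2 /minus_ge; rewrite ltnn.
- move=> j k m; rewrite inE => /orP[/eqP[-> ->]|]; last exact: H7.
  by move/H2 /minus_ge; lia.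
- move=> j k p; rewrite inE plus_skip plus_pop => /orP[/eqP[-> ->]|h].
    by case/orP=> [/eqP ->|/pcase]; lia.
  case/orP=> [/eqP -> h1 h2|hp h1 h2].
    by exists i; rewrite ?inE ?eqxx //; apply: kge h.
  by have [k' h3 h4] := H8 _ _ _ h hp h1 h2; exists k'; rewrite // inE h3 orbT.
- move=> m p hm; rewrite plus_skip plus_pop => /orP[/eqP -> h|hp h].
    by exists i; rewrite ?inE ?eqxx //; move/H2/minus_ge: hm.
  by have [k' h3 h4] := H9 _ _ hm hp h; exists k'; rewrite // inE h3 orbT.
- exact: H10.
Qed.

Lemma pairup_mem l a b : (a, b) \in pairup l -> a \in l /\ b \in l.
Proof.
have [m] := ubnP (size l); elim: m l => // m IH [|x [|y l]] //= hm.
rewrite inE => /orP[/eqP[-> ->]|h]; first by rewrite !inE !eqxx orbT.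
have [|h1 h2] := IH l _ h; first lia.
by rewrite !inE h1 h2 !orbT.
Qed.

(** Pairing goes from the left, so cups join consecutive elements and only the last element can stay
    unpaired; hence a ray coming from a left-over minus stands to the right of all dotted cups. *)
Lemma pairup_spec l : sorted ltn l ->
  [/\ forall a b, (a, b) \in pairup l -> (a < b)%N,
      forall a b m, (a, b) \in pairup l -> m \in l -> (m <= a)%N || (b <= m)%N,
      forall a b a' b', (a, b) \in pairup l -> (a', b') \in pairup l ->
         [|| a == a', b == b', a == b' | b == a'] -> a = a' /\ b = b' &
      forall m, m \in l -> (forall a b, (a, b) \in pairup l -> m != a /\ m != b) ->
         forall m', m' \in l -> (m' <= m)%N].
Proof.
have [k] := ubnP (size l); elim: k l => // k IH [|x [|y l]] hk so.
- by [].
- by split=> // m; rewrite inE => /eqP -> _ m'; rewrite inE => /eqP ->.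
have tr : transitive ltn by exact: ltn_trans.
have [xy so' ly] : [/\ (x < y)%N, sorted ltn l & forall m, m \in l -> (y < m)%N].
  move: so => /= /andP[-> h]; split=> //; first exact: path_sorted h.
  by move: h; rewrite (path_sortedE tr) => /andP[/allP].
have [|H1 H2 H3 H4] := IH l _ so'; first by move: hk => /=; lia.
have lm a b : (a, b) \in pairup l -> (y < a)%N /\ (y < b)%N.
  by case/pairup_mem => /ly ? /ly.
split=> /=.
- by move=> a b; rewrite inE => /orP[/eqP[-> ->]|/H1].
- move=> a b m; rewrite !inE => /orP[/eqP[-> ->]|h].
    by case/or3P=> [/eqP ->|/eqP ->|/ly]; lia.
  case/or3P=> [/eqP ->|/eqP ->|]; last exact: H2.
    by have := lm _ _ h; lia.
  by have := lm _ _ h; lia.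
- move=> a b a' b'; rewrite !inE => /orP[/eqP[-> ->]|h] /orP[/eqP[-> ->]|h'] //.
  + by have := lm _ _ h'; lia.
  + by have := lm _ _ h; lia.
  + exact: H3.
- move=> m; rewrite !inE => hm hn m' hm'.
  have [n1 n2] : m != x /\ m != y by apply: hn; rewrite inE eqxx.
  have ml : m \in l by move: hm; rewrite (negbTE n1) (negbTE n2).
  case/or3P: hm' => [/eqP ->|/eqP ->|hm']; [by have := ly _ ml; lia|by have := ly _ ml; lia|].
  by apply: H4 => // a b h; apply: hn; rewrite inE h orbT.
Qed.

Lemma partner_in_some ps j k : partner_in ps j = Some k -> (j, k) \in ps \/ (k, j) \in ps.
Proof.
rewrite /partner_in; case: ifP => [h1|_].
  have := mem_nth (0, 0)%N; rewrite -/(is_true _) => M.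
  have := nth_find (0, 0)%N h1; have : (find (fun p => p.1 == j) ps < size ps)%N by rewrite -has_find.
  by move/(mem_nth (0, 0)%N); case: (nth _ _ _) => a b /= hm /eqP <- [<-]; left.
case: ifP => // h2.
have := nth_find (0, 0)%N h2; have : (find (fun p => p.2 == j) ps < size ps)%N by rewrite -has_find.
by move/(mem_nth (0, 0)%N); case: (nth _ _ _) => a b /= hm /eqP <- [<-]; right.
Qed.

Lemma partner_in_none ps j : partner_in ps j = None ->
  forall a b, (a, b) \in ps -> j != a /\ j != b.
Proof.
rewrite /partner_in; case: ifP => // /negbT /hasPn h1; case: ifP => // /negbT /hasPn h2 _ a b h.
by have := h1 _ h; have := h2 _ h; rewrite /= ![_ == j]eq_sym.
Qed.

End Parsing.

(** * The cup diagram of a Weyl group element *)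

Section CupDiagram.
Variables (n : nat) (w : {perm Pt n}).
Implicit Types (i j k : 'I_n) (p r : Pt n).

Let U := undotted_cups w.
Let ms := (pm (signs w) 0 [::]).2.
Let V := dotted_cups w.

Lemma size_signs : size (signs w) = n.
Proof. by rewrite size_map size_enum_ord. Qed.

Lemma nth_signs b j : nth b (signs w) j = alpha w j.
Proof.
rewrite (nth_map j) ?size_enum_ord //; congr (alpha w _).
by apply: val_inj; rewrite /= nth_enum_ord.
Qed.

Lemma plus_signs j : plus (signs w) 0 [::] j = ~~ alpha w j.
Proof. by rewrite /plus subn0 nth_signs. Qed.

Lemma minus_signs j : minus (signs w) 0 j = alpha w j.
Proof. by rewrite /minus subn0 nth_signs. Qed.

Lemma minus_lt (k : nat) : minus (signs w) 0 k -> (k < n)%N.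
Proof.
rewrite /minus subn0; case: (ltnP k n) => // h.
by rewrite nth_default // size_signs.
Qed.

Let PU : parsed (signs w) 0 [::] U ms := @pm_parsed (signs w) 0 [::] isT (fun (x : nat) h => match notF h with end).

Definition cups : seq (nat * nat) := U ++ V.

Lemma V_ms a b : (a, b) \in V -> a \in ms /\ b \in ms.
Proof. exact: pairup_mem. Qed.

Lemma V_spec :
  [/\ forall a b, (a, b) \in V -> (a < b)%N,
      forall a b m, (a, b) \in V -> m \in ms -> (m <= a)%N || (b <= m)%N,
      forall a b a' b', (a, b) \in V -> (a', b') \in V ->
         [|| a == a', b == b', a == b' | b == a'] -> a = a' /\ b = b' &
      forall m, m \in ms -> (forall a b, (a, b) \in V -> m != a /\ m != b) ->
         forall m', m' \in ms -> (m' <= m)%N].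
Proof. exact: pairup_spec (parsed_sorted PU). Qed.

Lemma ms_minus m : m \in ms -> minus (signs w) 0 m.
Proof. exact: parsed_left PU _. Qed.

Lemma plus_minus (k : nat) : plus (signs w) 0 [::] k -> minus (signs w) 0 k -> False.
Proof.
move=> h1 h2; have lt := minus_lt h2.
have : plus (signs w) 0 [::] (Ordinal lt) by [].
have : minus (signs w) 0 (Ordinal lt) by [].
by rewrite minus_signs plus_signs => ->.
Qed.

Lemma cups_lt a b : (a, b) \in cups -> (a < b)%N /\ (b < n)%N.
Proof.
rewrite mem_cat => /orP[/(parsed_pair PU) [h1 h2 _]|h]; first exact: (conj h1 (minus_lt h2)).
have [H _ _ _] := V_spec; split; first exact: H.
by have [_ /ms_minus /minus_lt] := V_ms h.
Qed.

Lemma UV_disj a b a' b' : (a, b) \in U -> (a', b') \in V ->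
  [|| a == a', b == b', a == b' | b == a'] -> False.
Proof.
move=> hU /V_ms [h1 h2]; have [_ _ ha] := parsed_pair PU hU; have hb := parsed_disj PU hU.
case/or4P=> /eqP E; subst.
- exact: plus_minus ha (ms_minus h1).
- by rewrite h2 in hb.
- exact: plus_minus ha (ms_minus h2).
- by rewrite h1 in hb.
Qed.

Lemma cups_uniq a b a' b' : (a, b) \in cups -> (a', b') \in cups ->
  [|| a == a', b == b', a == b' | b == a'] -> a = a' /\ b = b'.
Proof.
rewrite !mem_cat => /orP[] h /orP[] h' E.
- have [_ hb ha] := parsed_pair PU h; have [_ hb' ha'] := parsed_pair PU h'.
  case/or4P: E => /eqP E; subst.
  + by split=> //; apply: parsed_snd PU _ _ _ h h'.
  + by split=> //; apply: parsed_fst PU _ _ _ h h'.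
  + by case: (plus_minus ha hb').
  + by case: (plus_minus ha' hb).
- by case: (UV_disj h h' E).
- have E' : [|| a' == a, b' == b, a' == b | b' == a].
    by move: E; rewrite ![a' == _]eq_sym ![b' == _]eq_sym; case/or4P=> ->; rewrite ?orbT.
  by case: (UV_disj h' h E').
- by have [_ _ H _] := V_spec; apply: H.
Qed.

Lemma cup_partner_some j k : cup_partner w j = Some k ->
  ((j : nat), (k : nat)) \in cups \/ ((k : nat), (j : nat)) \in cups.
Proof.
have I x : (x < n)%N -> nat_of_ord (insubd j x) = x by move=> h; rewrite val_insubd h.
rewrite /cup_partner /cups -/U -/V; case E: (partner_in U j) => [x|].
  move=> [<-]; case: (partner_in_some E) => h.
    by rewrite I; [left; rewrite mem_cat h|apply: (cups_lt (a := j) _).2; rewrite mem_cat h].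
  rewrite I; [by right; rewrite mem_cat h|apply: ltn_trans (ltn_ord j)].
  by apply: (cups_lt _).1; rewrite mem_cat h.
case E2: (partner_in V j) => [x|] // [<-]; case: (partner_in_some E2) => h.
  by rewrite I; [left; rewrite mem_cat h orbT|apply: (cups_lt (a := j) _).2; rewrite mem_cat h orbT].
rewrite I; [by right; rewrite mem_cat h orbT|apply: ltn_trans (ltn_ord j)].
by apply: (cups_lt _).1; rewrite mem_cat h orbT.
Qed.

Lemma cup_partner_none j : cup_partner w j = None ->
  forall a b, (a, b) \in cups -> nat_of_ord j != a /\ nat_of_ord j != b.
Proof.
rewrite /cup_partner -/U -/V; case E: (partner_in U j) => //; case E2: (partner_in V j) => // _ a b.
by rewrite mem_cat => /orP[]; apply: partner_in_none.
Qed.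

Lemma cup_partnerE j k :
  ((j : nat), (k : nat)) \in cups \/ ((k : nat), (j : nat)) \in cups -> cup_partner w j = Some k.
Proof.
move=> h; case E: (cup_partner w j) => [k'|]; last first.
  by have N := cup_partner_none E; case: h => /N []; rewrite eqxx.
congr Some; apply: val_inj; case: (cup_partner_some E) => h'; case: h => h;
  have [|e1 e2] := cups_uniq h' h; rewrite ?eqxx ?orbT //=; congruence.
Qed.

Lemma cup_partner_sym j k : cup_partner w j = Some k -> cup_partner w k = Some j.
Proof. by move/cup_partner_some => h; apply: cup_partnerE; case: h; auto. Qed.

Lemma cup_dot_some j k : cup_partner w j = Some k ->
  cup_dot w j = (((j : nat), (k : nat)) \in V) || (((k : nat), (j : nat)) \in V).
Proof.
move=> E; have := cup_partner_some E; rewrite /cup_dot -/U -/V.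
case E1: (partner_in U j) => [x|] h.
  apply/esym/negP => hV; case: (partner_in_some E1) => hy; case/orP: hV => hV;
    by apply: (UV_disj hy hV); rewrite eqxx ?orbT.
have N := partner_in_none E1; have {h}hV : ((j : nat, k : nat) \in V) || ((k : nat, j : nat) \in V).
  by case: h; rewrite mem_cat => /orP[/N []|->]; rewrite ?eqxx ?orbT.
rewrite hV; case E2: (partner_in V j) => [//|].
by case/orP: hV => /(partner_in_none E2) []; rewrite eqxx.
Qed.

Lemma cup_dot_none j : cup_partner w j = None -> cup_dot w j = alpha w j.
Proof.
rewrite /cup_partner /cup_dot; case: (partner_in _ _) => //.
by case: (partner_in _ _).
Qed.

Lemma cupD1_top j : (cupD w).1 (false, j) =
  if cup_partner w j is Some k then (false, k) else (true, j).
Proof. by rewrite ffunE. Qed.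
Lemma cupD1_bot j : (cupD w).1 (true, j) =
  if cup_partner w j is None then (false, j) else (true, j).
Proof. by rewrite ffunE. Qed.
Lemma cupD2_top j : (cupD w).2 (false, j) = cup_dot w j.
Proof. by rewrite ffunE. Qed.

Lemma alpha_cups j k : ((j : nat), (k : nat)) \in cups ->
  alpha w k /\ alpha w j = (((j : nat), (k : nat)) \in V).
Proof.
rewrite mem_cat => /orP[h|h].
  have [_ h1 h2] := parsed_pair PU h; rewrite minus_signs in h1; rewrite plus_signs in h2.
  split=> //; rewrite (negbTE h2); apply/esym/negP => hV.
  by apply: (UV_disj h hV); rewrite eqxx.
by have [/ms_minus + /ms_minus] := V_ms h; rewrite !minus_signs h.
Qed.

Lemma ms_alpha j : alpha w j -> (nat_of_ord j \in ms) \/ exists a, (a, nat_of_ord j) \in U.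
Proof. by rewrite -minus_signs => /(parsed_minus PU). Qed.

(** A plus before a left-over minus would have been matched, so a ray in that place is itself a
    left-over minus. *)
Lemma cup_ray_left m j : m \in ms -> cup_partner w j = None -> (j < m)%N -> alpha w j /\ nat_of_ord j \in ms.
Proof.
move=> hm hj lt; have N := cup_partner_none hj.
case aj: (alpha w j); last first.
  have [|k h _] := parsed_exposed PU hm (p := j) _ lt; first by rewrite plus_signs aj.
  by have [] := N j k; rewrite ?mem_cat ?h // eqxx.
split=> //; case: (ms_alpha aj) => // -[a h].
by have [] := N a j; rewrite ?mem_cat ?h // eqxx.
Qed.

Lemma cupD_cup : cup_type (cupD w).
Proof.
have left_top p : (pos p < pos ((cupD w).1 p))%N -> exists j, p = (false, j).
  case: p => [[] j]; last by exists j.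
  rewrite cupD1_bot; case: (cup_partner w j) => [k|]; rewrite ?ltnn // pos_bot pos_top => h.
  by have := ltn_ord j; lia.
have [V1 V2 V3 V4] := V_spec.
have cup_of j k : cup_partner w j = Some k -> (j < k)%N -> ((j : nat), (k : nat)) \in cups.
  by move/cup_partner_some => [//|/cups_lt []]; lia.
split; last by move=> j; rewrite cupD1_bot; case: (cup_partner w j); [left|right].
split; first split.
- move=> [[] j].
    rewrite cupD1_bot; case E: (cup_partner w j) => [k|]; rewrite ?cupD1_bot ?cupD1_top E //.
  rewrite cupD1_top; case E: (cup_partner w j) => [k|]; last by rewrite cupD1_bot E.
  by rewrite cupD1_top (cup_partner_sym E).
- move=> [[] j].
    by rewrite cupD1_bot; case E: (cup_partner w j) => [k|] //; rewrite !ffunE /= E eqxx.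
  rewrite cupD1_top; case E: (cup_partner w j) => [k|]; last by rewrite !ffunE /= E eqxx.
  by rewrite !cupD2_top (cup_dot_some E) (cup_dot_some (cup_partner_sym E)) orbC.
- move=> [[] j]; first by rewrite cupD1_bot; case E: (cup_partner w j) => [k|] //; rewrite !ffunE /= E.
  rewrite cupD1_top; case E: (cup_partner w j) => [k|] // [Ek].
  by have := cup_partner_some E; rewrite Ek; case=> /cups_lt []; rewrite ltnn.
- move=> j; rewrite cupD1_top; case E: (cup_partner w j) => [k|]; last by rewrite xpair_eqE.
  rewrite xpair_eqE /=; apply/eqP => Ek.
  by have := cup_partner_some E; rewrite Ek; case=> /cups_lt []; rewrite ltnn.
- move=> p r h1 h2 h3; have [j Ej] := left_top p (ltn_trans h1 h2).
  have [k Ek] := left_top r (ltn_trans h2 h3); subst p r.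
  move: h1 h2 h3; rewrite !cupD1_top pos_top.
  case Ej: (cup_partner w j) => [j'|]; case Ek: (cup_partner w k) => [k'|];
    rewrite !(pos_bot, pos_top).
  (* Two cups cannot cross: an undotted cup closes every plus under it and covers no left-over
     minus, while a dotted cup joins consecutive left-over minuses and closes every plus before its
     right end. *)
  + move=> h1 h2 h3; have hj := cup_of _ _ Ej (ltn_trans h1 h2).
    have hk := cup_of _ _ Ek (ltn_trans h2 h3); move: hj hk (hj) (hk); rewrite {1 2}/cups !mem_cat.
    case/orP=> hj /orP[hk|hk] hj' hk'.
    * have [_ _ pk] := parsed_pair PU hk; have [x hx lt] := parsed_nest PU hj pk h1 h2.
      by have E := parsed_snd PU hk hx; lia.
    * by have [h _] := V_ms hk; apply: (parsed_out PU hj h).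
    * have [_ h] := V_ms hj; have [_ _ pk] := parsed_pair PU hk.
      have [x hx lt] := parsed_exposed PU h pk h2.
      by have E := parsed_snd PU hk hx; lia.
    * by have [h _] := V_ms hk; have := V2 _ _ _ hj h; lia.
  + move=> h1 h2 _; have hj := cup_of _ _ Ej (ltn_trans h1 h2).
    have N := cup_partner_none Ek.
    move: hj; rewrite mem_cat => /orP[hj|hj].
      case ak: (alpha w k); last first.
        have [|x hx _] := parsed_nest PU hj (p := k) _ h1 h2; first by rewrite plus_signs ak.
        by have [] := N k x; rewrite ?mem_cat ?hx // eqxx.
      case: (ms_alpha ak) => [hm|[a h]]; first exact: (parsed_out PU hj hm).
      by have [] := N a k; rewrite ?mem_cat ?h // eqxx.
    have [m1 m2] := V_ms hj; have [ak hm] := cup_ray_left m2 Ek h2.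
    by have := V2 _ _ _ hj hm; lia.
  + by have := ltn_ord k'; lia.
  + by have := ltn_ord j; have := ltn_ord k; lia.
- move=> p r dp h1 h2 h3; have [j Ej] := left_top p h1.
  have [k Ek] := left_top r (ltn_trans h2 (ltn_trans h1 h3)); subst p r.
  move: dp h1 h2 h3; rewrite cupD2_top !cupD1_top !pos_top.
  have maxm (x : 'I_n) : cup_partner w x = None -> nat_of_ord x \in ms ->
      forall m', m' \in ms -> (m' <= x)%N.
    by move=> Ex hx; apply: V4 => // a b h; apply: (cup_partner_none Ex); rewrite mem_cat h orbT.
  (* Such a ray would be an unpaired left-over minus, hence the last of them, which the presence of
     [m] contradicts. *)
  have ray m : m \in ms -> cup_partner w k = None -> (k < m)%N -> False.
    move=> hm E lt; have [_ hk] := cup_ray_left hm E lt.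
    by have := maxm _ E hk _ hm; lia.
  case Ej: (cup_partner w j) => [j'|]; case Ek: (cup_partner w k) => [k'|];
    rewrite !(pos_bot, pos_top).
  + rewrite (cup_dot_some Ej) => /orP[hV h1 h2 h3|/V1]; last by lia.
    have [mj _] := V_ms hV.
    have := cup_of _ _ Ek (ltn_trans h2 (ltn_trans h1 h3)); rewrite mem_cat => /orP[hk|hk].
      by apply: (parsed_out PU hk mj h2); lia.
    by have := V2 _ _ _ hk mj; lia.
  + rewrite (cup_dot_some Ej) => /orP[hV h1 h2 _|/V1]; last by lia.
    by have [mj _] := V_ms hV; apply: (ray _ mj).
  + by have := ltn_ord k'; lia.
  + rewrite cup_dot_none // => /ms_alpha [hm _ h2 _|[a h]]; first exact: (ray _ hm).
    by have [] := cup_partner_none Ej (a := a) (b := j); rewrite ?mem_cat ?h // eqxx.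
Qed.

Definition alphaf : Sg n := [ffun j => alpha w j].

Lemma stdlab_cupD : stdlab (cupD w) = alphaf.
Proof.
apply/ffunP => j; rewrite [RHS]ffunE [LHS]ffunE cupD1_top cupD2_top.
case E: (cup_partner w j) => [k|]; last first.
  rewrite pos_bot cup_dot_none //; case: ltnP => // h.
  by have := ltn_ord j; lia.
rewrite pos_top (cup_dot_some E); case: (cup_partner_some E) => h.
  have [h1 _] := cups_lt h; have [_ ->] := alpha_cups h; rewrite ltnNge ltnW //=.
  case: (boolP (_ \in V)) => //= _; apply/negP => h2; have [H _ _ _] := V_spec.
  by have := H _ _ h2; lia.
by have [h1 _] := cups_lt h; have [-> _] := alpha_cups h; rewrite h1.
Qed.

End CupDiagram.

(** * Lengths in the Weyl group *)

Section WeylLength.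
Variables (n : nat) (hn : (1 < n)%N).
Implicit Types (i j k : 'I_n) (p r : Pt n) (w v : {perm Pt n}).

(* The order -n < ... < -1 < 1 < ... < n on signed points. *)
Definition rk p : nat := if p.1 then (n - p.2.+1)%N else (n + p.2)%N.
Definition ng p : Pt n := (~~ p.1, p.2).

Lemma rk_inj : injective rk.
Proof.
move=> [b j] [c k]; rewrite /rk /=; have := ltn_ord j; have := ltn_ord k.
by case: b; case: c => hk hj h; congr pair; try apply: val_inj => /=; lia.
Qed.

Lemma rk_ng p : (rk (ng p) + rk p).+1 = (n + n)%N.
Proof. by case: p => [[] j]; rewrite /rk /=; have := ltn_ord j; lia. Qed.

Lemma srefE i p : sref i p = if p.2 == lo i then (p.1 (+) zb i, hi i) else
                     if p.2 == hi i then (p.1 (+) zb i, lo i) else p.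
Proof.
have lh := lo_neq_hi hn i; have hl : (hi i == lo i) = false by rewrite eq_sym.
rewrite /sref -/(zb i); case: p => b j /=.
case: (j =P lo i) => [->|/eqP /negbTE h1]; [|case: (j =P hi i) => [->|/eqP /negbTE h2]];
  by case: (zb i); case: b; rewrite permM !permE /= !xpair_eqE ?eqxx ?lh ?hl ?h1 ?h2 //=
     ?xpair_eqE ?eqxx ?lh ?hl ?h1 ?h2.
Qed.

Lemma srefK i p : sref i (sref i p) = p.
Proof.
have lh := lo_neq_hi hn i; have hl : (hi i == lo i) = false by rewrite eq_sym.
case: p => b j; rewrite [sref i (b, j)]srefE /=; case: ifP => [/eqP ->|h1].
  by rewrite srefE /= hl eqxx addbK.
case: ifP => [/eqP ->|h2]; first by rewrite srefE /= eqxx addbK.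
by rewrite srefE /= h1 h2.
Qed.

Lemma sref_sq i : (sref i * sref i)%g = 1%g.
Proof. by apply/permP => p; rewrite permM srefK perm1. Qed.

Lemma srefV i : ((sref i)^-1)%g = sref i.
Proof. by rewrite -[LHS]mulg1 -(sref_sq i) mulKg. Qed.

Lemma sref_ng i p : sref i (ng p) = ng (sref i p).
Proof. by rewrite !srefE /=; do 2?case: ifP => // _; rewrite /ng /= addNb. Qed.

Definition ngc w := forall p, w (ng p) = ng (w p).

Lemma wprod_cons i t : @wprod n (i :: t) = (sref i * wprod t)%g.
Proof. by rewrite /wprod big_cons. Qed.
Lemma wprod_nil : @wprod n [::] = 1%g.
Proof. by rewrite /wprod big_nil. Qed.
Lemma wprod_rcons t i : @wprod n (rcons t i) = (wprod t * sref i)%g.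
Proof. by rewrite /wprod -cats1 big_cat big_seq1. Qed.
Lemma wprod_rev t : @wprod n (rev t) = ((wprod t)^-1)%g.
Proof.
elim: t => [|i t IH]; first by rewrite wprod_nil invg1.
by rewrite rev_cons wprod_rcons IH wprod_cons invMg srefV.
Qed.

Lemma sref_in i : sref i \in Wgrp n.
Proof. by apply: mem_gen; apply: imset_f. Qed.

Lemma wprod_in t : @wprod n t \in Wgrp n.
Proof.
elim: t => [|i t IH]; first by rewrite wprod_nil group1.
by rewrite wprod_cons groupM // sref_in.
Qed.

Lemma WgrpP w : w \in Wgrp n -> exists t, w = wprod t.
Proof.
case/gen_prodgP => m [c hc ->].
elim: m c hc => [|m IH] c hc; first by exists [::]; rewrite big_ord0 wprod_nil.
have [t ht] := IH (fun x : 'I_m => c (lift ord0 x)) (fun x => hc _).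
case/imsetP: (hc ord0) => i _ E; exists (i :: t).
by rewrite big_ord_recl E wprod_cons -ht.
Qed.

Lemma Wgrp_ng w : w \in Wgrp n -> ngc w.
Proof.
case/WgrpP => t ->; elim: t => [|i t IH] p; first by rewrite wprod_nil !perm1.
by rewrite wprod_cons !permM sref_ng IH.
Qed.

Definition sgpar w : bool := \big[addb/false]_j (w (false, j)).1.

Lemma sgpar_sref w i : ngc w -> sgpar (sref i * w)%g = sgpar w.
Proof.
move=> hw; have ne : hi i != lo i by rewrite eq_sym lo_neq_hi.
have S b j : (w (b, j)).1 = b (+) (w (false, j)).1.
  by case: b => //; have := hw (false, j); rewrite /ng /= => ->.
rewrite /sgpar (bigD1 (lo i)) // (bigD1 (hi i)) //= [RHS](bigD1 (lo i)) // (bigD1 (hi i)) //=.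
rewrite !permM !srefE /= (negbTE ne) !eqxx !addbA; congr addb.
  rewrite S [(w (zb i, lo i)).1]S.
  by case: (zb i); case: (w _).1; case: (w _).1.
by apply: eq_bigr => j /andP[/negbTE h1 /negbTE h2]; rewrite permM srefE /= h1 h2.
Qed.

Lemma Wgrp_sgpar w : w \in Wgrp n -> sgpar w = false.
Proof.
case/WgrpP => t ->; elim: t => [|i t IH].
  by rewrite wprod_nil /sgpar big1 // => j _; rewrite perm1.
by rewrite wprod_cons sgpar_sref //; apply/Wgrp_ng/wprod_in.
Qed.

(** The pair [r1 i], [r2 i] encodes the simple root of s_i as two signed points exchanged by s_i;
    for i = 0 these are -1 and 2. *)
Definition r1 i : Pt n := (zb i, lo i).
Definition r2 i : Pt n := (false, hi i).

Lemma sref_r1 i : sref i (r1 i) = r2 i.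
Proof. by rewrite srefE /= eqxx /r2 addbb. Qed.
Lemma sref_r2 i : sref i (r2 i) = r1 i.
Proof. by rewrite -sref_r1 srefK. Qed.

Definition special i (pr : Pt n * Pt n) := (pr == (r1 i, r2 i)) || (pr == (ng (r2 i), ng (r1 i))).

(** Leaving out opposite pairs restricts to the roots of type D. The pairs (p, p') and (-p', -p)
    stand for the same root, so every inversion is counted twice; this explains the doublings
    below. *)
Definition Inv w : {set Pt n * Pt n} :=
  [set pr | [&& (rk pr.1 < rk pr.2)%N, pr.2 != ng pr.1 & (rk (w pr.2) < rk (w pr.1))%N]].

(** The analogue of the fact that a simple reflection permutes the positive roots other than its
    own. *)
Lemma sref_mono i p p' : (rk p < rk p')%N -> p' != ng p -> ~~ special i (p, p') ->
  (rk (sref i p) < rk (sref i p'))%N.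
Proof.
have z0 : zb i -> lo i = 0 :> nat by exact: lo_eq0.
have hl := hi_lo hn i; have := ltn_ord (hi i); rewrite hl.
case: p => b j; case: p' => b' j'; rewrite /special /ng /r1 /r2 !xpair_eqE /= !srefE /rk /=.
have E (x y : 'I_n) : (x == y) = (x == y :> nat) by [].
rewrite !E; have := ltn_ord j; have := ltn_ord j'.
move: (zb i) z0 hl; case: (j =P lo i :> nat) => [->|n1]; [|case: (j =P hi i :> nat) => [->|n2]];
(case: (j' =P lo i :> nat) => [->|n3]; [|case: (j' =P hi i :> nat) => [->|n4]]);
 case; case: b; case: b' => /=; rewrite ?eqxx /=; lia.
Qed.

Lemma special_rk i pr : special i pr -> (rk pr.1 < rk pr.2)%N /\ pr.2 != ng pr.1.
Proof.
have z0 : zb i -> lo i = 0 :> nat by exact: lo_eq0.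
have hl := hi_lo hn i; have lt := ltn_ord (hi i).
have E : hi i != lo i by rewrite eq_sym lo_neq_hi.
case/orP=> /eqP -> /=; rewrite /ng /r1 /r2 /rk xpair_eqE /=; split.
- by case: (zb i) z0 => z0; [have := z0 isT|]; lia.
- by rewrite negb_and E orbT.
- by case: (zb i) z0 => z0; [have := z0 isT|]; simpl; lia.
- by rewrite lo_neq_hi ?andbF.
Qed.

Lemma sref_special i pr : special i (sref i pr.1, sref i pr.2) -> special i (pr.2, pr.1).
Proof.
case: pr => p p' /orP[] /eqP[/(congr1 (sref i)) + /(congr1 (sref i))];
  rewrite !srefK ?sref_ng ?sref_r1 ?sref_r2 => -> ->; by rewrite /special eqxx ?orbT.
Qed.

(** An inequality suffices: applied to [w] and to [sref i * w] it gives equality, s_i being an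
    involution. *)
Lemma card_Inv_nonspecial w i :
  (#|[set pr in Inv (sref i * w)%g | ~~ special i pr]| <= #|[set pr in Inv w | ~~ special i pr]|)%N.
Proof.
pose phi (pr : Pt n * Pt n) := (sref i pr.1, sref i pr.2).
have inj : injective phi by move=> [a b] [c d] [/perm_inj -> /perm_inj ->].
rewrite -(card_imset _ inj); apply/subset_leq_card/subsetP => _ /imsetP [[p p'] + ->].
rewrite !inE /= !permM => /andP[/and3P[h1 h2 h3] h4].
rewrite sref_mono // h3 -sref_ng (inj_eq (@perm_inj _ (sref i))) h2 /=.
apply/negP => /(@sref_special i (p, p')) /special_rk [/= h5 _]; lia.
Qed.

Lemma card_Inv_special w i : ngc w ->
  #|[set pr in Inv w | special i pr]| = (if (rk (w (r2 i)) < rk (w (r1 i)))%N then 2 else 0)%N.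
Proof.
move=> hw.
have E pr : special i pr -> (pr \in Inv w) = (rk (w (r2 i)) < rk (w (r1 i)))%N.
  move=> h; have [h1 h2] := special_rk h; rewrite inE h1 h2 /=.
  case/orP: h => /eqP -> //=; rewrite !hw.
  by have := rk_ng (w (r1 i)); have := rk_ng (w (r2 i)); lia.
have sp1 : special i (r1 i, r2 i) by rewrite /special eqxx.
case: ifP => h.
  have -> : [set pr in Inv w | special i pr] = [set (r1 i, r2 i); (ng (r2 i), ng (r1 i))].
    apply/setP => pr; rewrite inE !in_set2; case h2: (special i pr); first by rewrite E // h.
    by rewrite andbF; symmetry.
  rewrite cards2 xpair_eqE negb_and (_ : r1 i != ng (r2 i)) //.
  by rewrite /ng /r1 /r2 xpair_eqE lo_neq_hi // andbF.
by apply/eqP; rewrite cards_eq0; apply/eqP/setP => pr; rewrite inE in_set0;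
  case h2: (special i pr); rewrite ?andbF // E // h.
Qed.

Lemma card_Inv w i : #|Inv w| = (#|[set pr in Inv w | special i pr]| + #|[set pr in Inv w | ~~ special i pr]|)%N.
Proof.
rewrite -cardsUI (_ : _ :&: _ = set0) ?cards0 ?addn0; last first.
  by apply/setP => pr; rewrite !inE; case: (special i pr); rewrite ?andbF.
by apply: eq_card => pr; rewrite !inE; case: (special i pr); rewrite ?andbT ?andbF ?orbF.
Qed.

Lemma Inv_sref w i : ngc w -> ((rk (w (r1 i)) < rk (w (r2 i)))%N -> #|Inv (sref i * w)%g| = #|Inv w| + 2)%N /\
  ((rk (w (r2 i)) < rk (w (r1 i)))%N -> #|Inv w| = #|Inv (sref i * w)%g| + 2)%N.
Proof.
move=> hw; have hsw : ngc (sref i * w)%g by move=> p; rewrite !permM sref_ng hw.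
rewrite (card_Inv w i) (card_Inv (sref i * w)%g i) !card_Inv_special // !permM sref_r1 sref_r2.
have := card_Inv_nonspecial w i; have := card_Inv_nonspecial (sref i * w)%g i.
rewrite mulgA sref_sq mul1g => h1 h2; have -> : #|[set pr in Inv w | ~~ special i pr]| = #|[set pr in Inv (sref i * w)%g | ~~ special i pr]|.
  by apply/eqP; rewrite eqn_leq h1 h2.
by split=> h; rewrite h ltnNge (ltnW h) /= ?add0n ?addn0 addnC.
Qed.

Lemma rk_r12 w i : rk (w (r1 i)) != rk (w (r2 i)).
Proof.
by rewrite (inj_eq rk_inj) (inj_eq (@perm_inj _ w)) /r1 /r2 xpair_eqE lo_neq_hi // andbF.
Qed.

Lemma Inv_wprod t : (#|Inv (@wprod n t)| <= (size t).*2)%N.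
Proof.
elim: t => [|i t IH].
  rewrite wprod_nil leqn0 cards_eq0; apply/eqP/setP => pr; rewrite !inE !perm1.
  by case: ltngtP; rewrite ?andbF.
rewrite wprod_cons /=; have hw := Wgrp_ng (wprod_in t); have [h1 h2] := Inv_sref i hw.
case: (ltngtP (rk (wprod t (r1 i))) (rk (wprod t (r2 i)))) (rk_r12 (wprod t) i) => // h _.
  by rewrite (h1 h) doubleS addn2 !ltnS.
rewrite doubleS; apply: leq_trans (leqW (leqW IH)); rewrite (h2 h); exact: leq_addr.
Qed.

Lemma mono_ord_id (f : 'I_n -> 'I_n) : (forall j k, (j < k)%N -> (f j < f k)%N) -> f =1 id.
Proof.
move=> hf; have ge m : forall j, nat_of_ord j = m -> (m <= f j)%N.
  elim: m => // m IH j Ej; have lt : (m < n)%N by have := ltn_ord j; lia.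
  have /= := IH (Ordinal lt) erefl; have := hf (Ordinal lt) j; rewrite /= Ej => /(_ (ltnSn _)); lia.
have le m : forall j, (n - (nat_of_ord j).+1)%N = m -> (m <= n - (f j).+1)%N.
  elim: m => // m IH j Ej; have lt : (j.+1 < n)%N by lia.
  have /= := IH (Ordinal lt); have := hf j (Ordinal lt); rewrite /= => /(_ (ltnSn _)).
  have := ltn_ord (f (Ordinal lt)); move=> h1 h2 /(_ _) h3.
  have : (m <= n - (f (Ordinal lt)).+1)%N by apply: h3; lia.
  lia.
move=> j; apply: val_inj => /=; have := ge _ j erefl; have := le _ j erefl.
by have := ltn_ord j; have := ltn_ord (f j); lia.
Qed.

Lemma increasing_adj (f : 'I_n -> nat) :
  (forall i, i != 0 :> nat -> (f (lo i) < f (hi i))%N) -> forall j k, (j < k)%N -> (f j < f k)%N.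
Proof.
move=> h j k; have [m] := ubnP (k - j)%N; elim: m j k => // m IH j k hm jk.
have k0 : k != 0 :> nat by lia.
have [l1 l2] := lo_val_pos k0; have := h _ k0; rewrite l2 => lt.
have [E|ne] := eqVneq (j : nat) k.-1.
  by have -> : j = lo k; [apply: val_inj; rewrite /= E l1|].
by apply: ltn_trans lt; apply: IH; rewrite l1; lia.
Qed.

Lemma perm_ng_id w : ngc w -> (forall j, w (false, j) = (false, j)) -> w = 1%g.
Proof.
move=> hw h; apply/permP => -[[] j]; rewrite perm1 //.
by have := hw (false, j); rewrite /ng /= => ->; rewrite h.
Qed.

(** No descent at i > 0 makes [w] increasing on positive points. No descent at 0 says -w(1) < w(2),
    which makes all images after the first positive, and the even number of sign changes settles the
    first one. *)
Lemma no_descent w : w \in Wgrp n -> (forall i, (rk (w (r1 i)) < rk (w (r2 i)))%N) -> w = 1%g.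
Proof.
move=> hW h; have hw := Wgrp_ng hW.
have inc : forall j k, (j < k)%N -> (rk (w (false, j)) < rk (w (false, k)))%N.
  apply: (@increasing_adj (fun j => rk (w (false, j)))) => i i0.
  by have := h i; rewrite /r1 /r2 /zb (negbTE i0).
have n0 : (0 < n)%N by lia.
pose o0 := Ordinal n0; pose o1 := Ordinal hn.
have pos1 j : (0 < j)%N -> (w (false, j)).1 = false.
  have := h o0; have -> : r1 o0 = ng (false, o0).
    by rewrite /r1 /zb /lo /ng.
  have -> : r2 o0 = (false, o1) by rewrite /r2; congr pair; apply: val_inj; rewrite /= hi_lo.
  rewrite hw => h1 h2; have h3 : (rk (w (false, o1)) <= rk (w (false, j)))%N.
    have [->|ne] := eqVneq o1 j; first by [].
    by apply/ltnW/inc; move: ne; rewrite -val_eqE /=; lia.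
  have h4 := inc o0 o1 isT; have := rk_ng (w (false, o0)).
  case: (w (false, j)) h3 => [[] x] //= h3.
  have : (rk (true, x) < n)%N by rewrite /rk /=; have := ltn_ord x; lia.
  move: (rk (ng (w (false, o0)))) (rk (w (false, o0))) (rk (w (false, o1))) (rk (true, x)) h1 h3 h4 => a b c d.
  by clear; lia.
have p0 : (w (false, o0)).1 = false.
  have := Wgrp_sgpar hW; rewrite /sgpar (bigD1 o0) //= big1 ?addbF // => j ne.
  by apply: pos1; move: ne; rewrite -val_eqE /=; lia.
have pw j : w (false, j) = (false, (w (false, j)).2).
  rewrite [LHS]surjective_pairing; congr pair; case: (posnP j) => [E|]; last exact: pos1.
  by rewrite (_ : j = o0) //; apply: val_inj.
apply: perm_ng_id => // j; rewrite pw; congr pair.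
apply: (@mono_ord_id (fun j => (w (false, j)).2)) => {}j k jk.
by have := inc _ _ jk; rewrite pw [w (false, k)]pw /rk /=; lia.
Qed.

Lemma short_word w : w \in Wgrp n -> exists2 t, w = wprod t & (size t).*2 = #|Inv w|.
Proof.
have [m] := ubnP #|Inv w|; elim: m w => // m IH w hm hW.
case: (boolP [exists i, (rk (w (r2 i)) < rk (w (r1 i)))%N]) => [/existsP[i hi]|/existsPn h].
  have [_ /(_ hi) E] := Inv_sref i (Wgrp_ng hW).
  have [|t Et st] := IH (sref i * w)%g _ (groupM (sref_in i) hW); first by lia.
  exists (i :: t); last by rewrite E /= -st; lia.
  by rewrite wprod_cons -Et mulgA sref_sq mul1g.
have -> : w = 1%g.
  apply: no_descent => // i; have := h i; have := rk_r12 w i; lia.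
by exists [::]; rewrite ?wprod_nil //=; have := Inv_wprod [::]; rewrite wprod_nil /=; lia.
Qed.

(** [lenW] only searches word lengths up to the number of permutations. This crude bound keeps the
    shortest word within that range, so that [find] succeeds. *)
Lemma Inv_bound w : (#|Inv w| <= #|{: {perm Pt n}}|.*2)%N.
Proof.
have -> : #|{: {perm Pt n}}| = (n.*2)`!.
  have -> : n.*2 = #|[set: Pt n]| by rewrite cardsT card_prod card_bool card_ord mul2n.
  rewrite -card_perm; apply: eq_card => s; rewrite !inE; apply/esym/subsetP => p _.
  by rewrite inE.
apply: leq_trans (max_card _) _; rewrite !card_prod card_bool card_ord.
have [m ->] : exists m, n = m.+2 by exists n.-2; lia.
rewrite !doubleS 2!factS; have := fact_gt0 (m.*2).+2; move: (_ `!) => F hF.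
have h : (2 * m.+2 * (2 * m.+2) <= (m.*2.+4 * m.*2.+3).*2)%N by rewrite -!muln2; nia.
by apply: leq_trans h _; rewrite leq_double mulnA leq_pmulr.
Qed.

Lemma lenW_wprod t : (lenW (@wprod n t)).*2 = #|Inv (wprod t)|.
Proof.
have [t' E st] := short_word (wprod_in t).
have hb := Inv_bound (wprod t).
set a := fun x : nat => [exists u : x.-tuple 'I_n, wprod t == wprod u].
have ha : a (size t').
  by apply/existsP; exists (in_tuple t'); rewrite E.
have hs : (size t' < (#|{: {perm Pt n}}|).+1)%N by lia.
have le : (lenW (wprod t) <= size t')%N.
  rewrite /lenW -/a leqNgt; apply/negP => lt.
  by have := before_find 0%N lt; rewrite nth_iota // ha.
apply/eqP; rewrite eqn_leq -{1}st leq_double le /=.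
have hf : has a (iota 0 (#|{: {perm Pt n}}|).+1).
  by apply/hasP; exists (size t') => //; rewrite mem_iota.
have := nth_find 0%N hf; rewrite has_find size_iota in hf.
rewrite nth_iota // add0n -/(lenW (wprod t)) => /existsP[u /eqP E2].
by have := Inv_wprod u; rewrite -E2 size_tuple.
Qed.

Lemma lenW_Inv w : w \in Wgrp n -> (lenW w).*2 = #|Inv w|.
Proof. by case/WgrpP => t ->; apply: lenW_wprod. Qed.

Lemma lenW_word w : w \in Wgrp n -> exists2 t, w = wprod t & size t = lenW w.
Proof.
move=> hW; have [t E st] := short_word hW; exists t => //.
by have := lenW_Inv hW; lia.
Qed.

Lemma lenW_le t : (lenW (@wprod n t) <= size t)%N.
Proof. by have := lenW_wprod t; have := Inv_wprod t; lia. Qed.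

Lemma lenW1 : lenW (1%g : {perm Pt n}) = 0%N.
Proof. by have := lenW_le [::]; rewrite wprod_nil /=; lia. Qed.

Lemma lenW_left w i : w \in Wgrp n ->
  ((lenW w < lenW (sref i * w)%g)%N = (rk (w (r1 i)) < rk (w (r2 i)))%N) /\
  ((lenW w < lenW (sref i * w)%g)%N -> lenW (sref i * w)%g = (lenW w).+1) /\
  (~~ (lenW w < lenW (sref i * w)%g)%N -> lenW w = (lenW (sref i * w)%g).+1).
Proof.
move=> hW; have hsW := groupM (sref_in i) hW.
have e1 := lenW_Inv hW; have e2 := lenW_Inv hsW; have [h1 h2] := Inv_sref i (Wgrp_ng hW).
have := rk_r12 w i; move: e1 e2 h1 h2.
move: (lenW w) (lenW (sref i * w)%g) #|Inv w| #|Inv (sref i * w)%g| (rk (w (r1 i))) (rk (w (r2 i))) => l1 l2 c1 c2 k1 k2.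
by clear; case: (ltngtP k1 k2) => // h e1 e2 h1 h2 _; [have e3 := h1 isT|have e3 := h2 isT];
  split; lia.
Qed.

Lemma lenWV w : w \in Wgrp n -> lenW (w^-1)%g = lenW w.
Proof.
have le v : v \in Wgrp n -> (lenW (v^-1)%g <= lenW v)%N.
  by move=> /lenW_word [t -> <-]; rewrite -wprod_rev -(size_rev t) lenW_le.
move=> hW; apply/eqP; rewrite eqn_leq le //= -{1}[w]invgK le // groupV //.
Qed.

Lemma lenW_right w i : w \in Wgrp n ->
  ((lenW w < lenW (w * sref i)%g)%N = (rk ((w^-1)%g (r1 i)) < rk ((w^-1)%g (r2 i)))%N) /\
  ((lenW w < lenW (w * sref i)%g)%N -> lenW (w * sref i)%g = (lenW w).+1) /\
  (~~ (lenW w < lenW (w * sref i)%g)%N -> lenW w = (lenW (w * sref i)%g).+1).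
Proof.
move=> hW; have hV : (w^-1)%g \in Wgrp n by rewrite groupV.
have := lenW_left i hV; have -> : (sref i * w^-1 = (w * sref i)^-1)%g by rewrite invMg srefV.
by rewrite !lenWV // groupM // sref_in.
Qed.

End WeylLength.

(** * The module N as functions on sign sequences *)

Section Cosets.
Variables (n : nat) (hn : (1 < n)%N).
Implicit Types (i j k : 'I_n) (p r : Pt n) (w v : {perm Pt n}) (al be : Sg n).

Definition moved i al := al (lo i) (+) al (hi i) (+) zb i.

Lemma upd_hi i al t : upd i al t (hi i) = t.
Proof. by rewrite ffunE eqxx. Qed.
Lemma upd_lo i al t : upd i al t (lo i) = ~~ t (+) zb i.
Proof. by rewrite ffunE lo_neq_hi // eqxx. Qed.

Lemma moved_upd i al t : moved i (upd i al t).
Proof. by rewrite /moved upd_hi upd_lo; case: t; case: (zb i). Qed.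

Lemma upd_id i al : moved i al -> upd i al (al (hi i)) = al.
Proof.
move=> h; apply/ffunP => j; rewrite ffunE; case: ifP => [/eqP -> //|_].
case: ifP => [/eqP ->|//]; move: h; rewrite /moved.
by case: (al _); case: (al _); case: (zb i).
Qed.

Lemma upd_upd i al s t : upd i (upd i al s) t = upd i al t.
Proof. by apply/ffunP => j; rewrite !ffunE; case: (j == hi i) => //; case: (j == lo i). Qed.

Lemma stat_upd i al : stat (upd i al true) = (stat (upd i al false)).+1.
Proof.
have ne : hi i != lo i by rewrite eq_sym lo_neq_hi.
rewrite /stat (bigD1 (lo i)) // (bigD1 (hi i)) //= [in RHS](bigD1 (lo i)) // [in RHS](bigD1 (hi i)) //=.
rewrite !upd_hi !upd_lo (eq_bigr (fun j => upd i al false j * j)%N); last first.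
  by move=> j /andP[/negbTE h1 /negbTE h2]; rewrite !ffunE h1 h2.
rewrite hi_lo //=; have : zb i -> lo i = 0%N :> nat by exact: lo_eq0.
by case: (zb i) => [/(_ isT) ->|_] /=; lia.
Qed.

Lemma inv_sign w b j : w \in Wgrp n -> ((w^-1)%g (b, j)).1 = b (+) alphaf w j.
Proof.
move=> hW; have hV : (w^-1)%g \in Wgrp n by rewrite groupV.
rewrite ffunE /alpha; case: b => //.
by have := Wgrp_ng hn hV (false, j); rewrite /ng /= => ->.
Qed.

Lemma alpha_right w i : w \in Wgrp n ->
  alphaf (w * sref i)%g = if moved i (alphaf w) then upd i (alphaf w) (~~ alphaf w (hi i)) else alphaf w.
Proof.
move=> hW; have S b j := inv_sign b j hW.
have E j : alphaf (w * sref i)%g j = ((w^-1)%g (sref i (false, j))).1.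
  by rewrite ffunE /alpha invMg srefV // permM.
apply/ffunP => j; rewrite E srefE //=; case: ifP => [/eqP ->|h1].
  rewrite S; case: ifP; rewrite /moved ?upd_lo;
  by case: (alphaf w (lo i)); case: (alphaf w (hi i)); case: (zb i).
case: ifP => [/eqP ->|h2].
  rewrite S; case: ifP; rewrite /moved ?upd_hi;
  by case: (alphaf w (lo i)); case: (alphaf w (hi i)); case: (zb i).
by rewrite S; case: ifP => // _; rewrite [in RHS]ffunE h1 h2.
Qed.

Lemma alpha_left w i : i != 0 :> nat -> alphaf (sref i * w)%g = alphaf w.
Proof.
move=> i0; apply/ffunP => j; rewrite !ffunE /alpha invMg srefV // permM srefE // /zb (negbTE i0) !addbF.
by case: ifP => // _; case: ifP.
Qed.

Lemma alpha1 : alphaf (1%g : {perm Pt n}) = [ffun=> false].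
Proof. by apply/ffunP => j; rewrite !ffunE /alpha invg1 perm1. Qed.

Lemma par_alpha w : w \in Wgrp n -> par (alphaf w) = false.
Proof.
move=> hW; rewrite -(Wgrp_sgpar hn (w := (w^-1)%g)) ?groupV //.
by apply: eq_bigr => j _; rewrite ffunE.
Qed.

Lemma moved_up w i : w \in Wgrp n -> moved i (alphaf w) ->
  (lenW w < lenW (w * sref i)%g)%N = ~~ alphaf w (hi i).
Proof.
move=> hW hm; have [-> _] := lenW_right hn i hW.
have a2 : ((w^-1)%g (r2 i)).1 = alphaf w (hi i) by rewrite inv_sign.
have a1 : ((w^-1)%g (r1 i)).1 = ~~ alphaf w (hi i).
  rewrite inv_sign //.
  by move: hm; rewrite /moved; case: (alphaf w (lo i)); case: (alphaf w (hi i)); case: (zb i).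
move: a1 a2; case: ((w^-1)%g (r1 i)) => b j /= ->; case: ((w^-1)%g (r2 i)) => b' j' /= ->.
by rewrite /rk; have := ltn_ord j; have := ltn_ord j'; case: (alphaf w (hi i)) => /=; lia.
Qed.

Lemma stat_right w i : w \in Wgrp n ->
  (stat (alphaf (w * sref i)%g) <= (stat (alphaf w)).+1)%N.
Proof.
move=> hW; rewrite alpha_right //; case: ifP => h; last exact: leqnSn.
have E := upd_id h; have S := stat_upd i (alphaf w).
case: (alphaf w (hi i)) E => E; rewrite E in S; rewrite /= S //.
exact: leq_trans (leqnSn _) (leqnSn _).
Qed.

Lemma stat_alpha_le w : w \in Wgrp n -> (stat (alphaf w) <= lenW w)%N.
Proof.
move/(lenW_word hn) => [t -> <-]; elim/last_ind: t => [|t i IH].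
  by rewrite wprod_nil alpha1 /stat big1 // => j _; rewrite ffunE.
rewrite wprod_rcons size_rcons; apply: leq_trans (stat_right _ (wprod_in _)) _.
by rewrite ltnS.
Qed.

(** Without descents a minus at a position above 1 propagates one step to the left until it reaches
    position 1, where s_0 or s_1 would give a descent; position 0 is then excluded by parity. *)
Lemma even_no_descent al : par al = false -> (forall i, moved i al -> al (hi i) = false) ->
  al = [ffun=> false].
Proof.
move=> hp h; have n0 : (0 < n)%N by lia.
pose o0 := Ordinal n0; pose o1 := Ordinal hn.
have step j : (1 < j)%N -> al j -> al (lo j).
  move=> j1 aj; have [_ e2] := lo_val_pos (i := j) (lt0n_neq0 (ltnW j1)).
  have j0 : (j == 0 :> nat) = false by lia.
  by have := h j; rewrite /moved e2 aj /zb j0; case: (al (lo j)) => // /(_ isT).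
have a1 : al o1 = false.
  have e0 : hi o0 = o1 by apply: val_inj; rewrite /= hi_lo.
  have e1 : hi o1 = o1 by []. have e2 : lo o1 = o0 by apply: val_inj.
  have := h o0; have := h o1; rewrite /moved e0 e1 e2 (_ : lo o0 = o0) // /zb /=.
  by case: (al o0); case: (al o1) => //= h1 h2; [apply: h2|apply: h1].
have a2 m : forall j, nat_of_ord j = m.+1 -> al j = false.
  elim: m => [|m IH] j Ej; first by rewrite (_ : j = o1) //; apply: val_inj.
  apply/negP => aj; have [|e1 _] := lo_val_pos (i := j); first by rewrite Ej.
  have j1 : (1 < j)%N by rewrite Ej.
  by have := step j j1 aj; rewrite (IH (lo j)) // e1 Ej.
have a0 : al o0 = false.
  move: hp; rewrite /par (bigD1 o0) //= big1 ?addbF // => j ne.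
  by apply: (a2 j.-1); move: ne; rewrite -val_eqE /=; lia.
apply/ffunP => j; rewrite ffunE; case: (posnP j) => [E|j0]; last by apply: (a2 j.-1); lia.
by rewrite (_ : j = o0) //; apply: val_inj.
Qed.

(** Undoing a descent lowers [stat] by exactly 1, so [stat al] generators lead from the constant
    sequence to [al]. *)
Lemma exists_short al : par al = false ->
  exists w, [/\ w \in Wgrp n, alphaf w = al & (lenW w <= stat al)%N].
Proof.
have [m] := ubnP (stat al); elim: m al => // m IH al hm hp.
case: (boolP [exists i, moved i al && al (hi i)]) => [/existsP[i /andP[h1 h2]]|/existsPn h].
  have E := upd_id h1; rewrite h2 in E.
  have hs := stat_upd i al; rewrite E in hs.
  have [||w [w1 w2 w3]] := IH (upd i al false); first by lia.
    by rewrite par_upd.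
  exists (w * sref i)%g; split; first by rewrite groupM // sref_in.
    by rewrite alpha_right // w2 moved_upd upd_hi upd_upd.
  have [_ [h3 h4]] := lenW_right hn i w1.
  rewrite hs; case: (boolP (lenW w < lenW (w * sref i)%g)%N) => [/h3 ->|/h4 h5]; first by rewrite ltnS.
  by rewrite h5 in w3; apply: ltnW; apply: ltnW; rewrite ltnS.
exists 1%g; rewrite group1 lenW1 // alpha1 (even_no_descent hp) //.
by move=> i hi1; have := h i; rewrite hi1 /=; case: (al _).
Qed.

Lemma Wp_Wgrp w : w \in Wp n -> w \in Wgrp n.
Proof. by rewrite inE => /andP[]. Qed.

(** [stat] of the sign sequence is constant on a coset of W_p and bounds all lengths there from
    below, so an element attaining it is minimal. *)
Lemma Wp_of_short w : w \in Wgrp n -> (lenW w <= stat (alphaf w))%N -> w \in Wp n.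
Proof.
move=> hW h; rewrite inE hW; apply/forallP => i; apply/implyP => i0.
have hs := groupM (sref_in i) hW; have := stat_alpha_le hs; rewrite alpha_left // => h2.
have [_ [_ h3]] := lenW_left hn i hW.
by case: (boolP (_ < _)%N) => // /h3 E; rewrite E in h; have := leq_trans h h2; rewrite ltnn.
Qed.

Lemma Wp_increasing w : w \in Wp n ->
  forall j k, (j < k)%N -> (rk (w (false, j)) < rk (w (false, k)))%N.
Proof.
rewrite inE => /andP[hW /forallP h]; apply: (@increasing_adj n hn (fun j => rk (w (false, j)))) => i i0.
have := h i; rewrite i0 /=; have [-> _] := lenW_left hn i hW.
by rewrite /r1 /r2 /zb (negbTE i0).
Qed.

(** Both elements are increasing on positive points. With equal sign sequences, [w * v^-1] maps
    positive points to positive points and is increasing there, hence trivial. *)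
Lemma alpha_inj w v : w \in Wp n -> v \in Wp n -> alphaf w = alphaf v -> w = v.
Proof.
move=> hw hv E; have gw := Wgrp_ng hn (Wp_Wgrp hw); have gv := Wgrp_ng hn (Wp_Wgrp hv).
have gv' : ngc (v^-1)%g by apply: Wgrp_ng => //; rewrite groupV Wp_Wgrp.
have gw' : ngc (w^-1)%g by apply: Wgrp_ng => //; rewrite groupV Wp_Wgrp.
have S p : ((w^-1)%g p).1 = ((v^-1)%g p).1.
  have S0 j : ((w^-1)%g (false, j)).1 = ((v^-1)%g (false, j)).1.
    by have := congr1 (fun f : Sg n => f j) E; rewrite !ffunE.
  case: p => [[] j] //; have := gw' (false, j); have := gv' (false, j).
  by rewrite /ng /= => -> ->; rewrite S0.
have hx j : ((w * v^-1)%g (false, j)) = (false, ((w * v^-1)%g (false, j)).2).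
  by rewrite [LHS]surjective_pairing permM -S -permM mulgV perm1.
have vx j : v (false, ((w * v^-1)%g (false, j)).2) = w (false, j).
  by rewrite -hx permM permKV.
apply/eqP; rewrite eq_mulgV1; apply/eqP; apply: perm_ng_id.
  by move=> p; rewrite !permM gw gv'.
move=> j; rewrite hx; congr pair.
apply: (@mono_ord_id n hn (fun j => ((w * v^-1)%g (false, j)).2)) => {}j k jk.
rewrite ltnNge; apply/negP; rewrite leq_eqVlt => /orP[/eqP h|h].
  have := Wp_increasing hw jk; rewrite -vx -[w (false, k)]vx.
  by rewrite (val_inj h) ltnn.
have := Wp_increasing hv h; rewrite !vx => h2.
by have := ltn_trans h2 (Wp_increasing hw jk); rewrite ltnn.
Qed.

Lemma alpha_surj al : par al = false -> exists2 w, w \in Wp n & alphaf w = al.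
Proof.
move=> hp; have [w [w1 w2 w3]] := exists_short hp; exists w => //.
by apply: Wp_of_short; rewrite ?w2.
Qed.

Lemma lenW_Wp w : w \in Wp n -> lenW w = stat (alphaf w).
Proof.
move=> hw; have hW := Wp_Wgrp hw; have [v [v1 v2 v3]] := exists_short (par_alpha hW).
rewrite -v2 in v3; have hv := Wp_of_short v1 v3.
rewrite (alpha_inj hw hv (esym v2)); apply/eqP; rewrite eqn_leq v3.
exact: stat_alpha_le.
Qed.

End Cosets.

(** * The projection of the Hecke algebra onto N *)

Section Parabolic.
Variables (n : nat) (hn : (1 < n)%N).
Implicit Types (i j k : 'I_n) (w v : {perm Pt n}) (al be : Sg n) (h : hk n).

(* H_s acts by -q for s in S_p, so H_(xy) with x in W_p, y in W^p has image (-q)^l(x) N_y, and l(y) = stat (alphaf y). *)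
Definition cw w : L := (- qL) ^+ lenW w * (- qiL) ^+ stat (alphaf w).
Definition prj h al : L := \sum_(w in Wgrp n) h w * cw w * (alphaf w == al)%:R.

Lemma sclE (T : finType) a (f : {ffun T -> L}) x : scl a f x = a * f x.
Proof. by rewrite ffunE. Qed.

Lemma piD h h' al : prj (h + h') al = prj h al + prj h' al.
Proof.
by rewrite /prj -big_split /=; apply: eq_bigr => w _; rewrite ffunE -!mulrDl.
Qed.

Lemma pi_scl a h al : prj (scl a h) al = a * prj h al.
Proof.
by rewrite /prj big_distrr /=; apply: eq_bigr => w _; rewrite ffunE !mulrA.
Qed.

Lemma pi0 al : prj 0 al = 0.
Proof. by rewrite /prj big1 // => w _; rewrite ffunE !mul0r. Qed.

Lemma pi_sum (I : finType) (P : pred I) (F : I -> hk n) al :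
  prj (\sum_(i | P i) F i) al = \sum_(i | P i) prj (F i) al.
Proof. by apply: (big_morph (fun h => prj h al)) => [x y|]; rewrite ?piD ?pi0. Qed.

Lemma pi_Hw w al : w \in Wgrp n -> prj (Hw w) al = cw w * (alphaf w == al)%:R.
Proof.
move=> hW; rewrite /prj (bigD1 w) //= ffunE eqxx mul1r big1 ?addr0 // => v /andP[_ /negbTE h].
by rewrite ffunE h !mul0r.
Qed.

Lemma Cop_ext i (v v' : Sg n -> L) : v =1 v' -> Cop i v =1 Cop i v'.
Proof. by move=> h al; rewrite /Cop; congr (_ * _); apply: eq_bigr => t _; rewrite h. Qed.

Lemma Cop_sum (I : finType) (P : pred I) (a : I -> L) (v : I -> Sg n -> L) i al :
  Cop i (fun al => \sum_(x | P x) a x * v x al) al = \sum_(x | P x) a x * Cop i (v x) al.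
Proof.
rewrite /Cop; under eq_bigr => t _ do rewrite big_distrr /=.
rewrite exchange_big big_distrr /=; apply: eq_bigr => x _.
by rewrite [RHS]mulrCA; congr (_ * _); rewrite big_distrr; apply: eq_bigr => t _; rewrite mulrCA.
Qed.

Lemma Cop_scale a (v : Sg n -> L) i al : Cop i (fun al => a * v al) al = a * Cop i v al.
Proof.
rewrite /Cop [RHS]mulrCA; congr (_ * _); rewrite big_distrr.
by apply: eq_bigr => t _; rewrite mulrCA.
Qed.

Lemma Cop_delta i al be : Cop i (fun x => (al == x)%:R) be =
  (moved i al)%:R * qiL ^+ al (hi i) * ((upd i al true == be)%:R + qL * (upd i al false == be)%:R).
Proof.
have U t : (al == upd i be t) && moved i be = [&& moved i al, al (hi i) == t & upd i al (be (hi i)) == be].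
  apply/andP/and3P => [[/eqP -> h]|[h /eqP <- /eqP h2]].
    by rewrite moved_upd // upd_hi eqxx upd_upd upd_id.
  by rewrite -h2 upd_upd upd_id // moved_upd.
rewrite /Cop -/(moved i be) big_bool /=.
have -> : (moved i be)%:R * qL ^+ (~~ be (hi i)) *
  (qiL ^+ 1 * (al == upd i be true)%:R + qiL ^+ 0 * (al == upd i be false)%:R) =
  qL ^+ (~~ be (hi i)) * (qiL ^+ 1 * ((al == upd i be true) && moved i be)%:R +
     qiL ^+ 0 * ((al == upd i be false) && moved i be)%:R) :> L.
  by case: (moved i be); rewrite ?andbT ?andbF ?mul1r ?mulr0 ?addr0 ?mul0r ?mulr0.
rewrite !U; case hm: (moved i al); rewrite ?mul0r ?mulr0 ?addr0 ?mulr0 //= mul1r.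
have V t : (upd i al t == be) = (upd i al (be (hi i)) == be) && (be (hi i) == t).
  apply/eqP/andP => [<-|[/eqP h2 /eqP <-] //]; by rewrite upd_hi.
rewrite (V true) (V false) !eqb_id !eqbF_neg.
case: (upd i al (be (hi i)) == be); rewrite ?andbF ?andbT ?mulr0 ?addr0 ?mulr0 //.
by case: (al (hi i)); case: (be (hi i)) => /=;
  rewrite !(expr0, expr1, mulr0, mul0r, mulr1, mul1r, addr0, add0r) // mulrC.
Qed.

Lemma cw_up w v : lenW v = (lenW w).+1 -> alphaf v = alphaf w -> cw v = - qL * cw w.
Proof. by rewrite /cw => -> ->; rewrite exprS mulrA. Qed.

Lemma cw_down w v : lenW w = (lenW v).+1 -> alphaf v = alphaf w ->
  cw v + (qiL - qL) * cw w = - qL * cw w.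
Proof.
move=> h1 h2; have e : qiL * cw w = - cw v.
  by rewrite (cw_up h1 (esym h2)) mulrA mulrN qiq mulN1r.
by rewrite mulrBl e; ring.
Qed.

(** If s_i fixes the sign sequence, only the length in [cw] changes and H_s acts by -q. If it moves
    the sequence, length and [stat] change together, [cw] is unchanged, and the rule for minimal
    representatives remains. *)
Lemma pi_HwHs w i al : w \in Wgrp n ->
  prj (HwHs w i) al = Cop i (prj (Hw w)) al - qL * prj (Hw w) al.
Proof.
move=> hW; have hws : (w * sref i)%g \in Wgrp n by rewrite groupM // sref_in.
have E := pi_Hw al hW.
rewrite (Cop_ext i (fun x => pi_Hw x hW)) Cop_scale Cop_delta E.
have [_ [hup hdown]] := lenW_right hn i hW.
have := alpha_right hn i hW; case: ifP => hm ha; last first.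
  rewrite mul0r mul0r mulr0 sub0r /HwHs; case: (boolP (_ < _)%N) => [/hup h|/hdown h].
    by rewrite pi_Hw // ha (cw_up h ha) mulrA !mulNr.
  by rewrite piD pi_scl !pi_Hw // ha mulrA -mulrDl (cw_down h ha) mulrA !mulNr.
have := upd_id hm; have hs := stat_upd hn i (alphaf w).
rewrite /HwHs; have := moved_up hn hW hm; case: (boolP (_ < _)%N) => [/hup h|/hdown h];
  case: (alphaf w (hi i)) ha => //= ha _ hid; rewrite mul1r ?expr1 ?expr0 ?mul1r.
  have -> : prj (Hw (w * sref i)%g) al = cw w * (upd i (alphaf w) true == al)%:R.
    rewrite pi_Hw // ha; congr (_ * _); rewrite /cw h ha hs hid !exprS.
    have -> x y : - qL * x * (- qiL * y) = (qL * qiL) * (x * y) :> L by ring.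
    by rewrite qqi mul1r.
  by rewrite hid; ring.
have cwE : cw w = cw (w * sref i)%g.
  rewrite /cw h ha -[in LHS]hid hs !exprS.
  have -> x y : - qL * x * (- qiL * y) = (qL * qiL) * (x * y) :> L by ring.
  by rewrite qqi mul1r.
rewrite piD pi_scl !pi_Hw // ha hid cwE.
set c := cw _; set a := (alphaf w == al)%:R; set b := (_ == al)%:R.
have -> : c * (qiL * (a + qL * b)) = c * (qiL * a) + c * ((qiL * qL) * b) by ring.
by rewrite qiq; ring.
Qed.

Lemma inH_sum h : inH h -> h = \sum_(w in Wgrp n) scl (h w) (Hw w).
Proof.
move=> hH; apply/ffunP => x; rewrite sum_ffunE; case: (boolP (x \in Wgrp n)) => hx.
  rewrite (bigD1 x) //= big1 ?addr0 ?sclE ?ffunE ?eqxx ?mulr1 // => w /andP[_ /negbTE h1].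
  by rewrite sclE ffunE eq_sym h1 mulr0.
rewrite hH // big1 // => w hw; rewrite sclE ffunE.
by case: eqP => [E|]; rewrite ?mulr0 //; rewrite -E (negbTE hx) in hw.
Qed.

Lemma pi_rmulHs h i al : inH h -> prj (rmulHs h i) al = Cop i (prj h) al - qL * prj h al.
Proof.
move=> hH.
have E x : prj h x = \sum_(w in Wgrp n) h w * prj (Hw w) x.
  by rewrite {1}(inH_sum hH) pi_sum; apply: eq_bigr => w _; rewrite pi_scl.
rewrite (Cop_ext i E) Cop_sum E big_distrr -sumrB /rmulHs pi_sum (bigID (mem (Wgrp n))) /=.
rewrite [X in _ + X]big1 ?addr0 => [|w hw]; last by rewrite pi_scl hH // mul0r.
apply: eq_bigr => w hw; rewrite pi_scl pi_HwHs // mulrBr; congr (_ - _).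
by rewrite mulrCA.
Qed.

Lemma pi_rmulCs h i al : inH h -> prj (rmulCs h i) al = Cop i (prj h) al.
Proof. by move=> hH; rewrite piD pi_scl pi_rmulHs // subrK. Qed.

Lemma pi_lmulCs h i al : i != 0 :> nat -> inH h -> prj (lmulCs i h) al = 0.
Proof.
move=> i0 hH.
have E : prj h al = \sum_w h w * prj (Hw w) al.
  rewrite {1}(inH_sum hH) pi_sum [RHS](bigID (mem (Wgrp n))) /= [X in _ + X]big1 ?addr0.
    by apply: eq_bigr => w _; rewrite pi_scl.
  by move=> w hw; rewrite hH // mul0r.
rewrite piD pi_scl E pi_sum big_distrr -big_split /= big1 // => w _.
rewrite pi_scl mulrCA -mulrDr; case: (boolP (w \in Wgrp n)) => hW; last by rewrite hH // mul0r.
have hsw : (sref i * w)%g \in Wgrp n by rewrite groupM // sref_in.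
have [_ [hup hdown]] := lenW_left hn i hW; have ha := alpha_left hn w i0.
suff -> : prj (HsHw i w) al = - qL * prj (Hw w) al by rewrite mulNr addNr mulr0.
rewrite /HsHw; case: (boolP (_ < _)%N) => [/hup h1|/hdown h1].
  by rewrite !pi_Hw // (cw_up h1 ha) ha -mulrA.
by rewrite piD pi_scl !pi_Hw // ha mulrA -mulrDl (cw_down h1 ha) -mulrA.
Qed.

Lemma pi_inKer h al : inKer h -> prj h al = 0.
Proof.
case=> hs [hH ->]; rewrite pi_sum big1 // => i i0; exact: pi_lmulCs.
Qed.

Lemma lmulCsD i h h' : lmulCs i (h + h') = lmulCs i h + lmulCs i h'.
Proof.
apply/ffunP => x; rewrite /lmulCs /lmulHs !ffunE !sum_ffunE mulrDr [RHS]addrACA.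
congr (_ + _); rewrite -big_split; apply: eq_bigr => w _ /=.
by rewrite !sclE ffunE mulrDl.
Qed.

Lemma lmulCs_scl i a h : lmulCs i (scl a h) = scl a (lmulCs i h).
Proof.
apply/ffunP => x; rewrite /lmulCs /lmulHs !ffunE !sum_ffunE mulrDr big_distrr /=; congr (_ + _).
  by apply: eq_bigr => w _; rewrite !sclE mulrA.
by rewrite mulrCA.
Qed.

Lemma lmulCs0 i : lmulCs i 0 = 0 :> hk n.
Proof.
have E : scl 0 0 = 0 :> hk n by apply/ffunP => x; rewrite !ffunE mul0r.
by rewrite -{1}E lmulCs_scl; apply/ffunP => x; rewrite !ffunE mul0r.
Qed.

Lemma inKerD h h' : inKer h -> inKer h' -> inKer (h + h').
Proof.
case=> hs [hH ->] [hs' [hH' ->]]; exists (fun i => hs i + hs' i); split.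
  by move=> i x hx; rewrite ffunE hH // hH' // addr0.
by rewrite -big_split; apply: eq_bigr => i _; rewrite lmulCsD.
Qed.

Lemma inKer_scl a h : inKer h -> inKer (scl a h).
Proof.
case=> hs [hH ->]; exists (fun i => scl a (hs i)); split.
  by move=> i x hx; rewrite sclE hH // mulr0.
by apply/ffunP => x; rewrite sclE !sum_ffunE big_distrr; apply: eq_bigr => i _; rewrite lmulCs_scl sclE.
Qed.

Lemma inKer0 : inKer (0 : hk n).
Proof.
exists (fun=> 0); split; first by move=> i x _; rewrite ffunE.
by rewrite big1 // => i _; rewrite lmulCs0.
Qed.

Lemma inKer_sum (I : finType) (P : pred I) (F : I -> hk n) :
  (forall x, P x -> inKer (F x)) -> inKer (\sum_(x | P x) F x).
Proof. by move=> hF; elim/big_rec: _ => [|x h Px]; [exact: inKer0|apply/inKerD/hF]. Qed.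

Lemma inKer_lmulCs i h : i != 0 :> nat -> inH h -> inKer (lmulCs i h).
Proof.
move=> i0 hH; exists (fun k => if k == i then h else 0); split.
  by move=> k x hx; case: ifP => _; [rewrite hH|rewrite ffunE].
rewrite (bigD1 i) //= eqxx big1 ?addr0 // => k /andP[_ /negbTE ->].
exact: lmulCs0.
Qed.

Lemma inH_Hw w : w \in Wgrp n -> inH (Hw w).
Proof. by move=> hw x hx; rewrite ffunE; case: eqP => // E; rewrite E hw in hx. Qed.

Lemma lmulHs_Hw i w : lmulHs i (Hw w) = HsHw i w.
Proof.
apply/ffunP => x; rewrite sum_ffunE (bigD1 w) //= sclE ffunE eqxx mul1r big1 ?addr0 // => v /negbTE h.
by rewrite sclE ffunE h mul0r.
Qed.

(** A left descent s in S_p writes H_w as C_s H_(sw) minus q H_(sw), and the first term lies in the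
    kernel. Together with [pi_inKer] this makes [inKer] exactly the kernel of [prj] on H. *)
Lemma Hw_reduce w v : w \in Wgrp n -> v \in Wp n -> alphaf v = alphaf w ->
  inKer (Hw w - scl (cw w) (Hw v)).
Proof.
have [m] := ubnP (lenW w); elim: m w => // m IH w hm hW hv ha.
case: (boolP (w \in Wp n)) => hw.
  rewrite (alpha_inj hn hv hw ha) /cw lenW_Wp // -exprMn mulrNN qqi expr1n.
  have -> : Hw w - scl 1 (Hw w) = 0 by apply/ffunP => x; rewrite !ffunE mul1r subrr.
  exact: inKer0.
have [i i0 hd] : exists2 i : 'I_n, i != 0 :> nat & ~~ (lenW w < lenW (sref i * w)%g)%N.
  move: hw; rewrite inE hW /= negb_forall => /existsP[i]; rewrite negb_imply => /andP[h1 h2].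
  by exists i.
have hsw : (sref i * w)%g \in Wgrp n by rewrite groupM // sref_in.
have [_ [_ /(_ hd) hl]] := lenW_left hn i hW; have hal := alpha_left hn w i0.
have := IH (sref i * w)%g; rewrite -hl -ltnS => /(_ hm hsw hv); rewrite hal => /(_ ha) hK.
have E : HsHw i (sref i * w)%g = Hw w.
  by rewrite /HsHw mulgA sref_sq // mul1g hl ltnSn.
have -> : Hw w - scl (cw w) (Hw v) =
    lmulCs i (Hw (sref i * w)%g) + scl (- qL) (Hw (sref i * w)%g - scl (cw (sref i * w)%g) (Hw v)).
  rewrite /lmulCs lmulHs_Hw E (cw_up hl (esym hal)); apply/ffunP => x; rewrite !ffunE.
  by move: (_ %:R) (_ %:R) (_ %:R) => a b c; ring.
apply: inKerD; last exact: inKer_scl.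
by apply: inKer_lmulCs => //; apply: inH_Hw.
Qed.

Lemma ker_pi h : inH h -> (forall al, prj h al = 0) -> inKer h.
Proof.
move=> hH h0.
pose f w := odflt w [pick v in Wp n | alphaf v == alphaf w].
have hf w : w \in Wgrp n -> f w \in Wp n /\ alphaf (f w) = alphaf w.
  move=> hW; rewrite /f; case: pickP => [v /andP[h1 /eqP h2] //|h1].
  have [v hv e] := alpha_surj hn (par_alpha hn hW).
  by have := h1 v; rewrite /= hv e eqxx.
(* Subtracting the normal form of every term changes nothing, because the coefficients of the normal
   forms are the values of [prj h], which vanish. *)
have -> : h = \sum_(w in Wgrp n) scl (h w) (Hw w - scl (cw w) (Hw (f w))).
  rewrite {1}(inH_sum hH); apply/ffunP => x; rewrite !sum_ffunE.
  have T w : scl (h w) (Hw w - scl (cw w) (Hw (f w))) x =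
      h w * Hw w x - h w * (cw w * Hw (f w) x) by rewrite !ffunE mulrBr.
  under [RHS]eq_bigr => w _ do rewrite T.
  rewrite sumrB; under eq_bigr => w _ do rewrite sclE.
  rewrite -[LHS]subr0; congr (_ - _); apply/esym.
  transitivity (\sum_(w in Wgrp n) h w * cw w * (f w == x)%:R).
    by apply: eq_bigr => w _; rewrite ffunE mulrA [x == _]eq_sym.
  case: (boolP (x \in Wp n)) => hx.
    rewrite -[RHS](h0 (alphaf x)); apply: eq_bigr => w hw; congr (_ * _%:R).
    have [h1 h2] := hf w hw; rewrite -h2; congr nat_of_bool.
    by apply/eqP/eqP => [-> //|]; apply: alpha_inj.
  rewrite big1 // => w hw; case: eqP => [E|]; rewrite ?mulr0 //.
  by rewrite -E (hf w hw).1 in hx.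
apply: inKer_sum => w hw; apply: inKer_scl; have [h1 h2] := hf w hw.
exact: Hw_reduce.
Qed.

End Parabolic.

(** * The Kazhdan-Lusztig basis *)

Section CanonicalBasis.
Variables (n : nat) (hn : (1 < n)%N).
Implicit Types (i j : 'I_n) (w v : {perm Pt n}) (al be : Sg n) (h : hk n).

Definition Kw w : Sg n -> L := Kc (cupD w).

Lemma Kw_alpha w : Kw w (alphaf w) = 1.
Proof. by rewrite /Kw -stdlab_cupD Kc_stdlab //; apply: cupD_cup. Qed.

Lemma Kw_triangular w al : Kw w al != 0 -> al != alphaf w ->
  (stat al < stat (alphaf w))%N.
Proof.
move=> h /eqP ne; case: (Kc_triangular (cupD_cup w) h); rewrite stdlab_cupD => //.
by case.
Qed.

Lemma Kw_poly w al : exists p, Kw w al = polyL p.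
Proof.
rewrite /Kw /Kc KdE; case: (compat _ _); last by exists 0; rewrite mul0r polyL0.
by exists 'X^(flips (cupD w) (glue al (ones n))); rewrite mul1r polyLXn.
Qed.

Lemma Kw_qZq w al : al != alphaf w -> in_qZq (Kw w al).
Proof.
move=> /eqP ne; have [->|h] := eqVneq (Kw w al) 0; first exact: in_qZq0.
case: (Kc_triangular (cupD_cup w) h) => [|[_]]; rewrite ?stdlab_cupD //.
rewrite /Kw /Kc KdE; case: (compat _ _); last by rewrite mul0r => _; exact: in_qZq0.
case: (flips _ _) => // m _; apply/in_qZqE; exists 'X^m.
by rewrite mul1r polyLXn exprS.
Qed.

Lemma Kw_par w al : w \in Wgrp n -> par al -> Kw w al = 0.
Proof.
move=> hW hp; apply/eqP/negPn/negP => h; have := Kc_par (cupD_cup w) h.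
by rewrite stdlab_cupD par_alpha // hp.
Qed.

(** The only possible obstruction is an odd standard label. There [Cop i (Kw w)] vanishes by parity,
    while its value is the scalar produced by e_i, so the scalar is 0. *)
Lemma actE_closed i w : w \in Wp n -> (actE i (cupD w)).1 = 0 \/
  exists2 v, v \in Wp n & cupD v = (actE i (cupD w)).2.
Proof.
move=> hw; have hc := actE_cup i hn (cupD_cup w); have hW := Wp_Wgrp hw.
have [->|h] := eqVneq (actE i (cupD w)).1 0; [by left|right].
have E := Cop_Kc i (stdlab (actE i (cupD w)).2) hn (cupD_cup w).
rewrite Kc_stdlab // mulr1 in E.
have [|v hv ev] := alpha_surj hn (al := stdlab (actE i (cupD w)).2).
  apply/negP => hp; move: h; rewrite -E (@Cop_par n i (Kw w) false) ?eqxx ?hp //.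
  by move=> al; rewrite eqbF_neg negbK; apply: Kw_par.
by exists v => //; apply: stdlab_inj hc _; [exact: cupD_cup|rewrite stdlab_cupD].
Qed.

Lemma barL_scalar i c : barL (actE i c).1 = (actE i c).1.
Proof.
rewrite /= barLM /loopScal /bbScal; congr (_ * _); last first.
  by case: ifP => _; rewrite ?barL0 ?barL1.
rewrite (big_morph barL barLM barL1); apply: eq_bigr => j _.
by case: ifP => _; rewrite ?barL0 // barLD barL_q barL_qi addrC.
Qed.

(** By triangularity the values of largest [stat] can be removed by subtracting multiples of the
    [Kw w], without creating new values at that level or above. *)
Lemma Kw_span (v : Sg n -> L) : (forall al, par al -> v al = 0) ->
  exists a, forall al, v al = \sum_(w in Wp n) a w * Kw w al.
Proof.
move=> hv; have [m hm] : exists m, forall al, (m <= stat al)%N -> v al = 0.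
  exists (\max_(al : Sg n) stat al).+1 => al.
  by rewrite ltnNge (leq_bigmax_cond (F := fun al => stat al)).
elim: m v hv hm => [|m IH] v hv hm.
  by exists (fun=> 0) => al; rewrite hm // big1 // => w _; rewrite mul0r.
pose b w : L := if stat (alphaf w) == m then v (alphaf w) else 0.
have [|al hal|a ha] := IH (fun al => v al - \sum_(w in Wp n) b w * Kw w al).
- move=> al hp; rewrite hv // big1 ?subrr // => w hw.
  by rewrite Kw_par ?mulr0 // Wp_Wgrp.
- have Z w : w \in Wp n -> alphaf w != al -> b w * Kw w al = 0.
    move=> hw ne; rewrite /b; case: eqP => [E|]; last by rewrite mul0r.
    have [->|h] := eqVneq (Kw w al) 0; first by rewrite mulr0.
    by have := Kw_triangular h; rewrite eq_sym ne E ltnNge hal => /(_ isT).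
  case: (boolP (par al)) => hp.
    rewrite hv // big1 ?subrr // => w hw.
    by rewrite Kw_par ?mulr0 // Wp_Wgrp.
  have [w hw ew] := alpha_surj hn (negbTE hp).
  rewrite (bigD1 w) //= big1 ?addr0 => [|x /andP[hx nx]]; last first.
    by apply: Z => //; apply: contra nx => /eqP; rewrite -ew => /(alpha_inj hn hx hw) ->.
  rewrite -ew Kw_alpha mulr1 /b; case: eqP => [_|/eqP ne]; first by rewrite subrr.
  by rewrite subr0 hm // ltn_neqAle ew hal andbT eq_sym -ew.
- exists (fun w => a w + b w) => al.
  under eq_bigr => w _ do rewrite mulrDl.
  by rewrite big_split /= -ha subrK.
Qed.

(* Unitriangularity over Z[q] transfers any Z[q]-submodule property from values to coefficients. *)
Lemma Kw_coef (P : L -> Prop) (a : {perm Pt n} -> L) :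
  P 0 -> (forall x y, P x -> P y -> P (x - y)) -> (forall x p, P x -> P (x * polyL p)) ->
  (forall al, P (\sum_(w in Wp n) a w * Kw w al)) -> forall w, w \in Wp n -> P (a w).
Proof.
move=> P0 PB PM H; pose B := (\max_(al : Sg n) stat al)%N.
have hB al : (stat al <= B)%N by rewrite /B (leq_bigmax_cond (F := fun al => stat al)).
(* Downward induction on [stat]: at [alphaf w], apart from [w] itself, only kernels of strictly
   larger [stat] contribute. *)
move=> w; have [m] := ubnP (B - stat (alphaf w))%N; elim: m w => // m IH w hm hw.
have := H (alphaf w); rewrite (bigD1 w) //= Kw_alpha mulr1 => h.
rewrite -[a w](addrK (\sum_(x in Wp n | x != w) a x * Kw x (alphaf w))); apply: (PB _ _ h).
have PD x y : P x -> P y -> P (x + y).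
  by move=> hx hy; rewrite -[y]opprK -[- y]sub0r; apply/(PB _ _ hx)/(PB _ _ P0).
elim/big_rec: _ => // x y /andP[hx nx]; apply: PD.
have [->|h2] := eqVneq (Kw x (alphaf w)) 0; first by rewrite mulr0.
have [p ->] := Kw_poly x (alphaf w); apply: PM; apply: IH => //.
have ne : alphaf w != alphaf x.
  by apply: contra nx => /eqP E; rewrite (alpha_inj hn hw hx E).
by have := Kw_triangular h2 ne; have := hB (alphaf x); lia.
Qed.

Lemma Kw_free (a : {perm Pt n} -> L) :
  (forall al, \sum_(w in Wp n) a w * Kw w al = 0) -> forall w, w \in Wp n -> a w = 0.
Proof.
apply: (@Kw_coef (fun x => x = 0)) => // [x y -> ->|x p ->]; by rewrite ?subrr ?mul0r.
Qed.

(** The graph of the semilinear map that fixes every [Kw w]. [barred_pi] identifies it with the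
    involution induced by [barH]. *)
Definition barred (m m' : Sg n -> L) := exists a, (forall al, m al = \sum_(w in Wp n) a w * Kw w al) /\
  (forall al, m' al = \sum_(w in Wp n) barL (a w) * Kw w al).

Lemma barred_ext m m' k k' : m =1 k -> m' =1 k' -> barred m m' -> barred k k'.
Proof. by move=> e e' [a [h1 h2]]; exists a; split=> al; rewrite -?e -?e' ?h1 ?h2. Qed.

Lemma barredD m m' k k' : barred m m' -> barred k k' ->
  barred (fun al => m al + k al) (fun al => m' al + k' al).
Proof.
move=> [a [h1 h2]] [b [h3 h4]]; exists (fun w => a w + b w); split=> al.
  by rewrite h1 h3 -big_split; apply: eq_bigr => w _; rewrite mulrDl.
by rewrite h2 h4 -big_split; apply: eq_bigr => w _; rewrite barLD mulrDl.
Qed.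

Lemma barred_scale c m m' : barred m m' -> barred (fun al => c * m al) (fun al => barL c * m' al).
Proof.
move=> [a [h1 h2]]; exists (fun w => c * a w); split=> al.
  by rewrite h1 big_distrr; apply: eq_bigr => w _; rewrite /= mulrA.
by rewrite h2 big_distrr; apply: eq_bigr => w _; rewrite /= barLM mulrA.
Qed.

Lemma barred0 : barred (fun=> 0) (fun=> 0).
Proof.
by exists (fun=> 0); split=> al; rewrite big1 // => w _; rewrite ?barL0 mul0r.
Qed.

Lemma barred_sum (I : finType) (P : pred I) (c : I -> L) (m m' : I -> Sg n -> L) :
  (forall y, P y -> barred (m y) (m' y)) ->
  barred (fun al => \sum_(y | P y) c y * m y al) (fun al => \sum_(y | P y) barL (c y) * m' y al).
Proof.
move=> H; suff S (r : seq I) : barred (fun al => \sum_(y <- r | P y) c y * m y al)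
    (fun al => \sum_(y <- r | P y) barL (c y) * m' y al) by apply: S.
elim: r => [|y r IH].
  by apply: barred_ext barred0 => al; rewrite big_nil.
case hy: (P y); last by apply: barred_ext IH => al; rewrite big_cons hy.
have := barredD (barred_scale (c y) (H y hy)) IH.
by apply: barred_ext => al; rewrite big_cons hy.
Qed.

Lemma barred_Kw w : w \in Wp n -> barred (Kw w) (Kw w).
Proof.
move=> hw; exists (fun x => (x == w)%:R); split=> al; rewrite (bigD1 w) //= eqxx ?barL1 mul1r big1 ?addr0 //;
  by move=> x /andP[_ /negbTE ->]; rewrite ?barL0 mul0r.
Qed.

Lemma barred_Cop_Kw i w : w \in Wp n -> barred (Cop i (Kw w)) (Cop i (Kw w)).
Proof.
move=> hw; have E al := Cop_Kc i al hn (cupD_cup w).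
case: (actE_closed i hw) => [h0|[v hv ev]].
  by apply: barred_ext barred0 => al; rewrite E h0 mul0r.
have := barred_scale (actE i (cupD w)).1 (barred_Kw hv); rewrite barL_scalar.
by apply: barred_ext => al; rewrite E -ev.
Qed.

Lemma barred_Cop i m m' : barred m m' -> barred (Cop i m) (Cop i m').
Proof.
move=> [a [h1 h2]].
have := barred_sum a (fun w hw => @barred_Cop_Kw i w hw).
by apply: barred_ext => al; rewrite -Cop_sum; apply: Cop_ext => be; rewrite ?h1 ?h2.
Qed.

(** * Bar invariance along reduced words *)

Lemma inH_add h h' : inH h -> inH h' -> inH (h + h').
Proof. by move=> h1 h2 x hx; rewrite ffunE h1 // h2 // addr0. Qed.
Lemma inH_scl a h : inH h -> inH (scl a h).
Proof. by move=> h1 x hx; rewrite sclE h1 // mulr0. Qed.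
Lemma inH_opp h : inH h -> inH (- h).
Proof. by move=> h1 x hx; rewrite ffunE h1 // oppr0. Qed.
Lemma inH_sumP (I : finType) (P : pred I) (F : I -> hk n) :
  (forall y, P y -> inH (F y)) -> inH (\sum_(y | P y) F y).
Proof.
by move=> hF; elim/big_rec: _ => [x _|y g Py]; [rewrite ffunE|apply: inH_add (hF y Py)].
Qed.

Lemma inH_rmulHs h i : inH h -> inH (rmulHs h i).
Proof.
move=> hH; apply: inH_sumP => w _; case: (boolP (w \in Wgrp n)) => hW; last first.
  by move=> x hx; rewrite sclE hH // mul0r.
have hs : (w * sref i)%g \in Wgrp n by rewrite groupM // sref_in.
apply: inH_scl; rewrite /HwHs; case: ifP => _; first exact: inH_Hw.
by apply: inH_add; [exact: inH_Hw|apply/inH_scl/inH_Hw].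
Qed.

Lemma inH_rmulCs h i : inH h -> inH (rmulCs h i).
Proof. by move=> hH; apply: inH_add; [exact: inH_rmulHs|exact: inH_scl]. Qed.

Lemma Kw1 al : Kw 1%g al = (alphaf (1%g : {perm Pt n}) == al)%:R.
Proof.
have [<-|ne] := eqVneq (alphaf 1%g) al; first exact: Kw_alpha.
apply/eqP/negPn/negP => h; have := Kw_triangular h; rewrite eq_sym ne => /(_ isT).
by rewrite alpha1 /stat [X in (_ < X)%N]big1 // => j _; rewrite ffunE.
Qed.

Lemma one_Wp : 1%g \in Wp n.
Proof. by apply: Wp_of_short; rewrite ?group1 // lenW1. Qed.

Lemma barred_word t : lenW (@wprod n t) = size t ->
  inH (foldl (fun h i => rmulHsinv h i) (Hw 1%g) t) /\
  barred (prj (Hw (wprod t))) (prj (foldl (fun h i => rmulHsinv h i) (Hw 1%g) t)).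
Proof.
elim/last_ind: t => [|t i IH].
  move=> _; rewrite wprod_nil /=; split; first by apply/inH_Hw/group1.
  have := barred_Kw one_Wp; apply: barred_ext => al; rewrite Kw1 pi_Hw ?group1 //;
  by rewrite /cw lenW1 // alpha1 /stat big1 ?mul1r // => j _; rewrite ffunE.
rewrite wprod_rcons size_rcons -cats1 foldl_cat /= => hl.
have ht := wprod_in t; have le := lenW_le hn t.
have [_ [h1 h2]] := lenW_right hn i ht.
have lt : (lenW (wprod t) < lenW (wprod t * sref i)%g)%N by rewrite hl ltnS.
have [hI hB] := IH (succn_inj (etrans (esym (h1 lt)) hl)).
set g := foldl _ _ t in hI hB *; split.
  by apply: inH_add; [exact: inH_rmulHs|exact: inH_scl].
have E : Hw (wprod t * sref i)%g = HwHs (wprod t) i by rewrite /HwHs lt.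
(* H_s = C_s - q has the bar image H_s^-1 = C_s - q^-1, and [Cop i], the action of C_s, commutes
   with [barred]. *)
have := barredD (barred_Cop i hB) (barred_scale (- qL) hB).
apply: barred_ext => al; first by rewrite E pi_HwHs // mulNr.
by rewrite /rmulHsinv piD pi_scl pi_rmulHs // barLN barL_q; ring.
Qed.

Lemma redword_spec w : w \in Wgrp n -> w = wprod (redword w) /\ size (redword w) = lenW w.
Proof.
move=> hW; rewrite /redword; case: pickP => [t /eqP h|h]; first by rewrite size_tuple.
have [t et st] := lenW_word hn hW.
have st' : size t == lenW w by rewrite st.
by have := h (Tuple st'); rewrite /= {1}et eqxx.
Qed.

Lemma barred_pi h : inH h -> barred (prj h) (prj (barH h)).
Proof.
move=> hH.
have H w : w \in Wgrp n -> barred (prj (Hw w)) (prj (barHw w)).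
  move=> hW; have [e1 e2] := redword_spec hW; rewrite {1}e1.
  by apply: (proj2 (barred_word _)); rewrite -e1 e2.
have := barred_sum h H; apply: barred_ext => al.
  by rewrite {2}(inH_sum hH) pi_sum; apply: eq_bigr => w _; rewrite pi_scl.
by rewrite /barH pi_sum; apply: eq_bigr => w _; rewrite pi_scl.
Qed.

Lemma pi_par h al : par al -> prj h al = 0.
Proof.
move=> hp; rewrite /prj big1 // => w hW; case: eqP => [E|]; rewrite ?mulr0 //.
by rewrite -E par_alpha in hp.
Qed.

Lemma pi_N h al : prj (- h) al = - prj h al.
Proof. by apply: (@addrI _ (prj h al)); rewrite -piD !subrr pi0. Qed.

(** The uniqueness argument: the difference of both sides takes values in q Z[q], so by [Kw_coef]
    its coordinates lie there too; by [Kw_free] they are also bar-invariant, and only 0 is both. *)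
Theorem pi_KL u w : w \in Wp n -> isKL u w -> prj u =1 Kw w.
Proof.
move=> hw [hH hbar [c [hc hker]]].
have hbarE : prj (barH u) =1 prj u.
  by move=> al; apply/eqP; rewrite -subr_eq0 -pi_N -piD pi_inKer.
have [a [h1 h2]] := barred_pi hH.
have fixed x : x \in Wp n -> barL (a x) = a x.
  move=> hx; apply/eqP; rewrite -subr_eq0; apply/eqP.
  apply: (@Kw_free (fun x => barL (a x) - a x)) => // al.
  under eq_bigr => y _ do rewrite mulrBl.
  by rewrite sumrB -h1 -h2 hbarE subrr.
have pu al : prj u al = (alphaf w == al)%:R +
    \sum_(x in Wp n | x != w) c x * (alphaf x == al)%:R.
  have := pi_inKer hn al hker; rewrite piD pi_N => /subr0_eq ->; rewrite piD pi_sum.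
  have P x : x \in Wp n -> prj (Hw x) al = (alphaf x == al)%:R.
    move=> hx; rewrite pi_Hw ?Wp_Wgrp // /cw lenW_Wp // -exprMn mulrNN qqi expr1n.
    by rewrite mul1r.
  by rewrite P //; congr (_ + _); apply: eq_bigr => x /andP[hx _]; rewrite pi_scl P.
pose b x := a x - (x == w)%:R.
have bE al : \sum_(x in Wp n) b x * Kw x al = prj u al - Kw w al.
  under eq_bigr => x _ do rewrite mulrBl.
  rewrite sumrB -h1; congr (_ - _); rewrite (bigD1 w) //= eqxx mul1r big1 ?addr0 //.
  by move=> x /andP[_ /negbTE ->]; rewrite mul0r.
have b0 x : x \in Wp n -> b x = 0.
  move=> hx; apply: in_qZq_bar_fixed; last first.
    by rewrite /b barLD barLN fixed //; case: (x == w); rewrite ?barL1 ?barL0.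
  move: x hx; apply: Kw_coef in_qZq0 in_qZqB in_qZqM _ => al; rewrite bE pu addrAC.
  have Q0 : in_qZq (\sum_(x in Wp n | x != w) c x * (alphaf x == al)%:R).
    apply: in_qZq_sum => x _; case: eqP => _; rewrite ?mulr1 ?mulr0 //; exact: in_qZq0.
  rewrite -[\sum_(x in Wp n | _) _]opprK -[X in _ - X]sub0r; apply: in_qZqB; last exact: in_qZqB in_qZq0 Q0.
  have [<-|ne] := eqVneq (alphaf w) al; first by rewrite Kw_alpha subrr; exact: in_qZq0.
  by apply: in_qZqB in_qZq0 _; apply: Kw_qZq; rewrite eq_sym.
move=> al; apply/eqP; rewrite -subr_eq0 -bE big1 // => x hx.
by rewrite b0 // mul0r.
Qed.

(** * The isomorphism Phi *)

Section Phi.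
Variables (u : {perm Pt n} -> hk n) (Phi : hk n -> Nt n).
Hypothesis uKL : forall w, w \in Wp n -> isKL (u w) w.
Hypothesis PhiL : forall (a : L) (h h' : hk n), Phi (scl a h + h') = scl a (Phi h) + Phi h'.
Hypothesis PhiK : forall x : hk n, inKer x -> Phi x = 0.
Hypothesis PhiU : forall w, w \in Wp n -> Phi (u w) = delta (cupD w).

Lemma Phi_sum (I : finType) (P : pred I) (a : I -> L) (F : I -> hk n) :
  Phi (\sum_(y | P y) scl (a y) (F y)) = \sum_(y | P y) scl (a y) (Phi (F y)).
Proof.
apply: (big_ind2 (fun x y => Phi x = y)) => [|x x' y y' <- <-|y _].
- exact: PhiK (inKer0 n).
- have E (T : finType) (f : {ffun T -> L}) : scl 1 f = f by apply/ffunP => z; rewrite sclE mul1r.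
  by have := PhiL 1 x y; rewrite !E.
- have := PhiL (a y) (F y) 0; rewrite (PhiK (inKer0 n)) !addr0 //.
Qed.

(** [Phi] vanishes on the kernel of [prj], so [Phi h] can be read off from any expansion of [prj h]
    in the [Kw]. The family [f] may repeat elements, as e_i can send different cup diagrams to the
    same one. *)
Lemma Phi_eq (I : finType) (P : pred I) (a : I -> L) (f : I -> {perm Pt n}) h : inH h ->
  (forall y, P y -> f y \in Wp n) ->
  (forall al, prj h al = \sum_(y | P y) a y * Kw (f y) al) ->
  Phi h = \sum_(y | P y) scl (a y) (delta (cupD (f y))).
Proof.
move=> hH hf hp; set g := \sum_(y | P y) scl (a y) (u (f y)).
have hu y : P y -> inH (u (f y)) by move=> /hf /uKL [].
have K : inKer (h - g).
  apply: (ker_pi hn) => [|al]; first by apply: inH_add => //; apply/inH_opp/inH_sumP => y /hu; apply: inH_scl.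
  rewrite piD pi_N hp pi_sum; apply/eqP; rewrite subr_eq0; apply/eqP/eq_bigr => y Py.
  by rewrite pi_scl (pi_KL (hf y Py) (uKL (hf y Py))).
have -> : h = scl 1 (h - g) + g by apply/ffunP => z; rewrite !ffunE mul1r subrK.
rewrite PhiL (PhiK K) Phi_sum.
have -> : scl 1 0 = 0 :> Nt n by apply/ffunP => z; rewrite !ffunE mulr0.
by rewrite add0r; apply: eq_bigr => y Py; rewrite PhiU // hf.
Qed.

Lemma actV_delta i c : actV i (delta c) = scl (actE i c).1 (delta (actE i c).2).
Proof.
apply/ffunP => d; rewrite !ffunE (bigD1 c) //= big1 ?addr0.
  rewrite !ffunE eqxx mul1r [d == _]eq_sym.
  by case: ifP => _; rewrite ?mulr1 ?mulr0.
by move=> c' /negbTE h; rewrite ffunE h mul0r; case: ifP.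
Qed.

Lemma actV_sum (I : finType) (P : pred I) (a : I -> L) (F : I -> Nt n) i :
  actV i (\sum_(y | P y) scl (a y) (F y)) = \sum_(y | P y) scl (a y) (actV i (F y)).
Proof.
apply/ffunP => d; rewrite [LHS]ffunE.
transitivity (\sum_(y | P y) scl (a y) (actV i (F y)) d); last by rewrite sum_ffunE.
under [RHS]eq_bigr => y _ do rewrite sclE ffunE big_distrr /=.
rewrite exchange_big /=; apply: eq_bigr => c _; rewrite sum_ffunE; case: ifP => _.
  by rewrite big_distrl; apply: eq_bigr => y _; rewrite sclE mulrA.
by rewrite big1 // => y _; rewrite mulr0.
Qed.

Theorem Phi_intertwines i h : inH h -> Phi (rmulCs h i) = actV i (Phi h).
Proof.
move=> hH; have [a ha] := Kw_span (v := prj h) (fun al hp => pi_par h hp).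
rewrite (Phi_eq (P := mem (Wp n)) (f := id) hH _ ha) // actV_sum.
(* For [w] in [Wp n] the default is reached only when the scalar of e_i on the diagram is 0, so its
   value does not matter. *)
pose f w := odflt 1%g [pick v in Wp n | cupD v == (actE i (cupD w)).2].
have fW w : f w \in Wp n.
  by rewrite /f; case: pickP => [v /andP[]//|_] /=; exact: one_Wp.
have fE w : w \in Wp n -> (actE i (cupD w)).1 = 0 \/ cupD (f w) = (actE i (cupD w)).2.
  move=> hw; case: (actE_closed i hw) => [|[v hv ev]]; [by left|right].
  by rewrite /f; case: pickP => [x /andP[_ /eqP]//|/(_ v)]; rewrite hv ev eqxx.
rewrite (@Phi_eq _ (mem (Wp n)) (fun w => a w * (actE i (cupD w)).1) f) //.
- apply: eq_bigr => w hw; rewrite actV_delta; case: (fE w hw) => [->|->];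
    by apply/ffunP => d; rewrite !sclE ?mulr0 ?mul0r ?mulr0 ?mulrA.
- exact: inH_rmulCs.
- move=> al; rewrite pi_rmulCs // (Cop_ext i ha) Cop_sum; apply: eq_bigr => w hw.
  rewrite (Cop_Kc i al hn (cupD_cup w)) -mulrA; congr (_ * _); rewrite /Kw.
  by case: (fE w hw) => ->; rewrite ?mul0r.
Qed.

End Phi.
End CanonicalBasis.

(** * Words in the e_i *)

Section Words.
Variables (n : nat) (hn : (1 < n)%N).
Implicit Types (i j : 'I_n) (w : {perm Pt n}) (al be : Sg n) (D : Dg n) (t : word n).

Definition Cw t (m : Sg n -> L) : Sg n -> L := foldr (fun i m => Cop i m) m t.

(** Same coordinates in the basis of cup diagrams and in the [Kw]. It transports the action of words
    from diagrams to functions, and vanishing in both directions ([realizes_eq0]). *)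
Definition realizes (v : Nt n) (m : Sg n -> L) := exists a,
  v = \sum_(w in Wp n) scl (a w) (delta (cupD w)) /\
  (forall al, m al = \sum_(w in Wp n) a w * Kw w al).

Lemma realizes_ext v m m' : m =1 m' -> realizes v m -> realizes v m'.
Proof. by move=> e [a [h1 h2]]; exists a; split=> // al; rewrite -e. Qed.

Lemma realizes0 : realizes 0 (fun=> 0).
Proof.
exists (fun=> 0); split=> [|al]; rewrite big1 // => w _; last by rewrite mul0r.
by apply/ffunP => d; rewrite !ffunE mul0r.
Qed.

Lemma realizesD v m v' m' : realizes v m -> realizes v' m' ->
  realizes (v + v') (fun al => m al + m' al).
Proof.
move=> [a [-> h2]] [b [-> h4]]; exists (fun w => a w + b w); split=> [|al].
  by rewrite -big_split; apply: eq_bigr => w _; apply/ffunP => d; rewrite !ffunE mulrDl.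
by rewrite h2 h4 -big_split; apply: eq_bigr => w _; rewrite mulrDl.
Qed.

Lemma realizes_scl c v m : realizes v m -> realizes (scl c v) (fun al => c * m al).
Proof.
move=> [a [-> h2]]; exists (fun w => c * a w); split=> [|al].
  apply/ffunP => d; rewrite sclE !sum_ffunE big_distrr; apply: eq_bigr => w _.
  by rewrite /= !sclE mulrA.
by rewrite h2 big_distrr; apply: eq_bigr => w _; rewrite /= mulrA.
Qed.

Lemma realizes_sum (I : Type) (r : seq I) (P : pred I) (c : I -> L) (v : I -> Nt n) m :
  (forall x, P x -> realizes (v x) (m x)) ->
  realizes (\sum_(x <- r | P x) scl (c x) (v x)) (fun al => \sum_(x <- r | P x) c x * m x al).
Proof.
move=> H; elim: r => [|x r IH].
  by rewrite big_nil; apply: realizes_ext realizes0 => al; rewrite big_nil.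
rewrite big_cons; case hx: (P x); last by apply: realizes_ext IH => al; rewrite big_cons hx.
have := realizesD (realizes_scl (c x) (H x hx)) IH.
by apply: realizes_ext => al; rewrite big_cons hx.
Qed.

Lemma realizes_cup w : w \in Wp n -> realizes (delta (cupD w)) (Kw w).
Proof.
move=> hw; exists (fun x => (x == w)%:R); split=> [|al].
  apply/ffunP => d; rewrite sum_ffunE (bigD1 w) //= sclE eqxx mul1r big1 ?addr0 //.
  by move=> x /andP[_ /negbTE h]; rewrite sclE h mul0r.
rewrite (bigD1 w) //= eqxx mul1r big1 ?addr0 //.
by move=> x /andP[_ /negbTE h]; rewrite h mul0r.
Qed.

Lemma realizes_actV i v m : realizes v m -> realizes (actV i v) (Cop i m).
Proof.
move=> [a [-> h2]]; rewrite actV_sum.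
have H w : w \in Wp n -> realizes (actV i (delta (cupD w))) (Cop i (Kw w)).
  move=> hw; rewrite actV_delta; have E al := Cop_Kc i al hn (cupD_cup w).
  case: (actE_closed hn i hw) => [h0|[x hx ex]].
    have -> : scl (actE i (cupD w)).1 (delta (actE i (cupD w)).2) = 0.
      by apply/ffunP => d; rewrite sclE h0 mul0r ffunE.
    by apply: realizes_ext realizes0 => al; rewrite E h0 mul0r.
  have := realizes_scl (actE i (cupD w)).1 (realizes_cup hx); rewrite ex.
  by apply: realizes_ext => al; rewrite E -ex.
have := realizes_sum (index_enum _) a H; apply: realizes_ext => al.
by rewrite -Cop_sum; apply: Cop_ext => be; rewrite h2.
Qed.

Lemma realizes_actW t v m : realizes v m -> realizes (actW t v) (Cw t m).
Proof. by move=> h; elim: t => //= i t IH; apply: realizes_actV. Qed.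

Lemma realizes_actF (f : seq (L * word n)) v m : realizes v m ->
  realizes (actF f v) (fun al => \sum_(x <- f) x.1 * Cw x.2 m al).
Proof.
by move=> h; apply: realizes_sum => x _; apply: realizes_actW.
Qed.

Lemma realizes_eq0 v m : realizes v m -> (v = 0 <-> forall al, m al = 0).
Proof.
move=> [a [h1 h2]]; split=> [v0 al|m0].
  have a0 w : w \in Wp n -> a w = 0.
    move=> hw; have := congr1 (fun g : Nt n => g (cupD w)) v0.
    rewrite h1 sum_ffunE (bigD1 w) //= sclE ffunE eqxx mulr1 big1 ?addr0 ?ffunE // => x /andP[hx nx].
    rewrite sclE ffunE; case: eqP => [E|]; rewrite ?mulr0 //.
    have := congr1 (@stdlab n) E; rewrite !stdlab_cupD => /(alpha_inj hn hw hx) E2.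
    by rewrite E2 eqxx in nx.
  by rewrite h2 big1 // => w hw; rewrite a0 // mul0r.
rewrite h1 big1 // => w hw; apply/ffunP => d; rewrite sclE (Kw_free hn (a := a)) // ?mul0r ?ffunE //.
by move=> al; rewrite -h2.
Qed.

Lemma Cw_ext t m m' : m =1 m' -> Cw t m =1 Cw t m'.
Proof. by move=> h; elim: t => //= i t IH; apply: Cop_ext. Qed.

Lemma Cw_sum (I : finType) (P : pred I) (a : I -> L) (m : I -> Sg n -> L) t al :
  Cw t (fun be => \sum_(x | P x) a x * m x be) al = \sum_(x | P x) a x * Cw t (m x) al.
Proof.
elim: t al => //= i t IH al; rewrite (Cop_ext i IH); exact: Cop_sum.
Qed.

Definition pt_mass be al : L := (be == al)%:R.

Lemma pt_mass_sum (m : Sg n -> L) al : m al = \sum_be m be * pt_mass be al.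
Proof.
rewrite (bigD1 al) //= /pt_mass eqxx mulr1 big1 ?addr0 // => be /negbTE h.
by rewrite h mulr0.
Qed.

(** The [Kw w] and the point masses at even labels span the same space, so an element acts by zero
    exactly when the even columns of its matrix vanish. *)
Lemma kernel_even (f : seq (L * word n)) :
  (forall w, w \in Wp n -> actF f (delta (cupD w)) = 0) <->
  (forall al be, par be = false -> \sum_(x <- f) x.1 * Cw x.2 (pt_mass be) al = 0).
Proof.
have lin (I : finType) (P : pred I) (a : I -> L) (m : I -> Sg n -> L) m0 al :
    (forall be, m0 be = \sum_(y | P y) a y * m y be) ->
    \sum_(x <- f) x.1 * Cw x.2 m0 al = \sum_(y | P y) a y * \sum_(x <- f) x.1 * Cw x.2 (m y) al.
  move=> h; under eq_bigr => x _ do rewrite (Cw_ext x.2 h) Cw_sum big_distrr /=.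
  rewrite exchange_big /=; apply: eq_bigr => y _; rewrite big_distrr /=.
  by apply: eq_bigr => x _; rewrite mulrCA.
split=> H.
  move=> al be hbe.
  have [|a ha] := @Kw_span n hn (pt_mass be).
    by move=> x hx; rewrite /pt_mass; case: eqP => // E; rewrite -E hbe in hx.
  rewrite (lin _ _ _ _ _ al ha) big1 // => w hw.
  have [/(_ (H w hw)) -> _] := realizes_eq0 (realizes_actF f (realizes_cup hw)).
  by rewrite mulr0.
move=> w hw; apply/(realizes_eq0 (realizes_actF f (realizes_cup hw))) => al.
rewrite (lin _ _ _ _ _ al (pt_mass_sum (Kw w))) big1 // => be _.
case hbe: (par be); last by rewrite H ?mulr0.
by rewrite Kw_par ?mul0r // Wp_Wgrp.
Qed.

(** An undotted strand has different labels at its ends, so complementing the bottom label turns the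
    kernel of the identity diagram into the identity matrix, up to the factor q^[weight be]. *)
Definition neg be : Sg n := [ffun j => ~~ be j].
Definition weight be : nat := (\sum_j be j)%N.

(** * Matrix entries of words *)

Definition full D := forall p, D.1 p != p.

Lemma jn_full i D : matching D -> full D -> full (jn i D).
Proof.
move=> mD fD p; case: (ptP i mD p) => [->|->|h ->|h ->|h1 h2].
- by rewrite jn1_lo thi_neq_tlo.
- by rewrite jn1_hi // tlo_neq_thi.
- by rewrite jn1_x // (inj_eq (match_inj mD)) thi_neq_tlo.
- by rewrite jn1_y // (inj_eq (match_inj mD)) tlo_neq_thi.
- by rewrite jn1_o.
Qed.

Lemma idD_planar : planar (idD n).
Proof.
have E (b : bool) j : (idD n).1 (b, j) = (~~ b, j) by rewrite ffunE.
split; first split.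
- by move=> [b j]; rewrite !E negbK.
- by move=> p; rewrite !ffunE.
- by move=> [b j]; rewrite E => -[] /eqP; case: b.
- by move=> j; rewrite E xpair_eqE.
- move=> [b j] [c k]; rewrite !E; have := ltn_ord j; have := ltn_ord k.
  by case: b; case: c; rewrite !(pos_bot, pos_top); lia.
- by move=> p r; rewrite ffunE.
Qed.

Lemma idD_full : full (idD n).
Proof. by move=> [b j]; rewrite ffunE xpair_eqE; case: b. Qed.

Lemma redW_planar t : planar (redW t).2 /\ full (redW t).2.
Proof.
elim: t => [|i t [IH1 IH2]] /=; first by split; [exact: idD_planar|exact: idD_full].
have m1 : matching (redW t).2 := IH1.
by rewrite compD_jn //; split; [apply: jn_planar|apply: jn_full].
Qed.

Lemma sum_Pt (F : Pt n -> nat) : (\sum_p F p = \sum_j F (false, j) + \sum_j F (true, j))%N.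
Proof.
transitivity (\sum_(b : bool) \sum_j F (b, j))%N; last by rewrite big_bool addnC.
by rewrite pair_bigA; apply: eq_bigr => -[b j] _.
Qed.

Lemma Kd_id al be : Kd (idD n) (glue al (neg be)) = qL ^+ weight be * pt_mass be al.
Proof.
have E (b : bool) j : (idD n).1 (b, j) = (~~ b, j) by rewrite ffunE.
have d0 p : (idD n).2 p = false by rewrite ffunE.
have bt (j : 'I_n) : (n + (n - j.+1) < j)%N = false by have := ltn_ord j; lia.
have tb (j : 'I_n) : (j < n + (n - j.+1))%N by have := ltn_ord j; lia.
rewrite KdE mulrC /pt_mass; congr (qL ^+ _ * (nat_of_bool _)%:R).
  rewrite /flips big_mkcond sum_Pt /weight big1 => [|j _]; last by rewrite E !(pos_bot, pos_top) bt.
  apply: eq_bigr => j _; rewrite E !(pos_bot, pos_top) tb glue_bot ffunE.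
  by rewrite negbK.
apply/forallP/eqP => [h|-> [[] j]].
- apply/ffunP => j; have := h (true, j); rewrite E d0 !(pos_bot, pos_top) tb glue_top glue_bot ffunE /=.
  by case: (be j); case: (al j).
- by rewrite E d0 !(pos_bot, pos_top) tb glue_top glue_bot ffunE; case: (al j).
- by rewrite E !(pos_bot, pos_top) bt.
Qed.

Lemma word_matrix t al be :
  qL ^+ weight be * Cw t (pt_mass be) al = (redW t).1 * Kd (redW t).2 (glue al (neg be)).
Proof.
elim: t al => [|i t IH] al /=; first by rewrite mul1r Kd_id.
have [pD fD] := redW_planar t; have mD : matching (redW t).2 := pD.
have -> : qL ^+ weight be * Cop i (Cw t (pt_mass be)) al =
    Cop i (fun al => (redW t).1 * Kd (redW t).2 (glue al (neg be))) al.
  by rewrite -Cop_scale; apply: Cop_ext => x; rewrite IH.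
rewrite Cop_scale Cop_glue // compD_jn // loopScal_jn // mulrA; congr (_ * _).
exact: mulrC.
Qed.

Lemma Cw_par t m (b : bool) : (forall al, par al != b -> m al = 0) ->
  forall al, par al != b -> Cw t m al = 0.
Proof. by move=> h; elim: t => //= i t IH; apply: Cop_par. Qed.

(** A compatible label gives a nonzero matrix entry, and the operators [Cop] preserve parity; no
    count of dots on the diagram is required. *)
Lemma word_par t al be : (redW t).1 != 0 -> compat (redW t).2 (glue al (neg be)) -> par al = par be.
Proof.
move=> h hc; apply/eqP/negPn/negP => ne.
have := word_matrix t al be; rewrite (@Cw_par t (pt_mass be) (par be)) ?mulr0 //; last first.
  by move=> x hx; rewrite /pt_mass; case: eqP => // E; rewrite -E eqxx in hx.
rewrite KdE hc mul1r => /esym/eqP; apply/negP.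
exact: mul_qX_neq0.
Qed.

Lemma word_sum (f : seq (L * word n)) al be :
  qL ^+ weight be * \sum_(x <- f) x.1 * Cw x.2 (pt_mass be) al =
  \sum_D rhoF f D * Kd D (glue al (neg be)).
Proof.
rewrite big_distrr /=; under [RHS]eq_bigr => D _ do rewrite ffunE big_distrl /=.
rewrite exchange_big /=; apply: eq_bigr => x _.
rewrite mulrCA word_matrix (bigD1 (redW x.2).2) //= eqxx big1 ?addr0 ?mulrA // => D /negbTE h.
by rewrite eq_sym h mul0r.
Qed.

Lemma rhoF_word (f : seq (L * word n)) D : rhoF f D != 0 ->
  exists2 t, D = (redW t).2 & (redW t).1 != 0.
Proof.
rewrite ffunE => h; case: (boolP (has (fun x => ((redW x.2).2 == D) && ((redW x.2).1 != 0)) f)).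
  by case/hasP => x _ /andP[/eqP <- h1]; exists x.2.
move/hasPn => N; move: h; rewrite big_seq big1 ?eqxx // => x /N.
by case: eqP => //= _ /negPn/eqP ->; rewrite mulr0.
Qed.

Definition plain_cups D : {set 'I_n} :=
  [set j : 'I_n | (j < (D.1 (false, j)).2)%N && ~~ D.2 (false, j)].

Lemma par_no_through D al be : matching D -> (forall j, ~~ (D.1 (false, j)).1) ->
  compat D (glue al be) -> par al = odd #|plain_cups D|.
Proof.
move=> mD top hc; have K := hfK false mD.
have hD j : D.1 (false, j) = (false, hf false D j) by apply: hfE; rewrite (negbTE (top j)).
have nf j : hf false D j != j.
  by apply/eqP => E; have := match_top mD j; rewrite hD E eqxx.
have cj j : al j (+) al (hf false D j) = ~~ D.2 (false, j).
  have := compatP mD hc (match_top mD j); rewrite hD !glue_top.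
  by case: (al j); case: (al _); case: (D.2 _).
rewrite /par (big_pairs _ _ K) /= big_pred0 => [|j]; last by rewrite (negbTE (nf j)).
rewrite addFb (reindex_inj (inv_inj K)) /=.
under eq_big => [j|j _] do [rewrite K|rewrite K addbC cj].
rewrite -sum1_card (big_morph odd oddD (erefl : odd 0 = false)) /=.
rewrite [LHS]big_mkcond [RHS]big_mkcond /=; apply: eq_bigr => j _.
by rewrite !inE hD /=; case: (j < _)%N; case: (D.2 _).
Qed.

Lemma bad_par D al be : matching D -> badD D -> compat D (glue al be) -> par al.
Proof. by move=> mD /andP[/forallP top od] /(par_no_through mD top) ->. Qed.

End Words.

(** * Linear independence of diagrams *)

Section Independence.
Variables (n : nat) (hn : (1 < n)%N).
Implicit Types (i j : 'I_n) (al be : Sg n) (D : Dg n).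

Lemma negE be j : neg be j = ~~ be j. Proof. by rewrite ffunE. Qed.

Definition bottom_caps D : nat := (\sum_(j | (hf true D j < j)%N) 1)%N.
(* Unlike [flips], [cost] does not see the through strands; this is what makes the diagonal entries below minimal. *)
Definition cost D al be : nat :=
  (\sum_(j | (hf false D j < j)%N) ~~ al j + \sum_(j | (hf true D j < j)%N) ~~ be j)%N.

Lemma top_pos D j : matching D -> (pos (D.1 (false, j)) < j)%N = (hf false D j < j)%N.
Proof.
move=> mD; case: (boolP ((D.1 (false, j)).1 == false)) => h; first by rewrite (hfE h).
rewrite hf_ray // ltnn ltnNge (leq_trans _ (pos_bot_ge _)) //; first exact: ltnW.
by move: h; case: (_.1).
Qed.

Lemma bot_pos D j : full D -> (pos (D.1 (true, j)) < pos (true, j))%N = ~~ (hf true D j < j)%N.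
Proof.
move=> fD; case: (boolP ((D.1 (true, j)).1 == true)) => h; last first.
  rewrite hf_ray // ltnn pos_bot (leq_trans (pos_top_lt _)) ?leq_addr //.
  by move: h; case: (_.1).
have ne := fD (true, j); rewrite (hfE h) xpair_eqE /= -val_eqE /= in ne.
rewrite (hfE h) !pos_bot; have := ltn_ord j; have := ltn_ord (hf true D j).
move: (nat_of_ord (hf true D j)) (nat_of_ord j) ne => a b; rewrite ltn_add2l -leqNgt.
by clear; case: (leqP b a) => h ne ha hb; [have : (b < a)%N by rewrite ltn_neqAle eq_sym ne|]; lia.
Qed.

(** On the bent line the right end of a bottom arc is its left end on the face, so [flips] counts
    the minus signs of [be] there and on through strands. Adding 1 = b + not b at the other end of
    each arc completes this count to [weight be], common to all diagrams. *)
Lemma flips_cost D al be : matching D -> full D ->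
  (flips D (glue al (neg be)) + bottom_caps D = weight be + cost D al be)%N.
Proof.
move=> mD fD; rewrite /flips big_mkcond sum_Pt /cost addnCA -addnA; congr addn.
  rewrite [RHS]big_mkcond; apply: eq_bigr => j _.
  by rewrite pos_top top_pos // glue_top.
rewrite /bottom_caps /weight [X in (_ + X)%N = _]big_mkcond [X in _ = (_ + X)%N]big_mkcond -!big_split.
apply: eq_bigr => j _; rewrite /= bot_pos // glue_bot negE negbK.
by case: (_ < _)%N; case: (be j).
Qed.

Lemma Kd_cost D al be : matching D -> full D ->
  Kd D (glue al (neg be)) =
  qL ^+ weight be * (qiL ^+ bottom_caps D * (compat D (glue al (neg be)))%:R * qL ^+ cost D al be).
Proof.
move=> mD fD; apply: (@L_mulI (bottom_caps D)).
rewrite KdE mulrCA -exprD addnC flips_cost // exprD.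
rewrite [RHS]mulrCA !mulrA -[RHS]mulrA -[_ * qiL ^+ _]mulrA.
have := qXqi (bottom_caps D); set X := qL ^+ bottom_caps D; set Y := qiL ^+ bottom_caps D.
set W := qL ^+ weight be; set C := qL ^+ cost _ _ _; set c := _%:R => e.
have -> : W * (X * Y) * (c * C) = W * (X * Y) * c * C by ring.
by rewrite e mulr1; ring.
Qed.

Definition first_ray D j := [forall k : 'I_n, (hf false D k == k) ==> (j <= k)%N].

(* The leading entry of [D]: arcs in their cheap orientation, through strands labelled "+" on top except possibly the leftmost one, whose label [e] adjusts the parity. *)
Definition lead_top (e : bool) D : Sg n :=
  [ffun j => if hf false D j == j then e && first_ray D j
             else (hf false D j < j)%N || D.2 (false, j)].
Definition lead_bot (e : bool) D : Sg n :=
  [ffun j => if hf true D j == j then lead_top e D (D.1 (true, j)).2 (+) D.2 (true, j)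
             else (hf true D j < j)%N || D.2 (true, j)].

Lemma lead_topE e D j : lead_top e D j =
  if hf false D j == j then e && first_ray D j else (hf false D j < j)%N || D.2 (false, j).
Proof. by rewrite ffunE. Qed.
Lemma lead_botE e D j : lead_bot e D j =
  if hf true D j == j then lead_top e D (D.1 (true, j)).2 (+) D.2 (true, j)
  else (hf true D j < j)%N || D.2 (true, j).
Proof. by rewrite ffunE. Qed.

Lemma through_top D j : full D -> hf false D j = j -> (D.1 (false, j)).1.
Proof.
move=> fD E; apply/negPn/negP => h; have := fD (false, j).
by rewrite (@hfE _ false D j) ?E ?eqxx // (negbTE h).
Qed.

Lemma through_bot D j : full D -> hf true D j = j -> (D.1 (true, j)).1 = false.
Proof.
move=> fD E; apply/negP => h; have := fD (true, j).
by rewrite (@hfE _ true D j) ?E ?eqxx // h.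
Qed.

Lemma throughP D j : matching D -> full D -> hf false D j = j ->
  exists k, [/\ D.1 (false, j) = (true, k), D.1 (true, k) = (false, j) & hf true D k = k].
Proof.
move=> mD fD E; have := through_top fD E; case e : (D.1 (false, j)) => [[] k] // _; exists k.
have e2 : D.1 (true, k) = (false, j) by rewrite -e matchK.
by split=> //; rewrite hf_ray // e2.
Qed.

Lemma throughP' D k : matching D -> full D -> hf true D k = k ->
  exists j, [/\ D.1 (true, k) = (false, j), D.1 (false, j) = (true, k) & hf false D j = j].
Proof.
move=> mD fD E; have := through_bot fD E; case e : (D.1 (true, k)) => [[] j] // _; exists j.
have e2 : D.1 (false, j) = (true, k) by rewrite -e matchK.
by split=> //; rewrite hf_ray // e2.
Qed.

Lemma through_mono D j j' k k' : planar D ->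
  D.1 (false, j) = (true, k) -> D.1 (false, j') = (true, k') -> (j < j')%N -> (k < k')%N.
Proof.
move=> pD e e' lt; rewrite ltnNge leq_eqVlt; apply/negP => /orP[/eqP E|h].
  have := e; rewrite -(val_inj E) -e' => /(match_inj pD) [E2].
  by rewrite E2 ltnn in lt.
apply: (@planar_nc _ D pD (false, j) (false, j')); rewrite ?e ?e' ?pos_top ?pos_bot //;
  have := ltn_ord j'; have := ltn_ord k; have := ltn_ord k'; lia.
Qed.

Lemma arc_label (b : bool) D j : matching D -> full D -> hf b D j != j ->
  ((hf b D j < j)%N || D.2 (b, j)) (+) ((j < hf b D j)%N || D.2 (b, hf b D j)) = ~~ D.2 (b, j).
Proof.
move=> mD fD ne; have -> : D.2 (b, hf b D j) = D.2 (b, j) by rewrite -(hfD ne) match_dot.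
by move: ne; rewrite -val_eqE /=; case: ltngtP => // _ _; case: (D.2 _).
Qed.

Lemma lead_compat e D : planar D -> full D ->
  compat D (glue (lead_top e D) (neg (lead_bot e D))).
Proof.
move=> pD fD; have mD : matching D := pD; apply/forallP => p; apply/implyP => _.
have arc b j : hf b D j != j -> hf b D (hf b D j) != hf b D j.
  by rewrite (inj_eq (inv_inj (hfK b mD))).
case: p => [[] j].
  case: (hf true D j =P j) => [E|/eqP ne].
    have [i [e1 e2 e3]] := throughP' mD fD E.
    rewrite e1 glue_top glue_bot negE lead_botE E eqxx e1 /=.
    by case: (lead_top _ _ _); case: (D.2 _).
  rewrite hfD // !glue_bot !negE !lead_botE (negbTE ne) (negbTE (arc _ _ ne)) hfK //.
  by have := arc_label mD fD ne; case: (_ || _); case: (_ || _); case: (D.2 _).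
case: (hf false D j =P j) => [E|/eqP ne].
  have [i [e1 e2 e3]] := throughP mD fD E.
  rewrite e1 glue_top glue_bot negE lead_botE e3 eqxx e2 /=.
  have -> : D.2 (false, j) = D.2 (true, i) by rewrite -e1 match_dot.
  by case: (lead_top _ _ _); case: (D.2 _).
rewrite hfD // !glue_top !lead_topE (negbTE ne) (negbTE (arc _ _ ne)) hfK //.
by have := arc_label mD fD ne; case: (_ || _); case: (_ || _); case: (D.2 _).
Qed.

Lemma lead_cost e D : cost D (lead_top e D) (lead_bot e D) = 0%N.
Proof.
by rewrite /cost !big1 // => j h; rewrite ?lead_topE ?lead_botE h -val_eqE /= (ltn_eqF h).
Qed.

Lemma lead_standard e D : matching D ->
  standard (hf false D) (hd false D) (lead_top e D) /\
  standard (hf true D) (hd true D) (lead_bot e D).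
Proof.
move=> mD; have S b (al : Sg n) : (forall j, hf b D j != j -> al j = (hf b D j < j)%N || D.2 (b, j)) ->
    standard (hf b D) (hd b D) al.
  move=> H j h; have ne : hf b D j != j by rewrite -val_eqE /= gtn_eqF.
  have ne' : hf b D (hf b D j) != hf b D j by rewrite (inj_eq (inv_inj (hfK b mD))).
  rewrite !H // hfK // h ltnNge (ltnW h) /=; split=> //.
  by rewrite /hd hfD // eqxx.
by split; apply: S => j ne; rewrite ?lead_topE ?lead_botE (negbTE ne).
Qed.

(** On the bottom the label of a strand also absorbs its dot; only the leftmost strand can be
    dotted, so the later ones remain plus. *)
Lemma lead_rays e D : planar D -> full D ->
  only_first_ray_minus (hf false D) (lead_top e D) /\
  only_first_ray_minus (hf true D) (lead_bot e D).
Proof.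
move=> pD fD; have mD : matching D := pD.
have T : only_first_ray_minus (hf false D) (lead_top e D).
  move=> j k Ej Ek lt; rewrite lead_topE Ej eqxx; apply/negP => /andP[_ /forallP /(_ k)].
  by rewrite Ek eqxx leqNgt lt.
split=> // k k' Ek Ek' lt.
have [j [e1 e2 e3]] := throughP' mD fD Ek; have [j' [e1' e2' e3']] := throughP' mD fD Ek'.
have lt' : (j' < j)%N.
  case: (ltngtP j' j) => // [h|/val_inj h].
    by have := through_mono pD e2 e2' h; lia.
  by move: e2' lt; rewrite h e2 => -[->]; rewrite ltnn.
rewrite lead_botE Ek eqxx e1 /= (T j j' e3 e3' lt') addFb; apply/negP => d.
apply: (@planar_exp _ D pD (false, j) (false, j')); rewrite ?e2 ?e2' ?pos_top ?pos_bot //.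
- by rewrite -(match_dot mD) e2.
- by have := ltn_ord j; lia.
- by have := ltn_ord k; lia.
Qed.

Definition same_side D : {set Pt n} := [set p | (D.1 p).1 == p.1].

Lemma same_sideE D (b : bool) j : full D -> ((b, j) \in same_side D) = (hf b D j != j).
Proof.
move=> fD; rewrite inE /=; case: (boolP (_ == b)) => h; last by rewrite hf_ray ?eqxx.
by have := fD (b, j); rewrite (hfE h) xpair_eqE eqxx.
Qed.

Lemma cheap_standard D al be : planar D -> full D -> compat D (glue al (neg be)) ->
  cost D al be = 0%N ->
  standard (hf false D) (hd false D) al /\ standard (hf true D) (hd true D) be.
Proof.
move=> pD fD hc /eqP; rewrite addn_eq0 !sum_nat_eq0 => /andP[/forallP t /forallP b].
have mD : matching D := pD.
split=> j h.
  have ne : hf false D j != j by rewrite -val_eqE /= gtn_eqF.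
  have := t (hf false D j); rewrite hfK // h /=; case: (boolP (al _)) => // ak _; split=> //.
  have := compat_top pD hc ne; rewrite ak /hd hfD // eqxx /=.
  by case: (al j); case: (D.2 _).
have ne : hf true D j != j by rewrite -val_eqE /= gtn_eqF.
have := b (hf true D j); rewrite hfK // h /=; case: (boolP (be _)) => // ak _; split=> //.
have := compatP mD hc (fD (true, j)); rewrite hfD // !glue_bot !negE ak /hd hfD // eqxx /=.
by case: (be j); case: (D.2 _).
Qed.

(** Equal returning arcs leave the same points for through strands, which non-crossing joins in
    order. A label compatible with both diagrams then determines every dot. *)
Lemma same_arcs_eq D D' (a : lab n) : planar D -> planar D' -> full D -> full D' ->
  hf false D =1 hf false D' -> hf true D =1 hf true D' ->
  compat D a -> compat D' a -> D = D'.
Proof.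
move=> pD pD' fD fD' ht hb hc hc'; have mD : matching D := pD; have mD' : matching D' := pD'.
have through m : forall j, nat_of_ord j = m -> hf false D j = j -> D.1 (false, j) = D'.1 (false, j).
  have [B hB] := ubnP m; elim: B m hB => // B IH m hm j Ej E; rewrite -Ej ltnS in hm.
  have E' : hf false D' j = j by rewrite -ht.
  have [k [e1 e2 e3]] := throughP mD fD E; have [k' [e1' e2' e3']] := throughP mD' fD' E'.
  rewrite e1 e1'; congr pair; apply: val_inj; case: (ltngtP k k') => // lt.
    have [|x [x1 x2 x3]] := @throughP' D' k mD' fD'; first by rewrite -hb.
    have xj : (x < j)%N.
      case: (ltngtP x j) => // [h|/val_inj h]; first by have := through_mono pD' e1' x2 h; lia.
      by move: x2 lt; rewrite h e1' => -[->]; rewrite ltnn.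
    have x4 : hf false D x = x by rewrite ht.
    have h := IH x (leq_trans xj hm) x erefl x4.
    by have := match_inj mD (etrans e1 (esym (etrans h x2))) => -[h2]; rewrite h2 ltnn in xj.
  have [|x [x1 x2 x3]] := @throughP' D k' mD fD; first by rewrite hb.
  have xj : (x < j)%N.
    case: (ltngtP x j) => // [h|/val_inj h]; first by have := through_mono pD e1 x2 h; lia.
    by move: x2 lt; rewrite h e1 => -[->]; rewrite ltnn.
  have h := IH x (leq_trans xj hm) x erefl x3.
  by have := match_inj mD' (etrans e1' (esym (etrans (esym h) x2))) => -[h2]; rewrite h2 ltnn in xj.
have E p : D.1 p = D'.1 p.
  have T j : D.1 (false, j) = D'.1 (false, j).
    case: (hf false D j =P j) => [h|/eqP ne]; first exact: (through _ j erefl).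
    by rewrite !hfD // -?ht.
  case: p => [[] j] //.
  case: (hf true D j =P j) => [h|/eqP ne]; last by rewrite !hfD // -?hb.
  have [x [x1 x2 x3]] := throughP' mD fD h.
  by rewrite x1 -x2 T matchK.
apply/pair_eqP/andP; split; apply/eqP/ffunP => // p.
have := compatP mD hc (fD p); have := compatP mD' hc' (fD' p); rewrite E.
by case: (a _); case: (a _); case: (D.2 p); case: (D'.2 p).
Qed.

(** A unit entry means that the leading labels are standard for [D'] as well, so [half_compare] on
    each face shows that every returning arc of [D'] occurs in [D]. *)
Lemma leading_unique e D D' : planar D -> planar D' -> full D -> full D' ->
  compat D' (glue (lead_top e D) (neg (lead_bot e D))) ->
  cost D' (lead_top e D) (lead_bot e D) = 0%N ->
  D' = D \/ (#|same_side D'| < #|same_side D|)%N.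
Proof.
move=> pD pD' fD fD' hc hcost; have mD : matching D := pD; have mD' : matching D' := pD'.
have [S1 S2] := lead_standard e mD; have [R1 R2] := lead_rays e pD fD.
have [S1' S2'] := cheap_standard pD' fD' hc hcost.
have C1 := half_compare (half_top pD) (half_top pD') S1 R1 S1'.
have C2 := half_compare (half_bot pD (fun j => fD (true, j))) (half_bot pD' (fun j => fD' (true, j))) S2 R2 S2'.
have C (b : bool) j : hf b D' j != j -> hf b D j = hf b D' j.
  by case: b => ne; [have [] := C2 j ne|have [] := C1 j ne].
have sub : same_side D' \subset same_side D.
  by apply/subsetP => -[b j]; rewrite !same_sideE // => ne; rewrite C.
case: (eqVneq (same_side D') (same_side D)) => [E|ne]; [left|right]; last first.
  by apply: proper_card; rewrite properEneq ne.
have H b j : hf b D' j = hf b D j.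
  case: (hf b D' j =P j) => [h|/eqP /C //]; rewrite h; apply/esym/eqP/negPn.
  by rewrite -same_sideE // -E same_sideE // h eqxx.
exact: (same_arcs_eq pD' pD fD' fD (H false) (H true) hc (lead_compat e pD fD)).
Qed.

Lemma lead_par D : planar D -> full D -> ~~ badD D -> exists e, par (lead_top e D) = false.
Proof.
move=> pD fD nb; have mD : matching D := pD.
case: (pickP (fun j => hf false D j == j)) => [j0 hj0|none]; last first.
  have top j : ~~ (D.1 (false, j)).1.
    by apply/negP => h; have := none j; rewrite hf_ray ?eqxx // h.
  exists false; rewrite (par_no_through mD top (lead_compat false pD fD)).
  apply: contraNF nb => od; apply/andP; split=> //; exact/forallP.
have [j1 h1 hmin] := @arg_minnP _ j0 (fun j => hf false D j == j) (fun j => nat_of_ord j) hj0.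
(* The switch [e] affects a single point, the leftmost ray, and hence flips the parity. *)
have diff e j : lead_top e D j = lead_top false D j (+) (e && (j == j1)).
  rewrite !lead_topE; case: (boolP (hf false D j == j)) => hj; last first.
    by case: (j =P j1) => [E|_]; [rewrite E h1 in hj|rewrite andbF addbF].
  case: e => //=; apply/forallP/eqP => [h|-> k].
    apply: val_inj; apply/eqP; rewrite eqn_leq; have := h j1; rewrite h1 /= => ->; rewrite /=.
    exact: hmin.
  by apply/implyP => /hmin.
have parE : par (lead_top true D) = ~~ par (lead_top false D).
  rewrite /par; under eq_bigr => j _ do rewrite diff.
  have -> : \big[addb/false]_(j < n) (lead_top false D j (+) (j == j1)) =
      \big[addb/false]_j lead_top false D j (+) \big[addb/false]_j (j == j1) by rewrite big_split.
  rewrite [X in _ (+) X](bigD1 j1) //= eqxx [X in true (+) X]big1 ?addbT //.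
  by move=> j /negbTE.
by case E: (par (lead_top false D)); [exists true; rewrite parE E|exists false].
Qed.

Lemma independent (f : seq (L * word n)) :
  (forall al be, par be = false -> \sum_D rhoF f D * Kd D (glue al (neg be)) = 0) ->
  forall D, rhoF f D != 0 -> badD D.
Proof.
move=> H.
have W D : rhoF f D != 0 -> [/\ planar D, full D &
    forall al be, compat D (glue al (neg be)) -> par al = par be].
  move=> /rhoF_word [t -> ht]; have [p1 p2] := redW_planar hn t; split=> // al be.
  exact: word_par.
(* The factor q^-[bottom_caps D] varies with the diagram; it is absorbed into the coefficient before
   denominators are cleared. *)
have [k [P hP]] := common_denominator (fun D => rhoF f D * qiL ^+ bottom_caps D).
have P0 D : rhoF f D = 0 -> P D = 0.
  by move=> h; apply: polyL_inj; rewrite -hP h !mul0r polyL0.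
have E al be : par be = false -> 
    \sum_D P D * ((compat D (glue al (neg be)))%:R * 'X^(cost D al be)) = 0.
  move=> hbe; apply: polyL_inj; rewrite polyL_sum polyL0.
  apply: (@L_mulI (weight be)); rewrite mulr0 big_distrr /=.
  transitivity (\sum_D rhoF f D * Kd D (glue al (neg be)) * qL ^+ k); last first.
    by rewrite -big_distrl H /= ?mul0r.
  apply: eq_bigr => D _; rewrite polyLM -hP polyLM polyLXn.
  have -> (b : bool) : polyL b%:R = b%:R by case: b; rewrite ?polyL0 ?polyL1.
  have [->|/W [pD fD _]] := eqVneq (rhoF f D) 0; first by rewrite !mul0r mulr0.
  rewrite (Kd_cost al be pD fD).
  by move: (rhoF f D) (qL ^+ _) (qiL ^+ _) (qL ^+ k) (_ %:R) (qL ^+ _) => x1 x2 x3 x4 x5 x6; ring.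
have main N : forall M D, (N < M)%N -> rhoF f D != 0 -> ~~ badD D -> (P D)`_N = 0.
  move=> M; elim: M N => // M IHM N.
  suff S B : forall D, (#|same_side D| < B)%N -> (N <= M)%N -> rhoF f D != 0 -> ~~ badD D -> (P D)`_N = 0.
    by move=> D hN; apply: (S #|same_side D|.+1) => //.
  elim: B => // B IHB D hB hN hD nb.
  have [pD fD parD] := W D hD; have [e he] := lead_par pD fD nb.
  set al := lead_top e D in he *; set be := lead_bot e D.
  have hc : compat D (glue al (neg be)) by exact: lead_compat.
  have hbe : par be = false by rewrite -(parD _ _ hc).
  have := congr1 (fun p : {poly int} => p`_N) (E al be hbe).
  rewrite coef0 coef_sum (bigD1 D) //= hc lead_cost expr0 !mulr1 big1 ?addr0 // => D' ne.
  have [/P0 ->|hD'] := eqVneq (rhoF f D') 0; first by rewrite mul0r coef0.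
  have [pD' fD' parD'] := W D' hD'.
  case hc': (compat D' _); last by rewrite mul0r mulr0 coef0.
  rewrite mul1r coefMXn.
  (* The top label [al] is even, whereas a bad diagram is compatible only with odd top labels; this
     allows the induction hypotheses to be applied to [D']. *)
  have nb' : ~~ badD D'.
    by apply/negP => /(bad_par (pD' : matching D')) /(_ hc'); rewrite he.
  case: ltnP => // hN'; case: (posnP (cost D' al be)) => [c0|cpos].
    rewrite c0 subn0; apply: IHB => //.
    have [E2|lt] := leading_unique pD pD' fD fD' hc' c0; first by rewrite E2 eqxx in ne.
    exact: leq_trans lt _.
  have lt : (N - cost D' al be < M)%N by clear -cpos hN hN'; lia.
  exact: IHM lt hD' nb'.
move=> D hD; apply/negPn/negP => nb; move/eqP: (hD); apply.
have PD : P D = 0 by apply/polyP => N; rewrite coef0; exact: (main N N.+1 D (ltnSn N) hD nb).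
apply: (@L_mulI k); rewrite mulr0 mulrC; have := hP D; rewrite PD polyL0 => h.
have -> : rhoF f D * qL ^+ k = qL ^+ bottom_caps D * (rhoF f D * qiL ^+ bottom_caps D * qL ^+ k).
  rewrite -[in LHS](mulr1 (rhoF f D)) -(qXqi (bottom_caps D)).
  by move: (rhoF f D) (qL ^+ _) (qiL ^+ _) (qL ^+ k) => x1 x2 x3 x4; ring.
by rewrite h mulr0.
Qed.

End Independence.

(** * Faithfulness *)

(** Without through strands the n top points are paired off, so n is even; for odd n the quotient by
    the local relations is therefore already the right one. *)
Lemma odd_not_bad n (D : Dg n) : odd n -> matching D -> badD D -> False.
Proof.
move=> on mD /andP[/forallP top _]; have K := hfK false mD.
have nf j : hf false D j != j.
  apply/eqP => E; have := match_top mD j; rewrite (@hfE _ false D j) ?E ?eqxx //.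
  by rewrite (negbTE (top j)).
have := big_pairs (addn : Monoid.com_law 0%N) (fun=> 1%N) K.
rewrite sum1_card card_ord big_pred0 /= => [E|j]; last by rewrite (negbTE (nf j)).
by move: on; rewrite E sum_nat_const oddM andbF.
Qed.

Lemma faithful n (f : seq (L * word n)) : (1 < n)%N ->
  (forall w, w \in Wp n -> actF f (delta (cupD w)) = 0) <-> inKerTL f.
Proof.
move=> hn; rewrite (kernel_even hn).
have E al be : \sum_(x <- f) x.1 * Cw x.2 (pt_mass be) al = 0 <->
    \sum_D rhoF f D * Kd D (glue al (neg be)) = 0.
  rewrite -word_sum //; split=> [->|h]; first by rewrite mulr0.
  by apply: (@L_mulI (weight be)); rewrite h mulr0.
split=> [H|H al be hbe].
  have bad := independent hn (fun al be hbe => (E al be).1 (H al be hbe)).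
  rewrite /inKerTL; case: ifP => // on; apply/ffunP => D; rewrite [RHS]ffunE.
  apply/eqP/negPn/negP => hD; have [t Et _] := rhoF_word hD; have [pD _] := redW_planar hn t.
  by apply: (odd_not_bad on _ (bad D hD)); rewrite Et; apply: planar_matching.
(* At odd [al] the entry vanishes because words preserve parity; at even [al] it vanishes because
   every surviving diagram is bad and requires an odd top label. *)
case ha: (par al).
  rewrite big1_seq // => x _; rewrite (@Cw_par n hn _ (pt_mass be) false) ?mulr0 ?ha // => z hz.
  by rewrite /pt_mass; case: eqP => // e; rewrite -e hbe in hz.
apply/E; move: H; rewrite /inKerTL; case: ifP => [_ ->|_ H].
  by rewrite big1 // => D _; rewrite ffunE mul0r.
rewrite big1 // => D _; have [->|hD] := eqVneq (rhoF f D) 0; first by rewrite mul0r.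
have [t Et _] := rhoF_word hD; have [pD _] := redW_planar hn t; rewrite -Et in pD.
rewrite KdE; case hc: (compat D _); last by rewrite mul0r mulr0.
by have := bad_par (planar_matching pD) (H D hD) hc; rewrite ha.
Qed.

Theorem theorem4p16 (n : nat) (hn : (4 <= n)%N)
    (u : {perm Pt n} -> hk n) (Phi : hk n -> Nt n) :
  (* u w is a representative in H of the Kazhdan-Lusztig basis element of N *)
  (forall w, w \in Wp n -> isKL (u w) w) ->
  (* Phi is L-linear on N = H / kernel, with Phi(underline N_w) = underline w *)
  (forall (a : L) (h h' : hk n), Phi (scl a h + h') = scl a (Phi h) + Phi h') ->
  (forall x : hk n, inKer x -> Phi x = 0) ->
  (forall w, w \in Wp n -> Phi (u w) = delta (cupD w)) ->
  (forall (i : 'I_n) (h : hk n), inH h -> Phi (rmulCs h i) = actV i (Phi h))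
  /\
  (forall f : seq (L * word n),
     (forall w, w \in Wp n -> actF f (delta (cupD w)) = 0) <-> inKerTL f).
Proof.
move=> uKL PhiL PhiK PhiU; have n1 : (1 < n)%N by exact: leq_trans hn.
split=> [i h|f]; first exact: (Phi_intertwines n1 uKL PhiL PhiK PhiU).
exact: faithful.
Qed.
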